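(* Every flag pseudo-manifold of dimension at most three is pure-EKR. In particular, every flag simplicial manifold of dimension at most three is pure-EKR.
   Context: A simplicial complex $\mathcal C$ is a family of subsets (faces) of a finite ground set closed under taking subsets, with at least one vertex. The dimension of a face $\sigma$ is $|\sigma|-1$; facets are inclusion-maximal faces; $\mathcal C$ is pure if all facets have the same dimension $d$, and then ridges are the faces of dimension $d-1$. $\mathcal C$ is flag if every set of vertices that pairwise span edges is a face. A pseudo-manifold is a pure simplicial complex in which every ridge is contained in exactly two facets (no connectivity condition is imposed). A simplicial manifold is a simplicial complex whose underlying topological space is homeomorphic to a closed manifold. A family of facets is intersecting if no two of its members are disjoint. A pure simplicial complex is pure-EKR if the maximum size of an intersecting family of facets is attained by the family of all facets containing $v$, for some vertex $v$. *)

(* Defs.v *)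
From HB Require Import structures.
From mathcomp Require Import all_boot all_order all_algebra.
From mathcomp Require Import all_classical all_reals all_analysis.

Set Implicit Arguments.
Unset Strict Implicit.
Unset Printing Implicit Defensive.

Import Order.TTheory GRing.Theory Num.Theory.
Import numFieldNormedType.Exports.

Section Complexes.
Variable T : finType.
Implicit Types (C F : {set {set T}}) (A B S : {set T}).

(* The ground set [T] may have elements that are not vertices: the vertices of
   [C] are the [v] with [[set v] \in C]. *)
Definition simplicial_complex C : Prop :=
  (forall A B, A \in C -> B \subset A -> B \in C) /\
  (exists v : T, [set v] \in C).

(* Dimensions are shifted by one against cardinals: [#|A| = d.+1] says that [A]
   has dimension [d], and [#|A| = d] that it has dimension [d - 1], where
   [d - 1 = -1] is the dimension of the empty face. *)
Definition complex_dim C : nat := (\max_(A in C) #|A|).-1.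

Definition facets C : {set {set T}} := [set A | maxset [in C] A].

Definition pure C : Prop :=
  forall A B, A \in facets C -> B \in facets C -> #|A| = #|B|.

(* Only meant for pure complexes. *)
Definition ridges C : {set {set T}} := [set A in C | #|A| == complex_dim C].

Definition flag C : Prop :=
  forall S, (forall u, u \in S -> [set u] \in C) ->
    (forall u v, u \in S -> v \in S -> u != v -> [set u; v] \in C) ->
  S \in C.

Definition pseudo_manifold C : Prop :=
  [/\ simplicial_complex C, pure C &
      forall A, A \in ridges C -> #|[set B in facets C | A \subset B]| = 2].

Definition intersecting F : bool :=
  [forall A in F, forall B in F, ~~ [disjoint A & B]].

Definition max_intersecting C : nat :=
  \max_(F : {set {set T}} | (F \subset facets C) && intersecting F) #|F|.

Definition pure_EKR C : Prop :=
  pure C /\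
  exists2 v : T, [set v] \in C &
    #|[set A in facets C | v \in A]| = max_intersecting C.

End Complexes.

Local Open Scope classical_set_scope.
Local Open Scope ring_scope.

(* Barycentric coordinates: points of the standard simplex on [T] whose support
   is a face of [C], with the topology of [R^T]. *)
Definition realization (R : realType) (T : finType) (C : {set {set T}}) :
    set (prod_topology (fun _ : T => R)) :=
  [set x | [/\ forall v, 0 <= x v, \sum_(v : T) x v = 1 &
               [set v : T | x v != 0]%SET \in C]].
Arguments realization R {T} C.

Definition homeomorphic (X Y : topologicalType) : Prop :=
  exists (f : X -> Y) (g : Y -> X),
    [/\ continuous f, continuous g, cancel f g & cancel g f].

(* A subset [A] seen as a space is [set_type A], with the subspace topology
   (unlike [subspace A], whose carrier is the whole ambient type). *)
Definition locally_euclidean (R : realType) (n : nat) (M : topologicalType) :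
    Prop :=
  forall p : M, exists (U : set M) (V : set 'rV[R]_n),
    [/\ open U, U p, open V & homeomorphic (set_type U) (set_type V)].

Definition closed_manifold (R : realType) (n : nat) (M : topologicalType) :
    Prop :=
  [/\ compact [set: M], hausdorff_space M, @second_countable M &
      locally_euclidean R n M].

Definition simplicial_manifold (R : realType) (T : finType)
    (C : {set {set T}}) : Prop :=
  simplicial_complex C /\
  exists (n : nat) (M : topologicalType),
    closed_manifold R n M /\ homeomorphic (set_type (realization R C)) M.

(* Main.v *)
(* Let [F] be an intersecting family of facets of a flag pseudo-manifold of dimension
   3 and [X] one of its members; lower dimensions are similar and easier. Sort the
   members of [F] by their trace on [X]. Flagness makes complementary traces
   exclude each other: the two members would have a common vertex adjacent to all
   of [X]. Every subset of [X] is the trace of some facet, obtained by flipping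
   vertices of [X], and a proper trace with at least two vertices which does not
   meet every member of [F] comes from at most one member. So the star of [a] is
   at least as large as [F] whenever each trace avoiding [a] occurs at most once.
   The remaining configurations (an edge meeting all members, or several
   vertices of [X] that occur repeatedly as traces) are settled by comparing links
   of edges, which are cycles of length at least four.

   A triangulated manifold of positive dimension is a pseudo-manifold by invariance of
   domain, applied to affine coordinates on the open star of a facet (purity) or of
   a ridge (a single facet containing it would be a half-space, three would be a
   book with three pages). Invariance of domain follows Tao's proof, with
   Brouwer's theorem replaced by the Poincare-Miranda theorem. *)

Require Import Defs.
From mathcomp Require Import all_boot all_order all_algebra.
From mathcomp Require Import all_classical all_reals all_analysis.
From mathcomp Require Import zify ring lra.

Set Implicit Arguments.
Unset Strict Implicit.
Unset Printing Implicit Defensive.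

(** * Flag pseudo-manifolds of dimension at most three *)

(** The count is a budget. Each subset of [X] through [a] is the trace of some facet, so a trace
    avoiding [a] that occurs once in [F] is paid for by its complement, which is absent from [F] but
    present in the star. Only repeated traces avoiding [a] can overdraw; for [d = 3], when no edge
    meets all members, these are single vertices. Members with different such traces have to meet
    outside [X], and this is very restrictive: nearly every local contradiction exhibits five
    pairwise adjacent vertices or three facets on one triangle. On the topological side, Tao extends
    the inverse by Tietze's theorem and approximates it by polynomials. Here one infimal convolution
    does both and is Lipschitz, so that counting cells can replace measure zero. The
    Poincare-Miranda theorem comes from a mod 2 cup product on a cubical grid, evaluated by Stokes'
    formula. Manifolds of dimension 0 need not be pseudo-manifolds and are treated apart. *)

Lemma face_in_facet (T : finType) (C : {set {set T}}) A : A \in C ->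
  exists2 B, B \in facets C & A \subset B.
Proof.
move=> AC; have [B Bmax AB] := @maxset_exists T [in C] A AC.
by exists B; rewrite ?inE.
Qed.

Lemma facets_face (T : finType) (C : {set {set T}}) A : A \in facets C -> A \in C.
Proof. by rewrite inE => /maxsetP[]. Qed.

Lemma facet_max (T : finType) (C : {set {set T}}) A B :
  A \in facets C -> B \in C -> A \subset B -> B = A.
Proof. by rewrite inE => /maxsetP[_ H]; exact: H. Qed.

Section FlagPseudoManifold.
From mathcomp Require Import fintype finset.
Variables (T : finType) (C : {set {set T}}).
Hypotheses (flagC : flag C) (pmC : pseudo_manifold C).
Implicit Types (A B D R S X Y Z : {set T}) (F G : {set {set T}}) (u v w : T).

Local Notation d := (complex_dim C).

Definition adj u v := (u != v) && ([set u; v] \in C).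

(* Locked, lest [inE] unfold membership in [facets C]. *)
Definition facetset := locked (facets C).

Lemma facetsetE : facetset = facets C.
Proof. by rewrite /facetset -lock. Qed.

Definition star v := [set A in facetset | v \in A].

Lemma face_sub A B : A \in C -> B \subset A -> B \in C.
Proof. by case: pmC => -[H _] _ _; apply: H. Qed.

Lemma adjC u v : adj u v = adj v u.
Proof. by rewrite /adj eq_sym setUC. Qed.

Lemma adj_neq u v : adj u v -> u != v.
Proof. by case/andP. Qed.

Lemma face_adj A u v : A \in C -> u \in A -> v \in A -> u != v -> adj u v.
Proof.
move=> fA uA vA uv; rewrite /adj uv /=; apply: face_sub fA _.
by apply/subsetP=> w; rewrite !inE => /orP[]/eqP->.
Qed.

Lemma adj_vertexl u v : adj u v -> [set u] \in C.
Proof.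
by case/andP=> _ /face_sub; apply; apply/subsetP=> w; rewrite !inE => ->.
Qed.

Lemma clique_face A : (forall u, u \in A -> [set u] \in C) ->
  (forall u v, u \in A -> v \in A -> u != v -> adj u v) -> A \in C.
Proof.
move=> A1 A2; apply: flagC => // u v uA vA uv.
by case/andP: (A2 _ _ uA vA uv).
Qed.

Lemma face_vertex A u : A \in C -> u \in A -> [set u] \in C.
Proof. by move=> fA uA; apply: face_sub fA _; rewrite sub1set. Qed.

Lemma face_setU1 A v : A \in C -> (forall u, u \in A -> u != v -> adj v u) ->
  [set v] \in C -> v |: A \in C.
Proof.
move=> fA vA vC; apply: clique_face => [u|u w].
  by rewrite !inE => /orP[/eqP->//|/(face_vertex fA)].
rewrite !inE => /orP[/eqP->|uA] /orP[/eqP->|wA].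
- by rewrite eqxx.
- by rewrite eq_sym; exact: vA.
- by rewrite adjC; exact: vA.
- exact: face_adj fA uA wA.
Qed.

Lemma complex_dimE : d.+1 = \max_(A in C) #|A|.
Proof.
case: pmC => -[_ [v vC]] _ _; rewrite /d /complex_dim prednK //.
by apply: leq_trans (leq_bigmax_cond _ vC); rewrite cards1.
Qed.

Lemma face_card A : A \in C -> #|A| <= d.+1.
Proof. by rewrite complex_dimE => fA; apply: leq_bigmax_cond. Qed.

Lemma facet_face A : A \in facetset -> A \in C.
Proof. by rewrite facetsetE; exact: facets_face. Qed.

Lemma face_facet A : A \in C -> exists2 B, B \in facetset & A \subset B.
Proof. by rewrite facetsetE; exact: face_in_facet. Qed.

Lemma facetP A : reflect (A \in C /\ #|A| = d.+1) (A \in facetset).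
Proof.
have full B : B \in C -> #|B| = d.+1 -> B \in facetset.
  move=> fB Bd; rewrite facetsetE inE; apply/maxsetP; split=> // D DC BD.
  by apply/esym/eqP; rewrite eqEcard BD Bd face_card.
apply: (iffP idP) => [AF|[fA Ad]]; last exact: full.
split; first exact: facet_face.
case: pmC => -[_ [v vC]] pureC _.
have [B fB Bd] : exists2 B, B \in C & #|B| = d.+1.
  rewrite complex_dimE.
  have [|B fB ->] := @eq_bigmax_cond _ [in C] (fun A : {set T} => #|A|).
    by apply/card_gt0P; exists [set v].
  by exists B.
by rewrite -Bd; apply: pureC; rewrite -facetsetE //; apply: full.
Qed.

Lemma facet_card A : A \in facetset -> #|A| = d.+1.
Proof. by case/facetP. Qed.

(** Otherwise flagness would make [v |: A] a face with [d + 2] vertices. *)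
Lemma facet_notin_nonadj A v : A \in facetset -> v \notin A ->
  exists2 u, u \in A & ~~ adj v u.
Proof.
move=> AF vA; case: (boolP [forall u in A, adj v u]); last first.
  by rewrite negb_forall_in => /exists_inP.
move/forall_inP => H; have fA := facet_face AF.
have : v |: A \in C.
  apply: face_setU1 => // [u uA _|]; first exact: H.
  have [u uA] : exists u, u \in A.
    by apply/card_gt0P; rewrite (facet_card AF).
  exact: adj_vertexl (H _ uA).
by move/face_card; rewrite cardsU1 vA (facet_card AF) ltnn.
Qed.

Lemma facet_eq A B : A \in facetset -> B \in facetset -> A \subset B -> A = B.
Proof.
by move=> AF BF AB; apply/eqP; rewrite eqEcard AB (facet_card AF) (facet_card BF) leqnn.
Qed.

(** The facet [q |: R] differs from [A] and from [B], and only two facets contain the ridge [R]. *)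
Lemma ridge_uniq R q A B : #|R| = d -> A \in facetset -> B \in facetset ->
  R \subset A -> R \subset B -> q \notin A -> q \notin B -> q |: R \in C ->
  A = B.
Proof.
move=> Rd AF BF RA RB qA qB qR; apply/eqP; apply: contraT => AB.
have qnR : q \notin R by apply: contra qA => /(subsetP RA).
have QF : q |: R \in facetset by apply/facetP; rewrite cardsU1 qnR Rd.
case: pmC => _ _ /(_ R); rewrite -facetsetE [R \in _]inE Rd eqxx andbT => H2.
have {H2} := H2 (face_sub qR (subsetUr _ _)).
have : #|[set A; B; q |: R]| = 3.
  have qq : q \in q |: R by rewrite setU11.
  rewrite -setUA cardsU1 cards2 !inE negb_or AB.
  have -> : A != q |: R by apply: contraNneq qA => ->.
  by have -> : B != q |: R by apply: contraNneq qB => ->.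
move=> c3 c2; suff : 3 <= 2 by [].
rewrite -c3 -c2; apply/subset_leq_card/subsetP => D; rewrite !inE => H.
suff /andP[-> ->] : (D \in facetset) && (R \subset D) by [].
by case/orP: H => [/orP[]|] /eqP->; rewrite ?AF ?BF ?QF ?RA ?RB ?subsetUr.
Qed.

(** The second facet through the ridge [A :\ v]. Its new vertex is adjacent to the rest of [A],
    hence not to [v] as well. *)
Lemma flip_exists A v : A \in facetset -> v \in A ->
  exists u, [&& u \notin A, ~~ adj u v & (u |: A :\ v) \in facetset].
Proof.
move=> AF vA; set R := A :\ v.
have Rd : #|R| = d by apply: eq_add_S; rewrite -(facet_card AF) (cardsD1 v A) vA.
have RA : R \subset A by apply: subsetDl.
case: pmC => _ _ /(_ R); rewrite -facetsetE [R \in _]inE Rd eqxx andbT => H2.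
have {H2} H2 := H2 (face_sub (facet_face AF) RA).
have [B] : exists B, B \in [set B in facetset | R \subset B] :\ A.
  apply/card_gt0P; rewrite -(leq_add2l 1).
  by move: H2; rewrite (cardsD1 A) inE AF RA => ->.
rewrite !inE => /and3P[BA BF RB].
have [u uB uR] : exists2 u, u \in B & u \notin R.
  apply/subsetPn; apply/negP => /subset_leq_card.
  by rewrite (facet_card BF) Rd ltnn.
have BE : u |: R = B.
  apply/eqP; rewrite eqEcard subUset sub1set uB RB (facet_card BF).
  by rewrite cardsU1 uR Rd add1n leqnn.
have uA : u \notin A.
  apply: contra BA => uA; apply/eqP/esym/(facet_eq AF BF).
  have -> : A = u |: R; last by rewrite BE.
  by apply/esym/eqP; rewrite eqEcard subUset sub1set uA RA cardsU1 uR Rd (facet_card AF) add1n leqnn.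
exists u; rewrite uA BE BF andbT; apply/negP => uv.
have [w wA /negP] := facet_notin_nonadj AF uA; apply.
have [->//|wv] := eqVneq w v.
have wR : w \in R by rewrite !inE wv.
apply: (face_adj (facet_face BF)) => //; first exact: (subsetP RB).
by apply: contraNneq uA => ->.
Qed.

(** Flip the vertices of [A] in [S] one by one. A new vertex is never in the face [S], being
    nonadjacent to the vertex of [S] that it replaces, so [A :&: S] shrinks. *)
Lemma facet_avoid A S : A \in facetset -> S \in C ->
  exists Z, [&& Z \in facetset, A :\: S \subset Z & [disjoint Z & S]].
Proof.
move=> + SC; have [n] := ubnP #|A :&: S|; elim: n A => // n IH A An AF.
have [AS|/set0Pn[v]] := eqVneq (A :&: S) set0.
  by exists A; rewrite AF subsetDl -setI_eq0 AS eqxx.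
rewrite inE => /andP[vA vS].
have [u /and3P[uA uv BF]] := flip_exists AF vA.
have uS : u \notin S.
  apply: contra uv => uS; apply: (face_adj SC) => //.
  by apply: contraNneq uA => ->.
have [|Z /and3P[ZF ZB ZS]] := IH _ _ BF.
  rewrite -ltnS; apply: leq_trans An; rewrite (cardsD1 v (A :&: S)) inE vA vS.
  rewrite add1n !ltnS.
  apply/subset_leq_card/subsetP => w; rewrite !inE.
  by case/andP=> /orP[/eqP->|/andP[-> ->]] wS //; rewrite wS in uS.
exists Z; rewrite ZF ZS andbT; apply: subset_trans ZB.
apply/subsetP=> w; rewrite !inE => /andP[wS wA]; rewrite wS wA !andbT /=.
by apply/orP; right; apply: contraNneq wS => ->.
Qed.

Lemma facet_trace X S : X \in facetset -> S \subset X ->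
  exists2 Z, Z \in facetset & Z :&: X = S.
Proof.
move=> XF SX; have XS : X :\: S \in C.
  by apply: face_sub (facet_face XF) _; apply: subsetDl.
have [Z /and3P[ZF SZ dZ]] := facet_avoid XF XS; exists Z => //.
apply/setP=> w; rewrite !inE; apply/andP/idP => [[wZ wX]|wS].
  apply: contraT => wS; move: (disjointFr dZ wZ).
  by rewrite !inE wS wX.
split; last exact: (subsetP SX).
by apply: (subsetP SZ); rewrite !inE wS (subsetP SX).
Qed.

Lemma complementary_traces X A B : X \in facetset -> A \in C -> B \in C ->
  A :&: X = X :\: B -> [disjoint A & B].
Proof.
move=> XF fA fB AX; rewrite -setI_eq0; apply/eqP/setP => t; rewrite !inE.
apply/negP => /andP[tA tB].
have tX : t \notin X.
  by apply/negP => tX; move/setP/(_ t): AX; rewrite !inE tA tB tX.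
have [u uX /negP] := facet_notin_nonadj XF tX; apply.
have tu : t != u by apply: contraNneq tX => ->.
have [uB|uB] := boolP (u \in B); first exact: (face_adj fB).
have : u \in A :&: X by rewrite AX inE uB uX.
by rewrite inE => /andP[uA _]; apply: (face_adj fA).
Qed.

(** * Traces on a reference facet *)

Definition trace F X S := [set A in F | A :&: X == S].

Lemma trace_in F X S A : A \in trace F X S -> A \in F /\ A :&: X = S.
Proof. by rewrite inE => /andP[AF /eqP AS]. Qed.

Lemma card_trace F X :
  #|F| = \sum_(S in powerset X) #|trace F X S|.
Proof.
rewrite -sum1_card (partition_big (fun A => A :&: X) [in powerset X]) /=.
  by apply: eq_bigr => S _; rewrite -sum1_card; apply: eq_bigl => A; rewrite !inE.
by move=> A _; rewrite inE subsetIr.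
Qed.

Lemma card_trace_pair F X v : v \in X ->
  #|F| = \sum_(S in powerset X | v \in S)
            (#|trace F X S| + #|trace F X (X :\: S)|).
Proof.
move=> vX; rewrite (card_trace F X) (bigID [pred S : {set T} | v \in S]) /=.
rewrite big_split /=; congr (_ + _).
have XDK S : S \subset X -> X :\: (X :\: S) = S.
  by move=> SX; rewrite setDDr setDv set0U; apply/setIidPr.
rewrite (reindex_onto (fun S => X :\: S) (fun S => X :\: S)) /=; last first.
  by move=> S; rewrite inE => /andP[SX _]; apply: XDK.
apply: eq_bigl => S; rewrite !inE subsetDl vX andbT negbK.
apply/andP/andP => [[vS /eqP SX]|[SX vS]]; last by rewrite vS XDK.
by split=> //; rewrite -SX subsetDl.
Qed.

Lemma card_star X v : v \in X ->
  #|star v| = \sum_(S in powerset X | v \in S) #|trace facetset X S|.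
Proof.
move=> vX; rewrite (card_trace (star v) X) (bigID [pred S : {set T} | v \in S]) /=.
rewrite [X in _ + X]big1 ?addn0 => [|S /andP[_ vS]].
  apply: eq_bigr => S /andP[_ vS]; congr #|pred_of_set _|; apply/setP => A.
  rewrite !inE; case: eqP => [AS|]; rewrite ?andbF ?andbT //.
  by move: vS; rewrite -AS inE => /andP[-> _]; rewrite andbT.
apply/eqP; rewrite cards_eq0; apply/eqP/setP => A; rewrite !inE.
by apply: contraNF vS => /andP[/andP[_ vA] /eqP <-]; rewrite inE vA.
Qed.

Lemma trace_facet_gt0 X S : X \in facetset -> S \subset X ->
  0 < #|trace facetset X S|.
Proof.
move=> XF SX; have [Z ZF ZS] := facet_trace XF SX.
by apply/card_gt0P; exists Z; rewrite inE ZF ZS eqxx.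
Qed.

Lemma trace_sub F X S : F \subset facetset ->
  #|trace F X S| <= #|trace facetset X S|.
Proof.
by move=> FF; apply/subset_leq_card/subsetP => A; rewrite !inE => /andP[/(subsetP FF)-> ->].
Qed.

(** * Intersecting families in any dimension *)

Section IntersectingFamily.
Variable F : {set {set T}}.
Hypotheses (FF : F \subset facetset)
  (Fint : forall A B, A \in F -> B \in F -> ~~ [disjoint A & B]).

Lemma family_face A : A \in F -> A \in C.
Proof. by move/(subsetP FF)/facet_face. Qed.

Lemma family_meet A B : A \in F -> B \in F -> exists2 t, t \in A & t \in B.
Proof.
move=> AF BF; have := Fint AF BF; rewrite -setI_eq0 => /set0Pn[t].
by rewrite inE => /andP[]; exists t.
Qed.

Lemma trace_compl X S : X \in F -> S \subset X ->
  #|trace F X S| = 0 \/ #|trace F X (X :\: S)| = 0.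
Proof.
move=> XF SX; case: (set_0Vmem (trace F X S)) => [->|[A /trace_in[AF AS]]].
  by left; rewrite cards0.
right; apply/eqP; rewrite cards_eq0; apply/eqP/setP => B; rewrite [RHS]inE.
apply/negP => /trace_in[BF BS]; move: (Fint AF BF) => /negP; apply.
apply: (@complementary_traces X) => //; try exact: family_face.
  exact: (subsetP FF).
rewrite AS; apply/setP=> w; move/setP/(_ w): BS; rewrite !inE.
case wX: (w \in X); rewrite ?andbT ?andbF.
  by move->; rewrite negbK.
by move=> _; apply: contraFF wX => /(subsetP SX).
Qed.

Lemma trace_set0 X : X \in F -> trace F X set0 = set0.
Proof.
move=> XF; apply/setP=> B; rewrite [RHS]inE; apply/negP => /trace_in[BF /eqP].
by apply/negP; rewrite setI_eq0 Fint.
Qed.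

(** Compare complementary pairs of traces: at most one of the two occurs in [F], and if it is the
    one without [v], it is nonempty and occurs once, while the star has a facet with the other
    trace. *)
Lemma card_star_trace X v : X \in F -> v \in X ->
  (forall S, S \subset X -> v \notin S -> S != set0 -> #|trace F X S| <= 1) ->
  #|F| <= #|star v|.
Proof.
move=> XF vX H; rewrite (card_trace_pair F vX) (card_star vX).
apply: leq_sum => S /andP[]; rewrite inE => SX vS.
have [->|->] := trace_compl XF SX; last by rewrite addn0 trace_sub.
rewrite add0n; apply: leq_trans (trace_facet_gt0 (subsetP FF _ XF) SX).
have [->|S0] := eqVneq (X :\: S) set0; first by rewrite trace_set0 ?cards0.
by apply: H; rewrite ?subsetDl // inE vS.
Qed.

(** If [S] is not [X], it is a ridge of [X], and a member with trace [S] is the other facet through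
    it. *)
Lemma trace_codim1 X S : X \in F -> S \subset X -> d <= #|S| ->
  #|trace F X S| <= 1.
Proof.
move=> XF SX Sd; apply/card_le1_eqP => A B /trace_in[AF AS] /trace_in[BF BS].
have XC := subsetP FF _ XF; have [AC BC'] := (subsetP FF _ AF, subsetP FF _ BF).
have SA : S \subset A by rewrite -AS subsetIl.
have SB : S \subset B by rewrite -BS subsetIl.
have [SE|] := eqVneq S X.
  by rewrite SE in SA SB; rewrite -(facet_eq XC AC SA) -(facet_eq XC BC' SB).
rewrite eqEsubset SX /= => /subsetPn[q qX qS].
have qD D : D :&: X = S -> q \notin D.
  by move=> DS; apply: contra qS => qD; rewrite -DS inE qD.
have qSX : q |: S = X.
  apply/eqP; rewrite eqEcard subUset sub1set qX SX (facet_card XC) cardsU1 qS.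
  by rewrite add1n ltnS.
have Sd' : #|S| = d.
  by apply: eq_add_S; rewrite -(facet_card XC) -qSX cardsU1 qS.
apply/esym; apply: (ridge_uniq Sd' AC BC' SA SB (qD _ AS) (qD _ BS)).
by rewrite qSX family_face.
Qed.

(* [Y] meets [S] in no vertex, so it meets [X] in one of at most two others. *)
Lemma trace_codim2 X Y S : X \in F -> Y \in F -> S \subset X ->
  d <= #|S|.+1 -> [disjoint Y & S] -> #|trace F X S| <= 1.
Proof.
move=> XF YF SX Sd YS; apply/card_le1_eqP => A B.
move=> /trace_in[AF AS] /trace_in[BF BS].
have XS : X :\: S \subset Y = false.
  apply/negP => XSY.
  have [] := trace_compl XF SX; move=> /eqP; rewrite cards_eq0 => /eqP/setP.
    by move/(_ A); rewrite !inE AF AS eqxx.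
  move/(_ Y); rewrite !inE YF /= => /negP[]; apply/eqP/setP => w; rewrite !inE.
  apply/andP/andP => [[wY wX]|[wS wX]]; first by rewrite wX (disjointFr YS wY).
  by rewrite wX (subsetP XSY) // inE wS.
have [q] := subsetPn (negbT XS); rewrite inE => /andP[qS qX] qY.
have [p pX pY] := family_meet XF YF.
have pS : p \notin S by rewrite (disjointFr YS pY).
have pq : p != q by apply: contraNneq qY => <-.
have Xpq : q |: (p |: S) = X.
  apply/eqP; rewrite eqEcard !subUset !sub1set qX pX SX.
  rewrite (facet_card (subsetP FF _ XF)) !cardsU1 !inE negb_or eq_sym pq pS qS.
  by rewrite !add1n !ltnS.
have pSd : #|p |: S| = d.
  apply: eq_add_S; rewrite -(facet_card (subsetP FF _ XF)) -Xpq [in RHS]cardsU1.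
  by rewrite !inE negb_or eq_sym pq qS add1n.
(* A member [D] with trace [S] meets [Y] outside [X] in some [t], adjacent to [S] within [D] and to
   [p] within [Y]. So [t |: (p |: S)] is the second facet through the ridge [p |: S] of [X], and [t]
   is the same for [A] and [B]. Both are then the other facet through the ridge [t |: S]. *)
have ext D : D \in F -> D :&: X = S -> exists t,
    [/\ t \in D, t \in Y, t \notin X & t |: (p |: S) \in facetset].
  move=> DF DS; have [t tD tY] := family_meet DF YF.
  have tX : t \notin X.
    by apply: contraFN (disjointFr YS tY) => tX; rewrite -DS inE tD.
  exists t; split=> //; apply/facetP; split; last first.
    by rewrite cardsU1 pSd !inE negb_or (contraNneq _ tX) ?(contra (subsetP SX t)) // => ->.
  apply: face_setU1; last exact: face_vertex (family_face DF) tD.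
    by apply: face_sub (family_face XF) _; rewrite -Xpq subsetUr.
  move=> u; rewrite !inE => /orP[/eqP->|uS] ut.
    by apply: (face_adj (family_face YF)) => //; rewrite eq_sym.
  apply: (face_adj (family_face DF)) => //; last by rewrite eq_sym.
  by move: uS; rewrite -DS inE => /andP[].
have [t [tA tY tX tF]] := ext _ AF AS; have [u [uB uY uX uF]] := ext _ BF BS.
have qt w : w \in Y -> q \notin w |: (p |: S).
  by move=> wY; rewrite !inE !negb_or (contraNneq _ qY) ?(eq_sym q p) ?pq ?qS // => ->.
have tu : t = u.
  have E := ridge_uniq pSd tF uF (subsetUr _ _) (subsetUr _ _) (qt _ tY)
    (qt _ uY) _.
  have : t \in u |: (p |: S) by rewrite -E ?setU11 // Xpq family_face.
  rewrite !inE => /or3P[/eqP//|/eqP tp|tS]; first by rewrite tp pX in tX.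
  by rewrite (subsetP SX) in tX.
rewrite -{}tu in uB uY uX uF.
have pD D : D \in F -> D :&: X = S -> p \notin D.
  by move=> DF DS; apply: contra pS => pD; rewrite -DS inE pD.
have tS : t \notin S by apply: contra tX; apply: (subsetP SX).
have tSd : #|t |: S| = d by rewrite -pSd !cardsU1 tS pS.
have pt : p |: (t |: S) \in C by rewrite setUCA facet_face.
have tSD D : t \in D -> D :&: X = S -> t |: S \subset D.
  by move=> tD DS; rewrite subUset sub1set tD -DS subsetIl.
apply/esym; exact: ridge_uniq tSd (subsetP FF _ AF) (subsetP FF _ BF) (tSD _ tA AS)
  (tSD _ uB BS) (pD _ AF AS) (pD _ BF BS) pt.
Qed.
Lemma low_dim_bound v0 X : d <= 2 -> X \in F -> v0 \in X ->
  (forall v, exists2 A, A \in F & v \notin A) -> #|F| <= #|star v0|.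
Proof.
move=> d2 XF v0X nostar; apply: (card_star_trace XF v0X) => S SX _ S0.
have [S1|S1] := leqP #|S| 1; last first.
  by apply: trace_codim1 => //; apply: leq_trans d2 S1.
have [v vS] := set0Pn _ S0; have [Y YF vY] := nostar v.
apply: (trace_codim2 XF YF SX).
  by apply: leq_trans d2 _; rewrite ltnS card_gt0.
suff -> : S = [set v] by rewrite disjoint_sym disjoints1.
by apply/esym/eqP; rewrite eqEcard sub1set vS cards1.
Qed.

Lemma star_bound v : (forall A, A \in F -> v \in A) -> #|F| <= #|star v|.
Proof.
move=> Fv; apply/subset_leq_card/subsetP => A AF.
by rewrite inE (subsetP FF) // Fv.
Qed.
(** Families of Hilton-Milner type: [B] is paid for by a facet [Z] through [v] that is disjoint from
    [B] and therefore not in [F]. *)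
Lemma HM_bound v B : [set v] \in C -> B \in F -> v \notin B ->
  (forall A, A \in F -> v \in A \/ A = B) -> #|F| <= #|star v|.
Proof.
move=> vC BF vB FvB; have [A AF] := face_facet vC; rewrite sub1set => vA.
have [Z /and3P[ZF AZ ZB]] := facet_avoid AF (family_face BF).
have vZ : v \in Z by apply: (subsetP AZ); rewrite !inE vB.
have ZnF : Z \notin F by apply: contraL ZB => ZF'; apply: Fint.
rewrite (cardsD1 B) BF (cardsD1 Z (star v)) inE ZF vZ leq_add2l.
apply/subset_leq_card/subsetP => D; rewrite !inE => /andP[DB DF].
case: (FvB _ DF) DB => [vD _|->]; last by rewrite eqxx.
by rewrite vD (subsetP FF) // (contraNneq _ ZnF) // => <-.
Qed.
End IntersectingFamily.

(** * Facets through a face, flips and cliques *)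

Definition stf S := [set A in facetset | S \subset A].

Lemma stf1 v : stf [set v] = star v.
Proof. by apply/setP=> A; rewrite !inE sub1set. Qed.

Lemma card_stf_ridge R : R \in C -> #|R| = d -> #|stf R| = 2.
Proof.
by case: pmC => _ _ H RC Rd; rewrite /stf facetsetE H // inE RC Rd eqxx.
Qed.

(** Flipping [v] is injective: the new vertex of one facet cannot be an old vertex of another, as
    old vertices are adjacent to [v]. The nonadjacency to [v] is recorded because it later tells new
    vertices from given neighbours of [v]. *)
Lemma flip_family v F : (forall A, A \in F -> A \in facetset /\ v \in A) ->
  exists2 G : {set {set T}}, #|G| = #|F| &
    forall B, B \in G -> [/\ B \in facetset, v \notin B & exists2 A, A \in F &
      A :\ v \subset B /\ forall w, w \in B -> w \notin A -> ~~ adj w v].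
Proof.
move=> FP; pose fl A := odflt v
  [pick u | [&& u \notin A, ~~ adj u v & (u |: A :\ v) \in facetset]].
have flP A : A \in F ->
    [&& fl A \notin A, ~~ adj (fl A) v & (fl A |: A :\ v) \in facetset].
  move=> /FP[AF vA]; rewrite /fl; case: pickP => //= H.
  by have [u uP] := flip_exists AF vA; move: (H u); rewrite uP.
exists [set fl A |: A :\ v | A in F].
  apply: card_in_imset => A B AF BF /= E.
  have [/and3P[fA av _] /and3P[fB bv _]] := (flP _ AF, flP _ BF).
  have [[AC vA] [BC' vB]] := (FP _ AF, FP _ BF).
  suff fE : fl A = fl B.
    apply/setP=> w; have := congr1 (fun S : {set T} => w \in S) E.
    rewrite !inE -fE; have [->|wv] := eqVneq w v; first by rewrite vA vB.
    by have [->|] := eqVneq w (fl A); rewrite // (negPf fA) fE (negPf fB).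
  apply/eqP; have : fl A \in fl B |: B :\ v by rewrite -E setU11.
  rewrite !inE => /orP[//|/andP[fv fAB]].
  by case/negP: av; apply: face_adj (facet_face BC') fAB vB fv.
move=> B /imsetP[A AF ->]; have [/and3P[fA av BF]] := flP _ AF.
have [AC vA] := FP _ AF; split=> //.
  by rewrite !inE eqxx orbF; apply: contraNneq fA => <-.
exists A => //; split=> [|w]; first exact: subsetUr.
by rewrite !inE => /orP[/eqP->//|/andP[_ ->]].
Qed.

(** The facets through [v |: S] and their flips at [v] all contain [S], and [v] tells the two kinds
    apart. *)
Lemma card_stf_flip v S : v \notin S -> 2 * #|stf (v |: S)| <= #|stf S|.
Proof.
move=> vS; have [A|G Gc GP] := @flip_family v (stf (v |: S)).
  by rewrite !inE subUset sub1set => /and3P[-> ->].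
rewrite mul2n -addnn -{2}Gc -cardsUI.
rewrite [X in _ + #|pred_of_set X|](_ : _ = set0) ?cards0 ?addn0.
  apply/subset_leq_card/subsetP => A; rewrite !inE => /orP[|/GP[-> _ [B]]].
    by rewrite subUset => /and3P[-> _].
  rewrite !inE subUset => /and3P[_ _ SB] [BA _] /=.
  apply: subset_trans BA; apply/subsetP => w wS; rewrite !inE (subsetP SB) //.
  by rewrite andbT; apply: contraNneq vS => <-.
apply/setP=> A; rewrite !inE; apply/negP => /andP[/andP[_]].
by rewrite subUset sub1set => /andP[vA _] /GP[_]; rewrite vA.
Qed.

Lemma pairwise_adj (s : seq T) u v : pairwise adj s ->
  u \in s -> v \in s -> u != v -> adj u v.
Proof.
elim: s => // a s IH /= /andP[/allP as_ sP]; rewrite !inE.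
case/orP=> [/eqP->|us] /orP[/eqP->|vs] uv; try by [rewrite eqxx in uv | auto].
by rewrite adjC as_.
Qed.

Lemma pairwise_uniq (s : seq T) : pairwise adj s -> uniq s.
Proof. by rewrite uniq_pairwise; apply: sub_pairwise => u v /adj_neq. Qed.

Lemma clique_seq_face (s : seq T) : 1 < size s -> pairwise adj s ->
  [set u in s] \in C.
Proof.
case: s => [|a [|b s]] // _ sP; apply: clique_face => [u|u v]; rewrite !inE => us.
  have ab : adj a b by move: sP => /= /andP[/andP[]].
  have [->|ua] := eqVneq u a; first exact: adj_vertexl ab.
  by apply: (@adj_vertexl _ a); apply: (pairwise_adj sP); rewrite // !inE ?us ?eqxx.
by move=> vs; apply: (pairwise_adj sP); rewrite !inE.
Qed.

Lemma clique_seq (s : seq T) : 1 < size s -> pairwise adj s -> size s <= d.+1.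
Proof.
move=> s1 sP; have /face_card := clique_seq_face s1 sP.
by rewrite cardsE (card_uniqP (pairwise_uniq sP)).
Qed.

Lemma clique_seq_facet (s : seq T) : size s = d.+1 -> 0 < d -> pairwise adj s ->
  [set u in s] \in facetset.
Proof.
move=> sd d0 sP; apply/facetP; rewrite cardsE (card_uniqP (pairwise_uniq sP)).
by split=> //; apply: clique_seq_face; rewrite // sd.
Qed.

(** * Dimension three: cliques, triangles and edges *)

Section Dimension3.
Hypothesis d3 : d = 3.

Lemma no_clique5 a b c e f : ~ pairwise adj [:: a; b; c; e; f].
Proof. by move/clique_seq; rewrite d3 => /(_ isT). Qed.

Ltac distinct :=
  match goal with
  | |- is_true (?x != ?y) => first
    [ assumption
    | by rewrite eq_sym; assumption
    | match goal with
      | xA : is_true (x \in pred_of_set ?A), yA : is_true (y \notin pred_of_set ?A) |- _ =>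
        by apply: contraNneq yA => <-
      | xA : is_true (x \notin pred_of_set ?A), yA : is_true (y \in pred_of_set ?A) |- _ =>
        by apply: contraNneq xA => ->
      end
    | by apply: adj_neq; assumption
    | by rewrite eq_sym; apply: adj_neq; assumption ]
  end.

Ltac adjacent :=
  match goal with
  | |- is_true (adj ?x ?y) => first
    [ assumption
    | by rewrite adjC; assumption
    | match goal with
      | xA : is_true (x \in pred_of_set ?A), yA : is_true (y \in pred_of_set ?A), fA : is_true (@in_mem _ ?A _)
        |- _ => by apply: (face_adj fA xA yA); distinct
      end ]
  end.

Ltac clique := rewrite /= ?andbT;
  repeat match goal with |- is_true (_ && _) => apply/andP; split end; adjacent.

Lemma facet3_uniq a b c q A B : A \in facetset -> B \in facetset ->
  a \in A -> b \in A -> c \in A -> a \in B -> b \in B -> c \in B ->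
  q \notin A -> q \notin B -> pairwise adj [:: a; b; c; q] -> A = B.
Proof.
move=> AF BF aA bA cA aB bB cB qA qB abcq.
have abc : pairwise adj [:: a; b; c].
  by move: abcq => /= /and4P[/and4P[-> -> _ _] /and3P[-> _ _] _ _].
have := facetP _ (clique_seq_facet _ _ abcq); rewrite d3 => -[//|//|fQ cQ].
apply: (@ridge_uniq [set u in [:: a; b; c]] q) => //.
- by rewrite d3 cardsE (card_uniqP (pairwise_uniq abc)).
- by apply/subsetP => w; rewrite !inE => /or3P[]/eqP->.
- by apply/subsetP => w; rewrite !inE => /or3P[]/eqP->.
suff -> : q |: [set u in [:: a; b; c]] = [set u in [:: a; b; c; q]] by [].
by apply/setP=> w; rewrite !inE; case: (w == q); rewrite ?orbT ?orbF.
Qed.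

Lemma facet4_uniq a b c e A B : A \in facetset -> B \in facetset ->
  a \in A -> b \in A -> c \in A -> e \in A ->
  a \in B -> b \in B -> c \in B -> e \in B -> uniq [:: a; b; c; e] -> A = B.
Proof.
have E D : D \in facetset -> a \in D -> b \in D -> c \in D -> e \in D ->
    uniq [:: a; b; c; e] -> D = [set u in [:: a; b; c; e]].
  move=> DF aD bD cD eD us; apply/esym/eqP.
  rewrite eqEcard cardsE (card_uniqP us) (facet_card DF) d3 andbT.
  by apply/subsetP => w; rewrite !inE => /or4P[]/eqP->.
by move=> AF BF aA bA cA eA aB bB cB eB us; rewrite (E A) // (E B).
Qed.

(** The triangle [a b c] is a ridge, and each of [x], [y], [z] completes it to a facet. *)
Lemma ext3 a b c x y z : pairwise adj [:: a; b; c; x] ->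
  pairwise adj [:: a; b; c; y] -> pairwise adj [:: a; b; c; z] ->
  [|| x == y, x == z | y == z].
Proof.
move=> ax ay az; apply: contraT; rewrite !negb_or => /and3P[xy xz yz].
have inF w (aw : pairwise adj [:: a; b; c; w]) :
    [set u in [:: a; b; c; w]] \in facetset.
  by apply: clique_seq_facet; rewrite ?d3.
have := facet3_uniq (inF x ax) (inF y ay) _ _ _ _ _ _ _ _ az.
have notabc w : pairwise adj [:: a; b; c; w] -> w \notin [:: a; b; c].
  by move/pairwise_uniq; rewrite -[[:: a, _, _ & _]]/(rcons [:: a; b; c] w)
    rcons_uniq => /andP[].
have zP w : w != z -> z \notin [set u in [:: a; b; c; w]].
  move=> wz; have := notabc _ az; rewrite !inE !negb_or (eq_sym z w) wz.
  by case/and3P=> -> -> ->.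
move=> H; have {H} : x \in [set u in [:: a; b; c; y]].
  by rewrite -H ?zP // !inE eqxx ?orbT.
have := notabc _ ax; rewrite !inE !negb_or => /and3P[/negPf-> /negPf-> /negPf->].
by rewrite (negPf xy).
Qed.

Lemma in_stf (s : seq T) A :
  (A \in stf [set u in s]) = (A \in facetset) && all [in A] s.
Proof.
rewrite inE; congr (_ && _); apply/subsetP/allP => H w; first by move=> ws; apply: H; rewrite inE.
by rewrite inE; apply: H.
Qed.

Lemma card_stf3 a b c : pairwise adj [:: a; b; c] ->
  #|stf [set u in [:: a; b; c]]| = 2.
Proof.
move=> abc; apply: card_stf_ridge; first exact: clique_seq_face.
by rewrite d3 cardsE (card_uniqP (pairwise_uniq abc)).
Qed.

(** The two facets on a triangle [x a b], and their flips at [x]. *)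
Lemma card_stf2 a b : adj a b -> 4 <= #|stf [set u in [:: a; b]]|.
Proof.
move=> ab; have abC : [set u in [:: a; b]] \in C.
  by apply: clique_seq_face; rewrite //= ab.
have [X XF /subsetP abX] := face_facet abC; have fX := facet_face XF.
have aX : a \in X by apply: abX; rewrite !inE eqxx.
have bX : b \in X by apply: abX; rewrite !inE eqxx orbT.
have [x xX xab] : exists2 x, x \in X & x \notin [set u in [:: a; b]].
  apply/subsetPn; apply/negP => /subset_leq_card; rewrite (facet_card XF) d3 cardsE.
  by apply/negP; rewrite -ltnNge ltnS; apply: leq_trans (card_size _) _.
move: (xab); rewrite !inE negb_or => /andP[xa xb].
have := card_stf_flip xab; rewrite (_ : x |: _ = [set u in [:: x; a; b]]).
  have xabP : pairwise adj [:: x; a; b] by clique.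
  by rewrite card_stf3.
by apply/setP=> w; rewrite !inE.
Qed.

(* At most two vertices of [B] are adjacent to both [a] and [b], and each spans
   with [ab] a ridge, which lies in two facets. *)
Lemma edge_family_meeting a b B F : adj a b -> B \in C -> a \notin B ->
  b \notin B -> (forall A, A \in F -> [/\ A \in facetset, a \in A, b \in A &
    exists2 t, t \in A & t \in B]) ->
  #|F| <= 3 /\ (#|F| = 3 -> exists p q, [/\ p != q, p \in B, q \in B &
    [/\ pairwise adj [:: a; b; p], pairwise adj [:: a; b; q],
       stf [set u in [:: a; b; p]] \subset F &
       stf [set u in [:: a; b; q]] \subset F]]).
Proof.
move=> ab fB aB bB FP; pose N := [set t in B | adj a t && adj b t].
have NB t : t \in N -> [/\ t \in B, adj a t & adj b t].
  by rewrite inE => /and3P[].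
have adjN t : t \in N -> pairwise adj [:: a; b; t].
  by move/NB=> [tB at_ bt]; clique.
have N2 : #|N| <= 2.
  have NC : N \in C by apply: (face_sub fB); apply/subsetP => t /NB[].
  have vC := (adj_vertexl ab, adj_vertexl (etrans (adjC b a) ab)).
  have bN : b |: N \in C by apply: face_setU1; rewrite ?vC // => u /NB[].
  have abN : a |: (b |: N) \in C.
    apply: face_setU1; rewrite ?vC // => u.
    by rewrite !inE => /orP[/eqP-> //|/and3P[]].
  move/face_card: abN; rewrite d3 !cardsU1 !inE negb_or (adj_neq ab).
  by rewrite (negPf aB) (negPf bB).
have FN A : A \in F -> exists2 t, t \in N & A \in stf [set u in [:: a; b; t]].
  case/FP=> AF aA bA [t tA tB]; have fA := facet_face AF; exists t.
    by rewrite inE tB /=; apply/andP; split; adjacent.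
  by rewrite in_stf AF /= aA bA tA.
case: (posnP #|N|) => [/eqP|N0].
  rewrite cards_eq0 => /eqP N0; suff -> : F = set0 by rewrite cards0.
  by apply/setP=> A; rewrite inE; apply/negP => /FN[t]; rewrite N0 inE.
have [/eqP/cards1P[p Np]|N1] := eqVneq #|N| 1.
  have pN : p \in N by rewrite Np set11.
  have F2 : #|F| <= 2.
    rewrite -(card_stf3 (adjN _ pN)); apply/subset_leq_card/subsetP => A /FN[t].
    by rewrite Np inE => /eqP->.
  by split=> [|F3]; [exact: leqW | rewrite F3 in F2].
have /cards2P[p [q [pq Npq]]] : #|N| == 2 by rewrite eqn_leq N2 ltn_neqAle eq_sym N1.
have [pN qN] : p \in N /\ q \in N by rewrite Npq !inE !eqxx orbT.
have [[pB ap bp] [qB aq bq]] := (NB _ pN, NB _ qN).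
set P := stf [set u in [:: a; b; p]]; set Q := stf [set u in [:: a; b; q]].
have FPQ : F \subset P :|: Q.
  apply/subsetP=> A /FN[t]; rewrite Npq !inE => /orP[]/eqP-> ->//.
  by rewrite orbT.
have abpq : pairwise adj [:: a; b; p; q] by clique.
have PQ3 : #|P :|: Q| <= 3.
  have := cardsUI P Q; rewrite (card_stf3 (adjN _ pN)) (card_stf3 (adjN _ qN)).
  suff : 0 < #|P :&: Q|.
    by move: #|P :&: Q| #|P :|: Q| => m n; clear; lia.
  apply/card_gt0P; exists [set u in [:: a; b; p; q]].
  rewrite inE !in_stf clique_seq_facet ?d3 //=.
  by rewrite !inE !eqxx !orbT.
split=> [|F3]; first exact: leq_trans (subset_leq_card FPQ) PQ3.
have FE : F = P :|: Q by apply/eqP; rewrite eqEcard FPQ F3.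
by exists p, q; rewrite FE subsetUl subsetUr; split=> //; split=> //; apply: adjN.
Qed.

Lemma stf3_two a b c A1 A2 A3 : pairwise adj [:: a; b; c] ->
  [/\ A1 \in facetset, A2 \in facetset & A3 \in facetset] ->
  [/\ a \in A1, b \in A1 & c \in A1] -> [/\ a \in A2, b \in A2 & c \in A2] ->
  [/\ a \in A3, b \in A3 & c \in A3] -> [|| A1 == A2, A2 == A3 | A3 == A1].
Proof.
move=> abc [F1 F2 F3] [a1 b1 c1] [a2 b2 c2] [a3 b3 c3].
apply: contraT; rewrite !negb_or => /and3P[A12 A23 A31].
suff : 2 < #|stf [set u in [:: a; b; c]]| by rewrite card_stf3.
apply/card_gt2P; exists A1, A2, A3; split; split=> //; rewrite in_stf ?F1 ?F2 ?F3 /=.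
- by rewrite a1 b1 c1.
- by rewrite a2 b2 c2.
- by rewrite a3 b3 c3.
Qed.

(** Among three members two share a vertex [x] of [B1], since three distinct vertices of [B1] would
    form a clique of five with [a] and [b]. [key] excludes this. If [x] is in [B2], the third member
    misses [x] and meets [B1] and [B2] in the same vertex, which forces [B1 = B2]. If not, the two
    members meet [B2] in the same vertex and coincide. *)
Lemma edge_cross_le2 a b c e B1 B2 F : adj a b -> c != e ->
  [/\ B1 \in facetset, B2 \in facetset & B1 != B2] ->
  [/\ c \in B1, e \in B1, a \notin B1 & b \notin B1] ->
  [/\ c \in B2, e \in B2, a \notin B2 & b \notin B2] ->
  (forall A, A \in F -> [/\ A \in facetset, a \in A & b \in A] /\
     [/\ c \notin A, e \notin A, exists2 t, t \in A & t \in B1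
       & exists2 t, t \in A & t \in B2]) ->
  #|F| <= 2.
Proof.
move=> ab ce [BF1 BF2 B12] [cB1 eB1 aB1 bB1] [cB2 eB2 aB2 bB2] FP.
have [fB1 fB2] := (facet_face BF1, facet_face BF2).
rewrite leqNgt; apply/negP => /card_gt2P[A1 [A2 [A3 [[AF1 AF2 AF3] [A12 A23 A31]]]]].
have key D1 D2 D3 x : [/\ D1 \in F, D2 \in F & D3 \in F] ->
    [/\ D1 != D2, D2 != D3 & D3 != D1] -> [/\ x \in D1, x \in D2 & x \in B1] ->
    False.
  case=> /FP[[F1 a1 b1] [c1 e1 _ [y1 y1D y1B]]].
  move=> /FP[[F2 a2 b2] [c2 e2 _ [y2 y2D y2B]]].
  move=> /FP[[F3 a3 b3] [c3 e3 [x3 x3D x3B] [y3 y3D y3B]]].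
  move=> [D12 D23 D31] [xD1 xD2 xB].
  have [f1 f2 f3] := And3 (facet_face F1) (facet_face F2) (facet_face F3).
  have abx : pairwise adj [:: a; b; x] by clique.
  have [xB2|xB2] := boolP (x \in B2).
    have xD3 : x \notin D3.
      apply/negP => xD3; have := stf3_two abx (And3 F1 F2 F3)
        (And3 a1 b1 xD1) (And3 a2 b2 xD2) (And3 a3 b3 xD3).
      by rewrite (negPf D12) (negPf D23) (negPf D31).
    have [E|x3y3] := eqVneq x3 y3; last first.
      by apply: (@no_clique5 a b x x3 y3); clique.
    rewrite -{}E in y3B; case/eqP: B12; apply: (@facet4_uniq c e x x3) => //.
    apply: pairwise_uniq; clique.
  have [E|y12] := eqVneq y1 y2; last first.
    by apply: (@no_clique5 a b x y1 y2); clique.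
  rewrite -{}E in y2D; case/eqP: D12; apply: (@facet4_uniq a b x y1) => //.
  apply: pairwise_uniq; clique.
have [[F1 a1 b1] [c1 e1 [x1 x1A x1B] _]] := FP _ AF1.
have [[F2 a2 b2] [c2 e2 [x2 x2A x2B] _]] := FP _ AF2.
have [[F3 a3 b3] [c3 e3 [x3 x3A x3B] _]] := FP _ AF3.
have [f1 f2 f3] := And3 (facet_face F1) (facet_face F2) (facet_face F3).
have [E|x12] := eqVneq x1 x2.
  by apply: (key A1 A2 A3 x1); split; rewrite // E.
have [E|x23] := eqVneq x2 x3.
  by apply: (key A2 A3 A1 x2); split; rewrite // E.
have [E|x31] := eqVneq x3 x1.
  by apply: (key A3 A1 A2 x3); split; rewrite // E.
by apply: (@no_clique5 a b x1 x2 x3); clique.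
Qed.

(** One member on one side bounds the other side by 3, two members bound it by 2; so the total is at
    most [3 + 1] or [2 + 2]. *)
Lemma edge_cross a b c e F G : adj a b -> adj c e -> F != set0 -> G != set0 ->
  (forall A, A \in F -> [/\ A \in facetset, a \in A, b \in A, c \notin A & e \notin A]) ->
  (forall B, B \in G -> [/\ B \in facetset, c \in B, e \in B, a \notin B & b \notin B]) ->
  (forall A B, A \in F -> B \in G -> exists2 t, t \in A & t \in B) ->
  #|F| + #|G| <= 4.
Proof.
move=> ab ce /set0Pn[A AF] /set0Pn[B BG] FP GP FG.
have [AC aA bA cA eA] := FP _ AF; have [BC cB eB aB bB] := GP _ BG.
have F3 : #|F| <= 3.
  apply: (proj1 (edge_family_meeting ab (facet_face BC) aB bB _)) => D DF.
  by have [DC aD bD _ _] := FP _ DF; split=> //; apply: FG.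
have G3 : #|G| <= 3.
  apply: (proj1 (edge_family_meeting ce (facet_face AC) cA eA _)) => D DG.
  have [DC aD bD _ _] := GP _ DG; split=> //.
  by have [t] := FG _ _ AF DG; exists t.
have [G1|G1] := leqP #|G| 1; first exact: (leq_add F3 G1).
have [F1|F1] := leqP #|F| 1; first exact: (leq_add F1 G3).
apply: (@leq_add _ _ 2 2).
  have /card_gt1P[B1 [B2 [B1G B2G B12]]] := G1.
  have [? ? ? ? ?] := GP _ B1G; have [? ? ? ? ?] := GP _ B2G.
  apply: (@edge_cross_le2 a b c e B1 B2) => //; first exact: adj_neq.
  by move=> D DF; have [? ? ? ? ?] := FP _ DF; split; split=> //; apply: FG.
have /card_gt1P[B1 [B2 [B1G B2G B12]]] := F1.
have [? ? ? ? ?] := FP _ B1G; have [? ? ? ? ?] := FP _ B2G.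
apply: (@edge_cross_le2 c e a b B1 B2) => //; first exact: adj_neq.
move=> D DF; have [? ? ? ? ?] := GP _ DF; split; split=> //.
  by have [t] := FG _ _ B1G DF; exists t.
by have [t] := FG _ _ B2G DF; exists t.
Qed.

(** A vertex common to [A] and a member of [G] is adjacent to [a] and [b], so it is [u]. A member of
    [F] without [u] would meet [B1] and [B2] in one vertex [t], as there is no clique of five, and
    the triangle [b u t] would lie in [B1], [B2] and [a b u t]. *)
Lemma edge_pair_single a b u F G A : adj a b -> 1 < #|G| -> A \in F ->
  (forall t, t \in A -> adj t a -> adj t b -> t = u) ->
  (forall A, A \in F -> [/\ A \in facetset, a \in A & b \notin A]) ->
  (forall B, B \in G -> [/\ B \in facetset, b \in B & a \notin B]) ->
  (forall A B, A \in F -> B \in G -> exists2 t, t \in A & t \in B) ->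
  [/\ adj u a, adj u b, forall A, A \in F -> u \in A & forall B, B \in G -> u \in B].
Proof.
move=> ab G1 AF Au FP GP FG; have [AC aA bA] := FP _ AF.
have fA := facet_face AC.
have uAB B : B \in G -> [/\ u \in A, u \in B, adj u a & adj u b].
  move=> BG; have [t tA tB] := FG _ _ AF BG; have [BC bB aB] := GP _ BG.
  have fB := facet_face BC.
  have ta : adj t a by adjacent.
  have tb : adj t b by adjacent.
  by rewrite -(Au t).
have [B1 [B2 [B1G B2G B12]]] := card_gt1P G1.
have [uA uB1 ua ub] := uAB _ B1G; have [_ uB2 _ _] := uAB _ B2G.
split=> // [D DF|B /uAB[]//].
apply: contraT => uD; have [DC aD bD] := FP _ DF; have fD := facet_face DC.
have [BC1 bB1 aB1] := GP _ B1G; have [BC2 bB2 aB2] := GP _ B2G.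
have [fB1 fB2] := (facet_face BC1, facet_face BC2).
have [t1 t1D t1B] := FG _ _ DF B1G; have [t2 t2D t2B] := FG _ _ DF B2G.
have [E|t12] := eqVneq t1 t2; last first.
  by case: (@no_clique5 a b u t1 t2); clique.
rewrite -{}E in t2B t2D; case/eqP: B12.
apply: (@facet3_uniq b u t1 a) => //; clique.
Qed.

(** The scheme of [edge_cross_le2], with one more ingredient: each member has a common neighbour of
    [a] and [b] other than a given [x]. For distinct members through [x] these neighbours differ, by
    the triangle [a x t] and the facet [a b x t]; so three such members would contradict [ext3] on
    [a b x]. *)
Lemma edge_pair_le2 a b B1 B2 F : adj a b ->
  (forall A x, A \in F -> exists t, [/\ t \in A, adj t a, adj t b & t != x]) ->
  (forall A, A \in F -> [/\ A \in facetset, a \in A & b \notin A]) ->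
  [/\ B1 \in facetset, b \in B1 & a \notin B1] ->
  [/\ B2 \in facetset, b \in B2 & a \notin B2] -> B1 != B2 ->
  (forall A, A \in F ->
     (exists2 t, t \in A & t \in B1) /\ (exists2 t, t \in A & t \in B2)) ->
  #|F| <= 2.
Proof.
move=> ab F2 FP [BC1 bB1 aB1] [BC2 bB2 aB2] B12 FB.
have [fB1 fB2] := (facet_face BC1, facet_face BC2).
rewrite leqNgt; apply/negP => /card_gt2P[A1 [A2 [A3 [[AF1 AF2 AF3] [A12 A23 A31]]]]].
have key D1 D2 D3 x : [/\ D1 \in F, D2 \in F & D3 \in F] ->
    [/\ D1 != D2, D2 != D3 & D3 != D1] -> [/\ x \in D1, x \in D2 & x \in B1] ->
    False.
  case=> DF1 DF2 DF3 [D12 D23 D31] [xD1 xD2 xB].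
  have [F1 a1 b1] := FP _ DF1; have [_ [y1 y1D y1B]] := FB _ DF1.
  have [Fb2 a2 b2] := FP _ DF2; have [_ [y2 y2D y2B]] := FB _ DF2.
  have [F3 a3 b3] := FP _ DF3; have [[x3 x3D x3B] [y3 y3D y3B]] := FB _ DF3.
  have [f1 f2 f3] := And3 (facet_face F1) (facet_face Fb2) (facet_face F3).
  have [u1 [u1D u1a u1b u1x]] := F2 _ x DF1.
  have [u2 [u2D u2a u2b u2x]] := F2 _ x DF2.
  have [u3 [u3D u3a u3b u3x]] := F2 _ x DF3.
  have uneq D D' t t' : D \in facetset -> D' \in facetset -> D != D' ->
      x \in D -> x \in D' -> a \in D -> a \in D' -> b \notin D -> b \notin D' ->
      t \in D -> t' \in D' -> adj t a -> adj t b -> t != x -> t != t'.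
    move=> DC DC' DD xD xD' aD aD' bD bD' tD tD' ta tb tx; apply/eqP => E.
    rewrite -{}E in tD'; case/eqP: DD; have [fD fD'] := (facet_face DC, facet_face DC').
    apply: (@facet3_uniq a x t b) => //; clique.
  have [xB2|xB2] := boolP (x \in B2).
    have xD3 : x \notin D3.
      apply/negP => xD3.
      have u12 : u1 != u2 by apply: (uneq D1 D2).
      have u23 : u2 != u3 by apply: (uneq D2 D3).
      have u31 : u3 != u1 by apply: (uneq D3 D1).
      have : [|| u1 == u2, u1 == u3 | u2 == u3] by apply: (@ext3 a b x); clique.
      by rewrite (negPf u12) (eq_sym u1) (negPf u31) (negPf u23).
    have [E|x3y3] := eqVneq x3 y3; last first.
      by apply: (@no_clique5 a b x x3 y3); clique.
    rewrite -{}E in y3B; case/eqP: B12; apply: (@facet3_uniq b x x3 a) => //; clique.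
  have y12 : y1 != y2 by apply: (uneq D1 D2) => //; first [adjacent | distinct].
  by apply: (@no_clique5 a b x y1 y2); clique.
have [F1 a1 b1] := FP _ AF1; have [[x1 x1A x1B] _] := FB _ AF1.
have [Fb2 a2 b2] := FP _ AF2; have [[x2 x2A x2B] _] := FB _ AF2.
have [F3 a3 b3] := FP _ AF3; have [[x3 x3A x3B] _] := FB _ AF3.
have [f1 f2 f3] := And3 (facet_face F1) (facet_face Fb2) (facet_face F3).
have [E|x12] := eqVneq x1 x2.
  by apply: (key A1 A2 A3 x1); split; rewrite // E.
have [E|x23] := eqVneq x2 x3.
  by apply: (key A2 A3 A1 x2); split; rewrite // E.
have [E|x31] := eqVneq x3 x1.
  by apply: (key A3 A1 A2 x3); split; rewrite // E.
by apply: (@no_clique5 a b x1 x2 x3); clique.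
Qed.

Lemma edge_pair a b F G : adj a b -> 1 < #|F| -> 1 < #|G| ->
  (forall A, A \in F -> [/\ A \in facetset, a \in A & b \notin A]) ->
  (forall B, B \in G -> [/\ B \in facetset, b \in B & a \notin B]) ->
  (forall A B, A \in F -> B \in G -> exists2 t, t \in A & t \in B) ->
  (exists u, [/\ adj u a, adj u b, forall A, A \in F -> u \in A
    & forall B, B \in G -> u \in B]) \/ #|F| + #|G| <= 4.
Proof.
move=> ab F1 G1 FP GP FG; have ba : adj b a by rewrite adjC.
have GF B A : B \in G -> A \in F -> exists2 t, t \in B & t \in A.
  by move=> BG AF; have [t] := FG _ _ AF BG; exists t.
have [/exists_inP[A AF /existsP[u /forall_inP Au]]|] := boolP
    [exists A in F, exists u, forall (t | t \in A), adj t a && adj t b ==> (t == u)].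
  left; exists u; apply: (edge_pair_single ab G1 AF) => // t tA ta tb.
  by apply/eqP; move: (Au t tA); rewrite ta tb.
rewrite negb_exists_in => /forall_inP F2.
have [/exists_inP[B BG /existsP[u /forall_inP Bu]]|] := boolP
    [exists B in G, exists u, forall (t | t \in B), adj t b && adj t a ==> (t == u)].
  left; exists u; have [|? ? ? ?] := edge_pair_single ba F1 BG _ GP FP GF (u := u).
    by move=> t tB ta tb; apply/eqP; move: (Bu t tB); rewrite ta tb.
  by split.
rewrite negb_exists_in => /forall_inP G2; right.
have [A1 [A2 [AF1 AF2 A12]]] := card_gt1P F1.
have [B1 [B2 [BG1 BG2 B12]]] := card_gt1P G1.
apply: (@leq_add _ _ 2 2).
  apply: (edge_pair_le2 ab _ FP (GP _ BG1) (GP _ BG2) B12) => [A x AF|A AF].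
    have := F2 _ AF; rewrite negb_exists => /forallP/(_ x).
    rewrite negb_forall_in => /exists_inP[t tA]; rewrite negb_imply.
    by case/andP=> /andP[ta tb] tx; exists t.
  by split; apply: FG.
apply: (edge_pair_le2 ba _ GP (FP _ AF1) (FP _ AF2) A12) => [B x BG|B BG].
  have := G2 _ BG; rewrite negb_exists => /forallP/(_ x).
  rewrite negb_forall_in => /exists_inP[t tA]; rewrite negb_imply.
  by case/andP=> /andP[ta tb] tx; exists t.
by split; apply: GF.
Qed.

Lemma card_stf2D a b c : pairwise adj [:: a; b; c] ->
  #|stf [set u in [:: a; b]] :\: stf [set u in [:: a; b; c]]| =
  #|stf [set u in [:: a; b]]| - 2.
Proof.
move=> abc; rewrite cardsD (_ : _ :&: _ = stf [set u in [:: a; b; c]]).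
  by rewrite card_stf3.
apply/setIidPr/subsetP => A; rewrite !in_stf /= !andbT.
by case/and4P=> -> -> ->.
Qed.

Lemma stf_perm (s t : seq T) : s =i t -> stf [set u in s] = stf [set u in t].
Proof.
by move=> st; congr stf; apply/setP => w; rewrite !inE.
Qed.

(** The at most [#|Ebu| - 2] members through [b] and [u] without [a] are paid for by flipping [b] in
    the [#|Eab| - 2] facets through [a] and [b] without [u]. Such a flip contains [a] but neither
    [b] nor [u], because its new vertex is not adjacent to [b]. *)
Lemma triangle_family_star a b u F : pairwise adj [:: a; b; u] ->
  F \subset facetset ->
  (forall A, A \in F ->
     [\/ a \in A /\ b \in A, a \in A /\ u \in A | b \in A /\ u \in A]) ->
  #|stf [set w in [:: b; u]]| <= #|stf [set w in [:: a; b]]| ->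
  #|F| <= #|star a|.
Proof.
move=> abu FF FP buab; set t := stf [set w in [:: a; b; u]].
have abu' := abu; move: abu'; rewrite /= !andbT => /andP[/andP[ab au] bu].
set Ebu := stf _ in buab; set Eab := stf _ in buab; pose Eau := stf [set w in [:: a; u]].
have [A|G Gc GP] := @flip_family b (Eab :\: t).
  by rewrite in_setD !in_stf => /andP[_ /and4P[-> _ -> _]].
have FE : #|F| <= #|Eab :|: Eau| + #|Ebu :\: t|.
  have := leq_card_setU (Eab :|: Eau) (Ebu :\: t).
  move=> [+ _]; apply: leq_trans; apply/subset_leq_card/subsetP => A AF.
  have AC := subsetP FF _ AF; move: (FP _ AF).
  rewrite 2!in_setU in_setD !in_stf AC /= !andbT.
  by case=> -[-> ->]; rewrite ?orbT ?andbT //; case: (a \in A).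
have tE : #|Ebu :\: t| = #|Ebu| - 2.
  rewrite -(@card_stf2D b u a); last by clique.
  congr #|pred_of_set (_ :\: _)|; apply: stf_perm => w.
  by rewrite !inE; case: (w == a); rewrite ?orbT ?orbF.
have GE : #|Eab :|: Eau| + #|G| <= #|star a|.
  rewrite -cardsUI (_ : _ :&: G = set0) ?cards0 ?addn0.
    apply/subset_leq_card/subsetP => A; rewrite in_setU => /orP[|/GP[AC bA [B]]].
      by rewrite in_setU !in_stf inE; case/orP=> /and3P[-> -> _].
    rewrite in_setD !in_stf => /andP[_ /and4P[BC aB bB _]] [BA _].
    rewrite inE AC (subsetP BA) // !inE aB andbT; exact: adj_neq.
  apply/setP=> A; rewrite in_set0; apply/negP.
  rewrite in_setI in_setU => /andP[+ /GP[AC bA [B]]].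
  rewrite in_setD !in_stf => + /andP[+ /and4P[BC aB bB _]] [BA BN].
  rewrite AC BC /= aB bB (negPf bA) !andbT andbF /= => /andP[_ uA] uB.
  by have /negP := BN _ uA uB; apply; rewrite adjC.
apply: leq_trans FE (leq_trans _ GE); rewrite leq_add2l Gc card_stf2D //.
by rewrite tE leq_sub2r.
Qed.

Lemma triangle_family_bound a b u F : pairwise adj [:: a; b; u] ->
  F \subset facetset ->
  (forall A, A \in F ->
     [\/ a \in A /\ b \in A, a \in A /\ u \in A | b \in A /\ u \in A]) ->
  exists2 v, [set v] \in C & #|F| <= #|star v|.
Proof.
move=> abu FF FP; have abu' := abu; move: abu'; rewrite /= !andbT => /andP[/andP[ab au] bu].
have swap x y : stf [set w in [:: x; y]] = stf [set w in [:: y; x]].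
  by apply: stf_perm => w; rewrite !inE orbC.
have [buab|abbu] := leqP #|stf [set w in [:: b; u]]| #|stf [set w in [:: a; b]]|.
  by exists a; [exact: adj_vertexl ab | exact: triangle_family_star buab].
have [aubu|buau] := leqP #|stf [set w in [:: a; u]]| #|stf [set w in [:: b; u]]|.
  exists b; first exact: adj_vertexl bu.
  apply: (@triangle_family_star b u a) => //; first by clique.
    by move=> A /FP[] [? ?]; [constructor 2 | constructor 3 | constructor 1].
  by rewrite swap.
exists a; first exact: adj_vertexl ab.
apply: (@triangle_family_star a u b) => //; first by clique.
  by move=> A /FP[] [? ?]; [constructor 2 | constructor 1 | constructor 3].
by rewrite swap ltnW.
Qed.

(** * Families with an edge meeting every member *)

Section EdgeCover.
Variable F : {set {set T}}.
Hypotheses (FF : F \subset facetset)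
  (Fint : forall A B, A \in F -> B \in F -> ~~ [disjoint A & B]).

(** If at most one member misses [b], or at most one misses [a], the family is part of a star or of
    Hilton-Milner type. Otherwise [edge_pair] gives a triangle with two vertices in every member, or
    at most 4 members that do not contain both [a] and [b]. These 4 are absorbed by the star of [a]:
    flipping [b] doubles the facets through [a] and [b], which are at least 4. *)
Lemma edge_cover_bound a b : adj a b -> (forall A, A \in F -> a \in A \/ b \in A) ->
  exists2 v, [set v] \in C & #|F| <= #|star v|.
Proof.
have small x y : adj x y -> (forall A, A \in F -> x \in A \/ y \in A) ->
    #|[set A in F | y \notin A]| <= 1 ->
    exists2 v, [set v] \in C & #|F| <= #|star v|.
  move=> xy Fxy le1; exists y; first by apply: (@adj_vertexl _ x); rewrite adjC.
  case: (set_0Vmem [set A in F | y \notin A]) => [F0|[B]].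
    apply: (star_bound FF) => A AF; apply: contraT => yA.
    by move/setP/(_ A): F0; rewrite !inE AF yA.
  rewrite inE => /andP[BF yB]; apply: (HM_bound FF Fint _ BF yB).
    by apply: (@adj_vertexl _ x); rewrite adjC.
  move=> A AF; case: (boolP (y \in A)) => [|yA]; [by left | right].
  by move/card_le1_eqP: le1; apply; rewrite inE ?AF ?BF.
move=> ab Fab; have ba : adj b a by rewrite adjC.
have Fba A : A \in F -> b \in A \/ a \in A by case/Fab; [right | left].
pose Fa := [set A in F | b \notin A]; pose Fb := [set A in F | a \notin A].
have FaP A : A \in Fa -> [/\ A \in facetset, a \in A & b \notin A].
  rewrite inE => /andP[AF bA]; split=> //; first exact: (subsetP FF).
  by case: (Fab A AF) => // bA'; rewrite bA' in bA.
have FbP A : A \in Fb -> [/\ A \in facetset, b \in A & a \notin A].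
  rewrite inE => /andP[AF bA]; split=> //; first exact: (subsetP FF).
  by case: (Fab A AF) => // bA'; rewrite bA' in bA.
have FG A B : A \in Fa -> B \in Fb -> exists2 t, t \in A & t \in B.
  by rewrite !inE => /andP[AF _] /andP[BF _]; apply: (family_meet Fint).
have [Fa1|Fa1] := leqP #|Fa| 1; first exact: small ab Fab Fa1.
have [Fb1|Fb1] := leqP #|Fb| 1; first exact: small ba Fba Fb1.
have [[u [ua ub Fau Fbu]]|F4] := edge_pair ab Fa1 Fb1 FaP FbP FG.
  apply: (@triangle_family_bound a b u) => //; first by clique.
  move=> A AF; case: (boolP (a \in A)) => aA; last first.
    constructor 3; have AFb : A \in Fb by rewrite inE AF.
    by have [_ bA _] := FbP _ AFb; rewrite Fbu.
  case: (boolP (b \in A)) => bA; first by constructor 1.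
  by constructor 2; rewrite Fau // inE AF.
exists a; first exact: adj_vertexl ab.
have Fsum : #|F| <= #|stf [set w in [:: a; b]]| + 4.
  apply: leq_trans (leq_add (leqnn _) F4).
  have [+ _] := leq_card_setU Fa Fb; have [+ _] := leq_card_setU (stf [set w in [:: a; b]]) (Fa :|: Fb).
  move=> H1 H2; apply: leq_trans (leq_trans H1 (leq_add (leqnn _) H2)).
  apply/subset_leq_card/subsetP => A AF; have AC := subsetP FF _ AF.
  rewrite !in_setU in_stf AC [A \in Fa]inE [A \in Fb]inE AF /= andbT.
  by case: (a \in A); case: (b \in A); rewrite ?orbT.
apply: leq_trans Fsum _.
have := @card_stf_flip b [set a]; rewrite !inE (adj_neq ba) => /(_ isT).
rewrite stf1 (_ : _ |: _ = [set w in [:: a; b]]) => [|]; last first.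
  by apply/setP => w; rewrite !inE orbC.
by have := card_stf2 ab; move: #|_| #|star a| => m n; clear; lia.
Qed.
End EdgeCover.

(** * Families with no edge meeting every member *)

Section NoEdgeCover.
Variable F : {set {set T}}.
Hypotheses (FF : F \subset facetset)
  (Fint : forall A B, A \in F -> B \in F -> ~~ [disjoint A & B])
  (Fedge : forall a b, adj a b -> exists2 Y, Y \in F & a \notin Y /\ b \notin Y).

Lemma facet3_extra A a b c : A \in facetset -> exists2 t, t \in A & t \notin [:: a; b; c].
Proof.
move=> AF; have /subsetPn[t tA tn] : ~~ (A \subset [set u in [:: a; b; c]]).
  apply/negP => /subset_leq_card; rewrite (facet_card AF) d3 cardsE.
  by move=> H; have := leq_trans H (card_size _).
by exists t => //; move: tn; rewrite inE.
Qed.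

(** The edge [a s] lies in at least 5 facets: two on [a s b] and two on [a s c], which have only
    [a b c s] in common, and [A1], [A2]. Flipping [s] doubles them. *)
Lemma link_two_edges a b c s A1 A2 : pairwise adj [:: a; b; c; s] ->
  A1 \in facetset -> A2 \in facetset -> A1 != A2 ->
  [/\ a \in A1, s \in A1, b \notin A1 & c \notin A1] ->
  [/\ a \in A2, s \in A2, b \notin A2 & c \notin A2] ->
  10 <= #|star a|.
Proof.
move=> abcs AF1 AF2 A12 [a1 s1 b1 c1] [a2 s2 b2 c2].
have := abcs; rewrite /= !andbT => /andP[/and3P[ab ac as_] /andP[/andP[bc bs] cs]].
pose P := stf [set u in [:: a; s; b]]; pose Q := stf [set u in [:: a; s; c]].
have PQ1 : #|P :&: Q| <= 1.
  apply/card_le1_eqP => A B; rewrite 2!in_setI !in_stf /= !andbT.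
  move=> /andP[/and4P[AF aA sA bA] /andP[_ /and3P[_ _ cA]]].
  move=> /andP[/and4P[BF aB sB bB] /andP[_ /and3P[_ _ cB]]].
  apply: (@facet4_uniq a b c s) => //; exact: pairwise_uniq.
have PQ3 : 3 <= #|P :|: Q|.
  have := cardsUI P Q; rewrite card_stf3; last by clique.
  rewrite card_stf3; last by clique.
  by move: #|_| PQ1 #|_| => m + n; clear; lia.
have sub : [set A1; A2] :|: (P :|: Q) \subset stf [set u in [:: a; s]].
  apply/subsetP=> A; rewrite !in_setU !in_stf /= !inE !andbT.
  by case/orP=> [/orP[]/eqP->|/orP[/and4P[-> -> ->]|/and4P[-> -> ->]]] //;
     rewrite ?AF1 ?AF2 ?a1 ?a2.
have disj : #|[set A1; A2] :&: (P :|: Q)| = 0.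
  apply/eqP; rewrite cards_eq0; apply/eqP/setP => A; rewrite in_set0 in_setI.
  apply/negP => /andP[]; rewrite !in_setU !in_stf /= !inE !andbT.
  by case/orP => /eqP->; rewrite ?(negPf b1) ?(negPf b2) ?(negPf c1) ?(negPf c2) !andbF.
have l5 : 5 <= #|stf [set u in [:: a; s]]|.
  apply: leq_trans (subset_leq_card sub).
  by have := cardsUI [set A1; A2] (P :|: Q); rewrite disj addn0 cards2 A12 => ->; rewrite (leq_add2l 2 3).
have := @card_stf_flip s [set a]; rewrite inE eq_sym (adj_neq as_) => /(_ isT).
rewrite stf1 (_ : _ |: _ = [set u in [:: a; s]]); first by move: l5 #|star a|; move: #|_| => m + n; clear; lia.
by apply/setP=> w; rewrite !inE orbC.
Qed.

(* Here [a], [e] and [y], [s] turn out to be two pairs of opposite vertices of a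
   square [a e y s], and all members without [a] and [s] contain [e] and [y];
   families on opposite sides of the square are cross-intersecting. *)
Lemma two_common_vertices a b c e X Y : X \in F -> Y \in F ->
  pairwise adj [:: a; b; c; e] -> [/\ a \in X, b \in X, c \in X & e \in X] ->
  1 < #|trace F X [set a]| -> a \notin Y -> b \in Y -> c \in Y ->
  #|F| <= #|star a|.
Proof.
move=> XF YF abce [aX bX cX eX] na aY bY cY.
have fF A : A \in F -> A \in C by move/(subsetP FF)/facet_face.
have FC A : A \in F -> A \in facetset by move/(subsetP FF).
have [fX fY] := (fF _ XF, fF _ YF).
have := abce; rewrite /= !andbT => /andP[/and3P[ab ac ae] /andP[/andP[bc be] ce]].
have Xabce w : w \in X -> w \in [:: a; b; c; e].
  move=> wX; apply: contraT; rewrite !inE !negb_or => /and4P[wa wb wc we].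
  by case: (@no_clique5 a b c e w); clique.
have traceP A : A \in trace F X [set a] ->
    [/\ A \in F, a \in A, b \notin A, c \notin A & e \notin A].
  move=> /trace_in[AF AX].
  have H w : w \in X -> (w \in A) = (w == a).
    by move=> wX; move/setP/(_ w): AX; rewrite !inE wX andbT.
  by split; rewrite ?H // 1?eq_sym; try exact: adj_neq.
have [A1 [A2 [A1a A2a A12]]] := card_gt1P na.
have [[A1F a1 b1 c1 e1] [A2F a2 b2 c2 e2]] := (traceP _ A1a, traceP _ A2a).
have [fA1 fA2] := (fF _ A1F, fF _ A2F).
have [s sA1 sY] := family_meet Fint A1F YF.
have eY : e \notin Y.
  by apply/negP => eY; case: (@no_clique5 a b c e s); clique.
have abcs : pairwise adj [:: a; b; c; s] by clique.
have se : ~~ adj s e.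
  by apply/negP => se; case: (@no_clique5 a b c e s); clique.
(* Such a member meets [Y] in a vertex completing [a b c] to a facet. Only [e] and [s] do so, and
   the member misses [e]. *)
have sA A : A \in trace F X [set a] -> s \in A.
  move=> /traceP[AF aA bA cA eA]; have fA := fF _ AF.
  have [t tA tY] := family_meet Fint AF YF.
  have abct : pairwise adj [:: a; b; c; t] by clique.
  have := ext3 abcs abct abce => /or3P[/eqP->//|/eqP E|/eqP E].
    by rewrite E (negPf e1) in sA1.
  by rewrite -E tA in eA.
have sA2 := sA _ A2a.
have [y yY] := facet3_extra b c s (FC _ YF); rewrite !inE !negb_or => /and3P[yb yc ys].
have Ybcsy w : w \in Y -> w \in [:: b; c; s; y].
  move=> wY; apply: contraT; rewrite !inE !negb_or => /and4P[wb wc ws wy].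
  by case: (@no_clique5 b c s y w); clique.
have ya : ~~ adj y a.
  by apply/negP => ya; case: (@no_clique5 a b c s y); clique.
(* If [Z] contained [b], then [c], [t1] and [t2] would all complete the triangle [a s b], so
   [t1 = t2], and [A1 = A2] by the triangle [a s t1]. The same holds for [c], which leaves only [e]
   and [y] for meeting [X] and [Y]. *)
have off Z : Z \in F -> a \notin Z -> s \notin Z ->
    [/\ b \notin Z, c \notin Z, e \in Z & y \in Z].
  move=> ZF aZ sZ; have fZ := fF _ ZF.
  have [t1 t1A t1Z] := family_meet Fint A1F ZF.
  have [t2 t2A t2Z] := family_meet Fint A2F ZF.
  have nb x x' : x \in Y -> adj a x -> adj s x -> adj a x' -> adj s x' -> adj x x' ->
      x \notin A1 -> x' \notin A1 -> x \notin A2 -> x' \notin A2 -> x \notin Z.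
    move=> xY ax sx ax' sx' xx' x1 x'1 x2 x'2; apply/negP => xZ.
    have asx' : pairwise adj [:: a; s; x; x'] by clique.
    have as1 : pairwise adj [:: a; s; x; t1] by clique.
    have as2 : pairwise adj [:: a; s; x; t2] by clique.
    have := ext3 asx' as1 as2 => /or3P[/eqP E|/eqP E|/eqP E].
    - by rewrite E t1A in x'1.
    - by rewrite E t2A in x'2.
    rewrite -{}E in t2A; case/eqP: A12; apply: (@facet3_uniq a s t1 x) => //.
    + exact: FC.
    + exact: FC.
    by clique.
  have bZ : b \notin Z by apply: (nb b c) => //; adjacent.
  have cZ : c \notin Z by apply: (nb c b) => //; adjacent.
  have [u uX uZ] := family_meet Fint XF ZF; have [v vY vZ] := family_meet Fint YF ZF.
  split=> //.
    move: (Xabce _ uX) uZ; rewrite !inE => /or4P[]/eqP-> //.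
    - by rewrite (negPf aZ).
    - by rewrite (negPf bZ).
    - by rewrite (negPf cZ).
  move: (Ybcsy _ vY) vZ; rewrite !inE => /or4P[]/eqP-> //.
  - by rewrite (negPf bZ).
  - by rewrite (negPf cZ).
  - by rewrite (negPf sZ).
have as_ : adj a s by adjacent.
have [Z ZF [aZ sZ]] := Fedge as_; have fZ := fF _ ZF.
have [bZ cZ eZ yZ] := off _ ZF aZ sZ.
have ey : adj e y by adjacent.
have FZ A : A \in F -> e \notin A -> y \notin A ->
    exists w, [/\ w \in A, w \in Z, adj w e & adj w y].
  move=> AF eA yA; have [w wA wZ] := family_meet Fint AF ZF.
  by exists w; split=> //; adjacent.
have Z2 w1 w2 w3 : w1 \in Z -> w2 \in Z -> w3 \in Z -> adj w1 e -> adj w1 y ->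
    adj w2 e -> adj w2 y -> adj w3 e -> adj w3 y -> [|| w1 == w2, w1 == w3 | w2 == w3].
  move=> z1 z2 z3 we1 wy1 we2 wy2 we3 wy3; apply: contraT.
  rewrite !negb_or => /and3P[w12 w13 w23].
  by case: (@no_clique5 e y w1 w2 w3); clique.
(* Besides [e] and [y], the facet [Z] has just the vertices [w] and [w'], and each of [A1], [A2]
   contains one of them. If they contain different ones, uniqueness of triangle extensions puts [w']
   into both; a common one, with [a] and [s], forces [A1 = A2]. *)
have mixed x x' w w' : adj x w -> adj x' w' -> w \in Z -> w' \in Z ->
    adj w e -> adj w y -> adj w' e -> adj w' y -> w != w' ->
    adj x a -> adj x s -> x \notin A1 -> x \notin A2 -> x \notin Z ->
    adj x' a -> adj x' s -> x' \notin A1 -> x' \notin A2 -> x' \notin Z -> False.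
  move=> xw xw' wZ wZ' we wy we' wy' ww' xa xs x1 x2 xZ xa' xs' x1' x2' xZ'.
  have yA A : A \in C -> a \in A -> y \notin A.
    move=> fA aA; apply: contra ya => yA; adjacent.
  have [u1 [u1A u1Z u1e u1y]] := FZ _ A1F e1 (yA _ fA1 a1).
  have [u2 [u2A u2Z u2e u2y]] := FZ _ A2F e2 (yA _ fA2 a2).
  have same t x0 : t \in A1 -> t \in A2 -> adj x0 t -> adj x0 a -> adj x0 s ->
      x0 \notin A1 -> x0 \notin A2 -> t \in Z -> False.
    move=> t1 t2 x0t x0a x0s x01 x02 tZ; case/eqP: A12.
    apply: (@facet3_uniq a s t x0) => //; [exact: FC | exact: FC | clique].
  have extra A t t' x0 : A \in F -> a \in A -> s \in A -> t \in A -> t \in Z ->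
      t' \in Z -> adj t' a -> adj t' s -> t != t' -> adj x0 t -> adj x0 a -> adj x0 s ->
      x0 \notin A -> x0 \notin Z -> t' \in A.
    move=> AF aA sA' tA tZ tZ' ta' ts' tt' x0t x0a x0s x0A x0Z; have fA := fF _ AF.
    have [f fA' ] := facet3_extra a s t (FC _ AF).
    rewrite !inE !negb_or => /and3P[fa fs ft].
    have H0 : pairwise adj [:: a; s; t; x0] by clique.
    have H1 : pairwise adj [:: a; s; t; t'] by clique.
    have H2 : pairwise adj [:: a; s; t; f] by clique.
    have := ext3 H0 H1 H2 => /or3P[/eqP E|/eqP E|/eqP->//].
      by rewrite E tZ' in x0Z.
    by rewrite E fA' in x0A.
  have [E1|n1] := eqVneq u1 w; have [E2|n2] := eqVneq u2 w.
  - by rewrite E1 in u1A; rewrite E2 in u2A; apply: (same w x).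
  - have E2' : u2 = w'.
      have := Z2 w w' u2 wZ wZ' u2Z we wy we' wy' u2e u2y.
      by rewrite (negPf ww') (eq_sym w) (negPf n2) => /eqP.
    rewrite {}E1 in u1A; rewrite {}E2' in u2A.
    have w'A1 : w' \in A1 by apply: (extra A1 w w' x) => //; adjacent.
    by apply: (same w' x').
  - have E1' : u1 = w'.
      have := Z2 w w' u1 wZ wZ' u1Z we wy we' wy' u1e u1y.
      by rewrite (negPf ww') (eq_sym w) (negPf n1) => /eqP.
    rewrite {}E2 in u2A; rewrite {}E1' in u1A.
    have w'A2 : w' \in A2 by apply: (extra A2 w w' x) => //; adjacent.
    by apply: (same w' x').
  have E1' : u1 = w'.
    have := Z2 w w' u1 wZ wZ' u1Z we wy we' wy' u1e u1y.
    by rewrite (negPf ww') (eq_sym w) (negPf n1) => /eqP.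
  have E2' : u2 = w'.
    have := Z2 w w' u2 wZ wZ' u2Z we wy we' wy' u2e u2y.
    by rewrite (negPf ww') (eq_sym w) (negPf n2) => /eqP.
  by rewrite E1' in u1A; rewrite E2' in u2A; apply: (same w' x').
have bcP x : x \in [:: b; c] ->
    [/\ adj x a, adj x s, x \notin Z & [/\ x \notin A1, x \notin A2 & x \notin A1]].
  by rewrite !inE => /orP[]/eqP->; split=> //; adjacent.
(* Two such members with the same [x] and [w] agree by the triangle [g x w]; if exactly one of these
   vertices agrees there is a clique of five; if neither does, [mixed] applies. *)
have le1 g h (G : {set {set T}}) : g \notin Z -> adj g b -> adj g c -> adj g h ->
    adj h b -> adj h c -> (forall w, adj w e -> adj w y -> adj h w) ->
    (forall A, A \in G -> [/\ A \in F, g \in A, h \notin A &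
       (exists2 x, x \in A & x \in [:: b; c]) /\
       exists w, [/\ w \in A, w \in Z, adj w e & adj w y]]) -> #|G| <= 1.
  move=> gZ gb gc gh hb hc hw GP; apply/card_le1_eqP => A B AG BG.
  have [AF gA hA [[x xA xbc] [w [wA wZ we wy]]]] := GP _ AG.
  have [BF gB hB [[x' xB' xbc'] [w' [wB' wZ' we' wy']]]] := GP _ BG.
  have [xa xs xZ [x1 x2 _]] := bcP _ xbc; have [xa' xs' xZ' [x1' x2' _]] := bcP _ xbc'.
  have [fA fB] := (fF _ AF, fF _ BF); have [hw1 hw2] := (hw _ we wy, hw _ we' wy').
  have [gx hx] : adj g x /\ adj h x by move: xbc; rewrite !inE => /orP[]/eqP->.
  have [gx' hx'] : adj g x' /\ adj h x' by move: xbc'; rewrite !inE => /orP[]/eqP->.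
  have xw : adj x w by adjacent.
  have xw' : adj x' w' by adjacent.
  have gw : adj g w by adjacent.
  have gw' : adj g w' by adjacent.
  have xx' : x != x' -> adj x x'.
    by move: xbc xbc'; rewrite !inE => /orP[]/eqP-> /orP[]/eqP->; rewrite ?eqxx // adjC.
  have [E|/xx'{}xx'] := eqVneq x x'; have [E'|ww'] := eqVneq w w'.
  - rewrite -E in xB'; rewrite -E' in wB'; apply/esym.
    by apply: (@facet3_uniq g x w h); rewrite ?FC //; clique.
  - by rewrite -{}E in xw' xa' xs' xZ'; case: (@no_clique5 g x h w w'); clique.
  - by rewrite -{}E' in xw'; case: (@no_clique5 g x x' h w); clique.
  by case: (mixed x x' w w').
have meetX A : A \in F -> e \notin A -> A \notin trace F X [set a] ->
    exists2 x, x \in A & x \in [:: b; c].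
  move=> AF eA; rewrite inE AF /= => AX.
  have [u uX uA] := family_meet Fint XF AF.
  case: (boolP (b \in A)) => bA; first by exists b; rewrite ?inE ?eqxx.
  case: (boolP (c \in A)) => cA; first by exists c; rewrite ?inE ?eqxx ?orbT.
  case/eqP: AX; have XA w : w \in A -> w \in X -> w = a.
    move=> wA /Xabce; rewrite !inE => /or4P[]/eqP E //; move: wA; rewrite E.
    - by rewrite (negPf bA).
    - by rewrite (negPf cA).
    - by rewrite (negPf eA).
  apply/setP=> w; rewrite !inE; apply/andP/eqP => [[wA wX]|->]; first exact: XA.
  by rewrite aX -(XA u).
(* One family for each side of the square, and two for the members with a single one of [a], [s] and
   no side at it. Opposite sides contribute at most 4 per pair and the other two families at most 1
   each; the total 10 is the bound of [link_two_edges]. *)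
pose Fas := [set A in F | (a \in A) && (s \in A)].
pose Fey := [set A in F | (a \notin A) && (s \notin A)].
pose Fae := [set A in F | (a \in A) && (e \in A)].
pose Fsy := [set A in F | (s \in A) && (y \in A)].
pose Fa := [set A in F | [&& a \in A, s \notin A & e \notin A]].
pose Fs := [set A in F | [&& s \in A, a \notin A & y \notin A]].
have nadj A u v : A \in C -> ~~ adj u v -> u != v -> u \in A -> v \notin A.
  by move=> fA uv uv' uA; apply: contra uv => vA; apply: (face_adj fA).
have ya' : y != a by distinct.
have se' : s != e by distinct.
have Fa1 : #|Fa| <= 1.
  apply: (le1 a e) => //; try adjacent; first by move=> w we _; rewrite adjC.
  move=> A; rewrite inE => /and4P[AF aA sA' eA]; split=> //; split.
    by apply: meetX => //; apply: contra sA'; apply: sA.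
  by apply: FZ => //; apply: (nadj _ a); rewrite ?fF 1?adjC // eq_sym.
have Fs1 : #|Fs| <= 1.
  apply: (le1 s y) => //; try adjacent; first by move=> w _ wy; rewrite adjC.
  move=> A; rewrite inE => /and4P[AF sA' aA yA]; have eA := nadj _ _ _ (fF _ AF) se se' sA'.
  split=> //; split; last exact: FZ.
  by apply: meetX => //; apply: contra aA => /traceP[].
have F1 : #|Fas| + #|Fey| <= 4.
  apply: (@edge_cross a s e y) => //.
  - by apply/set0Pn; exists A1; rewrite inE A1F a1.
  - by apply/set0Pn; exists Z; rewrite inE ZF aZ.
  - move=> A; rewrite inE => /and3P[AF aA sA']; split=> //; first exact: FC.
      exact: (nadj _ s e (fF _ AF)).
    by apply: (nadj _ a y (fF _ AF)); rewrite 1?adjC // eq_sym.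
  - move=> A; rewrite inE => /and3P[AF aA sA'].
    by have [_ _ eA yA] := off _ AF aA sA'; split=> //; exact: FC.
  by move=> A B; rewrite !inE => /andP[AF _] /andP[BF _]; apply: (family_meet Fint).
have F2 : #|Fae| + #|Fsy| <= 4.
  apply: (@edge_cross a e s y) => //; first by adjacent.
  - by apply/set0Pn; exists X; rewrite inE XF aX.
  - by apply/set0Pn; exists Y; rewrite inE YF sY.
  - move=> A; rewrite inE => /and3P[AF aA eA]; split=> //; first exact: FC.
      by apply: (nadj _ e s (fF _ AF)); rewrite 1?adjC // eq_sym.
    by apply: (nadj _ a y (fF _ AF)); rewrite 1?adjC // eq_sym.
  - move=> A; rewrite inE => /and3P[AF sA' yA]; split=> //; first exact: FC.
      exact: (nadj _ y a (fF _ AF)).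
    exact: (nadj _ s e (fF _ AF)).
  by move=> A B; rewrite !inE => /andP[AF _] /andP[BF _]; apply: (family_meet Fint).
have FE : F \subset (Fas :|: Fey) :|: (Fae :|: Fsy) :|: (Fa :|: Fs).
  apply/subsetP => A AF; rewrite !in_setU !inE AF /=.
  by case: (a \in A); case: (s \in A); case: (e \in A); case: (y \in A).
have leU (G H : {set {set T}}) : #|G :|: H| <= #|G| + #|H|.
  by rewrite -cardsUI leq_addr.
apply: leq_trans (subset_leq_card FE) _.
have F10 : #|(Fas :|: Fey) :|: (Fae :|: Fsy) :|: (Fa :|: Fs)| <= 10.
  apply: leq_trans (leU _ _) (@leq_add _ _ 8 2 _ _).
    apply: leq_trans (leU _ _) (@leq_add _ _ 4 4 _ _).
      exact: leq_trans (leU _ _) F1.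
    exact: leq_trans (leU _ _) F2.
  exact: leq_trans (leU _ _) (leq_add Fa1 Fs1).
apply: leq_trans F10 _; apply: (@link_two_edges a b c s A1 A2) => //; exact: FC.
Qed.

Lemma trace_le1 X S : X \in F -> S \subset X -> 1 < #|S| -> #|trace F X S| <= 1.
Proof.
move=> XF SX S1; have [S2|S2] := leqP #|S| 2; last first.
  by apply: trace_codim1 => //; rewrite d3.
have /cards2P[u [v [uv SE]]] : #|S| == 2 by rewrite eqn_leq S2.
have SS w : w \in [set u; v] -> w \in X by rewrite -SE => /(subsetP SX).
have uvadj : adj u v.
  by apply: (face_adj (family_face FF XF)); rewrite ?SS // !inE eqxx ?orbT.
have [Y YF [uY vY]] := Fedge uvadj.
apply: (trace_codim2 FF Fint XF YF SX); first by rewrite d3 SE cards2 uv.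
rewrite disjoint_sym SE; apply/pred0P => w /=; rewrite !inE.
by apply/negP => /andP[/orP[]/eqP->]; apply/negP.
Qed.

Lemma trace1P X p A : p \in X -> A \in trace F X [set p] ->
  [/\ A \in F, p \in A & forall w, w \in X -> w \in A -> w = p].
Proof.
move=> pX /trace_in[AF /setP AX]; split=> // [|w wX wA].
  by have := AX p; rewrite !inE pX eqxx andbT.
by have := AX w; rewrite !inE wX wA /= => /esym/eqP.
Qed.

Lemma trace1_pair X p q : X \in F -> p \in X -> q \in X -> p != q ->
  1 < #|trace F X [set p]| -> 1 < #|trace F X [set q]| ->
  (exists u, [/\ adj u p, adj u q, forall A, A \in trace F X [set p] -> u \in A
    & forall B, B \in trace F X [set q] -> u \in B]) \/
  #|trace F X [set p]| + #|trace F X [set q]| <= 4.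
Proof.
move=> XF pX qX pq np nq; have fX := family_face FF XF.
apply: edge_pair => //; first exact: (face_adj fX).
- move=> A /(trace1P pX)[AF pA AX]; split=> //; first exact: (subsetP FF).
  by apply: contra pq => qA; rewrite (AX q).
- move=> A /(trace1P qX)[AF qA AX]; split=> //; first exact: (subsetP FF).
  by apply: contra pq => pA; rewrite (AX p).
by move=> A B /trace_in[AF _] /trace_in[BF _]; apply: (family_meet Fint).
Qed.

(** If the two traces share no vertex [u], their multiplicities add up to at most 4. Otherwise the
    members with trace [[set p]] contain the edge [p u], and a member avoiding both its ends leaves
    room for 3. *)
Lemma trace1_le3 X p q : X \in F -> p \in X -> q \in X -> p != q ->
  1 < #|trace F X [set p]| -> 1 < #|trace F X [set q]| -> #|trace F X [set p]| <= 3.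
Proof.
move=> XF pX qX pq np nq.
have [[u [up uq Au Bu]]|H] := trace1_pair XF pX qX pq np nq; last first.
  by move: np nq H; move: #|_| #|_| => m n; clear; lia.
have pu : adj p u by rewrite adjC.
have [Y YF [pY uY]] := Fedge pu.
apply: (proj1 (edge_family_meeting pu (family_face FF YF) pY uY _)) => A Ap.
have [AF pA _] := trace1P pX Ap; split=> //; first exact: (subsetP FF).
  exact: Au.
exact: (family_meet Fint).
Qed.

(** With [u] and [u'] distinct, the members would all contain the ridge [p u u']. *)
Lemma trace1_common X p u u' : p \in X -> 2 < #|trace F X [set p]| ->
  adj u p -> adj u' p -> (forall A, A \in trace F X [set p] -> u \in A) ->
  (forall A, A \in trace F X [set p] -> u' \in A) -> u = u'.
Proof.
move=> pX np up up' Au Au'; apply/eqP; apply: contraT => uu'.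
suff H : #|trace F X [set p]| <= 2 by rewrite ltnNge H in np.
have /card_gt0P[A Ap] : 0 < #|trace F X [set p]| by apply: leq_trans np.
have [AF pA _] := trace1P pX Ap; have [uA uA'] := (Au _ Ap, Au' _ Ap).
have fA := family_face FF AF.
rewrite -(@card_stf3 p u u'); last by clique.
apply/subset_leq_card/subsetP => B Bp; have [BF pB _] := trace1P pX Bp.
by rewrite in_stf (subsetP FF) //= pB Au // Au'.
Qed.

(** * Counting all sixteen traces on one member *)

Section ReferenceMember.
Variable X : {set T}.
(** If [Xsingle] fails, some member contains two vertices of [X] but misses the repeated vertex [p],
    and [two_common_vertices] applies. *)
Hypotheses (XF : X \in F)
  (Xsingle : forall p S, p \in X -> 1 < #|trace F X [set p]| -> S \subset X ->
     p \notin S -> 1 < #|S| -> trace F X S = set0).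

(** The three traces share a vertex [u], and a member [Y] without [a] and [u] meets [X] in the
    fourth vertex [e] only. Multiplicity 3 is the extremal case of [edge_family_meeting], giving
    [p], [q] in [Y] for [a] and [p'], [q'] for [b]. All four are adjacent to [u], unlike [e]; only
    [p'] and [q'] are adjacent to [b]. So [Y] would have five vertices. *)
Lemma trace1_three a b c : a \in X -> b \in X -> c \in X -> a != b -> a != c ->
  b != c -> #|trace F X [set a]| = 3 -> #|trace F X [set b]| = 3 ->
  #|trace F X [set c]| = 3 -> False.
Proof.
move=> aX bX cX ab ac bc na nb nc; have fX := family_face FF XF.
have [||[u [ua ub Au Bu]]|] := trace1_pair XF aX bX ab; rewrite ?na ?nb //.
have [||[u' [ua' uc Au' Cu]]|] := trace1_pair XF aX cX ac; rewrite ?na ?nc //.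
have uu : u = u' by apply: (trace1_common aX) => //; rewrite na.
rewrite -{}uu in ua' uc Au' Cu.
have au : adj a u by rewrite adjC.
have [Y YF [aY uY]] := Fedge au; have fY := family_face FF YF.
have YS : #|Y :&: X| <= 1.
  rewrite leqNgt; apply/negP => YS; have := Xsingle aX _ (subsetIr Y X) _ YS.
  rewrite na inE (negPf aY) => /(_ isT isT)/setP/(_ Y).
  by rewrite !inE YF eqxx.
have [e eX eY] := family_meet Fint XF YF.
have YXe w : w \in X -> w \in Y -> w = e.
  by move=> wX wY; move/card_le1_eqP: YS; apply; rewrite inE ?wX ?wY ?eX ?eY.
have Ytr v : v \in X -> (forall B, B \in trace F X [set v] -> u \in B) -> v \notin Y.
  move=> vX Bv; apply: contra uY => vY; apply: Bv; rewrite inE YF /=.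
  apply/eqP/setP => w; rewrite !inE; apply/andP/eqP => [[wY wX]|->//].
  by rewrite (YXe _ wX wY) (YXe _ vX vY).
have [bY cY] := (Ytr _ bX Bu, Ytr _ cX Cu).
have ue : ~~ adj u e.
  apply/negP => ue; case: (@no_clique5 a b c e u); clique.
have meetY v : v \in X -> v \notin Y -> adj v u ->
    (forall A, A \in trace F X [set v] -> u \in A) -> forall A,
    A \in trace F X [set v] -> [/\ A \in facetset, v \in A, u \in A &
      exists2 t, t \in A & t \in Y].
  move=> vX vY vu vA A Av; have [AF vA' _] := trace1P vX Av.
  by split; [exact: (subsetP FF) | | exact: vA | exact: (family_meet Fint)].
have bu : adj b u by rewrite adjC.
have [_ /(_ na)[p [q [pq pY qY [aup auq pF qF]]]]] :=
  edge_family_meeting au fY aY uY (meetY _ aX aY au Au).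
have [_ /(_ nb)[p' [q' [pq' pY' qY' [bup buq _ _]]]]] :=
  edge_family_meeting bu fY bY uY (meetY _ bX bY bu Bu).
have adju v w : pairwise adj [:: v; u; w] -> adj v w /\ adj u w.
  by rewrite /= !andbT => /andP[/andP[_ ->] ->].
have [[ap up] [aq uq]] := (adju _ _ aup, adju _ _ auq).
have [[bp' up'] [bq' uq']] := (adju _ _ bup, adju _ _ buq).
have noe v : adj u v -> v != e by move=> uv; apply: contraNneq ue => <-.
have [pe qe pe' qe'] := And4 (noe _ up) (noe _ uq) (noe _ up') (noe _ uq').
have nob r : r \in Y -> adj a r -> adj u r ->
    stf [set w in [:: a; u; r]] \subset trace F X [set a] -> ~~ adj b r.
  move=> rY ar ur rF; apply/negP => br.
  have abadj : adj a b by adjacent.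
  have aurb : pairwise adj [:: a; u; r; b] by clique.
  have D : [set w in [:: a; u; r; b]] \in stf [set w in [:: a; u; r]].
    by rewrite in_stf clique_seq_facet ?d3 //= !inE !eqxx !orbT.
  have [_ _ /(_ b bX)] := trace1P aX (subsetP rF _ D).
  by rewrite !inE eqxx !orbT => /(_ isT) E; rewrite E eqxx in ab.
have [pb qb] := (nob _ pY ap up pF, nob _ qY aq uq qF).
have neq v w : adj b v -> ~~ adj b w -> v != w by move=> bv; apply: contraNneq => <-.
have [n1 n2 n3 n4] := And4 (neq _ _ bp' pb) (neq _ _ bp' qb) (neq _ _ bq' pb) (neq _ _ bq' qb).
by case: (@no_clique5 p q p' q' e); clique.
Qed.

(** The vertex [u] common to all members with trace [[set a]] would be adjacent to all of [X]. *)
Lemma trace1_four a b c e : a \in X -> b \in X -> c \in X -> e \in X ->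
  uniq [:: a; b; c; e] -> #|trace F X [set a]| = 3 -> 1 < #|trace F X [set b]| ->
  1 < #|trace F X [set c]| -> 1 < #|trace F X [set e]| -> False.
Proof.
move=> aX bX cX eX; rewrite /= !inE !negb_or.
move=> /and4P[/and3P[ab ac ae] /andP[bc be] ce _] na nb nc ne.
have fX := family_face FF XF.
have get v : v \in X -> a != v -> 1 < #|trace F X [set v]| ->
    exists u, [/\ adj u a, adj u v & forall A, A \in trace F X [set a] -> u \in A].
  move=> vX av nv; have [||[u [ua uv Au _]]|] := trace1_pair XF aX vX av => //.
  - by rewrite na.
  - by exists u.
  by rewrite na; move: nv; move: #|_| => m; clear; lia.
have [u [ua ub Au]] := get _ bX ab nb.
have [u1 [u1a u1c Au1]] := get _ cX ac nc; have [u2 [u2a u2e Au2]] := get _ eX ae ne.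
have E1 : u = u1 by apply: (trace1_common aX) => //; rewrite na.
have E2 : u = u2 by apply: (trace1_common aX) => //; rewrite na.
by rewrite -{}E1 in u1c; rewrite -{}E2 in u2e; case: (@no_clique5 a b c e u); clique.
Qed.

(** Membership is prescribed vertex by vertex, so that traces on [X] are indexed by four Booleans
    and the final count is linear arithmetic. *)
Definition pattern_card (G : {set {set T}}) (s : seq (T * bool)) :=
  #|[set A in G | all (fun x => (x.1 \in A) == x.2) s]|.

Lemma pattern_card_cons G s v :
  pattern_card G s = pattern_card G ((v, true) :: s) + pattern_card G ((v, false) :: s).
Proof.
rewrite /pattern_card -cardsUI [X in _ + #|pred_of_set X|](_ : _ = set0) ?cards0 ?addn0.
  congr #|pred_of_set _|; apply/setP => A; rewrite !inE /=.
  by case: (A \in G); case: (v \in A); rewrite //= orbF.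
by apply/setP => A; rewrite !inE /=; case: (v \in A); rewrite /= ?andbF ?andFb.
Qed.

Lemma pattern_card_nil G : #|G| = pattern_card G [::].
Proof. by apply: eq_card => A; rewrite !inE /= andbT. Qed.

Lemma pattern_card_star v : #|star v| = pattern_card facetset [:: (v, true)].
Proof. by apply: eq_card => A; rewrite !inE /= andbT eqb_id. Qed.

Lemma pattern_card_trace (a b c e : T) (p q r s : bool) G :
  (forall w, (w \in X) = (w \in [:: a; b; c; e])) -> uniq [:: a; b; c; e] ->
  exists S, [/\ S \subset X, #|S| = p + q + r + s,
    [/\ (a \in S) = p, (b \in S) = q, (c \in S) = r & (e \in S) = s] &
    pattern_card G [:: (a, p); (b, q); (c, r); (e, s)] = #|trace G X S|].
Proof.
move=> XE us; pose S := [set w in X | nth false [:: p; q; r; s] (index w [:: a; b; c; e])].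
have [aS bS cS eS] : [/\ (a \in S) = p, (b \in S) = q, (c \in S) = r & (e \in S) = s].
  move: us; rewrite /= !inE !negb_or andbT => /and3P[/and3P[ab ac ae] /andP[bc be] ce].
  by rewrite /S !XE !inE /= !eqxx (negPf ab) (negPf ac) (negPf ae) (negPf bc)
    (negPf be) (negPf ce) !orbT.
have SX : S \subset X by apply/subsetP => w; rewrite /S inE => /andP[].
clearbody S; exists S; split=> //.
  have -> : #|S| = count [in S] [:: a; b; c; e].
    rewrite -size_filter -(card_uniqP _) ?filter_uniq //; apply: eq_card => w.
    by rewrite mem_filter -XE; case wS: (w \in S); rewrite // (subsetP SX).
  by rewrite /= aS bS cS eS addn0 !addnA.
apply: eq_card => A; rewrite !inE /= andbT; congr (_ && _); apply/and4P/eqP.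
  move=> [/eqP Ea /eqP Eb /eqP Ec /eqP Ee]; apply/setP => w; rewrite inE XE.
  rewrite !inE; apply/andP/idP => [[wA wE]|wS].
    by case/or4P: wE => /eqP E; move: wA; rewrite E ?aS ?bS ?cS ?eS ?Ea ?Eb ?Ec ?Ee.
  have := subsetP SX _ wS; rewrite XE !inE => wE; split=> //; move: wE wS.
  by case/or4P=> /eqP->; rewrite ?aS ?bS ?cS ?eS ?Ea ?Eb ?Ec ?Ee.
move=> AX; have H w : w \in X -> (w \in A) = (w \in S).
  by move=> wX; rewrite -AX inE wX andbT.
by rewrite !H ?XE ?inE ?eqxx ?orbT // aS bS cS eS !eqxx.
Qed.

Lemma reference_bound : exists2 v, v \in X & #|F| <= #|star v|.
Proof.
have XC := subsetP FF _ XF; have fX := facet_face XC.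
have [x0 x0X] : exists x, x \in X by apply/card_gt0P; rewrite (facet_card XC).
case: (@arg_maxnP T x0 [in X] (fun p => #|trace F X [set p]|) x0X) => a /= aX amax.
exists a => //.
have [/exists_inP[b bX /andP[ba nb]]|/exists_inPn nb] :=
    boolP [exists b in X, (b != a) && (1 < #|trace F X [set b]|)]; last first.
  apply: (card_star_trace FF Fint XF aX) => S SX aS S0.
  have [S1|S1] := ltnP 1 #|S|; first exact: trace_le1.
  have [p pS] := set0Pn _ S0; have SE : S = [set p].
    by apply/esym/eqP; rewrite eqEcard sub1set pS cards1.
  have := nb p (subsetP SX _ pS); rewrite negb_and negbK -leqNgt SE.
  by case/orP=> // /eqP pa; rewrite -pa pS in aS.
have na : 1 < #|trace F X [set a]| by apply: leq_trans nb (amax _ bX).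
have [c cX] := facet3_extra a b b XC; rewrite !inE !negb_or => /and3P[ca cb _].
have [e eX] := facet3_extra a b c XC; rewrite !inE !negb_or => /and3P[ea eb ec].
have us : uniq [:: a; b; c; e].
  by rewrite /= !inE !negb_or !(eq_sym a) ba ca ea !(eq_sym b) cb eb eq_sym ec.
have XE w : (w \in X) = (w \in [:: a; b; c; e]).
  suff -> : X = [set u in [:: a; b; c; e]] by rewrite inE.
  apply/esym/eqP; rewrite eqEcard (facet_card XC) d3 cardsE (card_uniqP us) andbT.
  by apply/subsetP => u; rewrite !inE => /or4P[]/eqP->.
pose f p q r s := pattern_card F [:: (a, p); (b, q); (c, r); (e, s)].
pose g p q r s := pattern_card facetset [:: (a, p); (b, q); (c, r); (e, s)].
have FE : #|F| = \sum_p \sum_q \sum_r \sum_s f p q r s.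
  by rewrite !big_bool /= pattern_card_nil (pattern_card_cons _ [::] e)
    !(pattern_card_cons _ [:: (e, _)] c) !(pattern_card_cons _ [:: (c, _); (e, _)] b)
    !(pattern_card_cons _ [:: (b, _); (c, _); (e, _)] a) /f; clear; lia.
have GE : #|star a| = \sum_q \sum_r \sum_s g true q r s.
  have aE q r s : pattern_card facetset [:: (b, q); (c, r); (e, s); (a, true)] = g true q r s.
    apply: eq_card => A; rewrite !inE /= !andbT; congr (_ && _).
    by rewrite [RHS]andbC -!andbA.
  rewrite !big_bool /= pattern_card_star (pattern_card_cons _ [:: (a, true)] e).
  rewrite !(pattern_card_cons _ [:: (e, _); (a, true)] c).
  rewrite !(pattern_card_cons _ [:: (c, _); (e, _); (a, true)] b) !aE.
  by clear; lia.
have fg p q r s : f p q r s <= g p q r s.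
  by apply/subset_leq_card/subsetP => A; rewrite !inE => /andP[/(subsetP FF)-> ->].
have g1 p q r s : 0 < g p q r s.
  have [S [SX _ _]] := pattern_card_trace p q r s facetset XE us.
  by rewrite -/(g p q r s) => ->; apply: trace_facet_gt0.
have f1 (p q r s : bool) : 1 < p + q + r + s -> f p q r s <= 1.
  have [S [SX SE _]] := pattern_card_trace p q r s F XE us.
  by rewrite -/(f p q r s) => -> S1; apply: trace_le1; rewrite ?SE.
have f0 : f false false false false = 0.
  have [S [SX /eqP S0 _ fS]] := pattern_card_trace false false false false F XE us.
  by move: S0; rewrite /f fS cards_eq0 => /eqP->; rewrite (trace_set0 Fint) ?cards0.
have fc p q r s : f p q r s = 0 \/ f (~~ p) (~~ q) (~~ r) (~~ s) = 0.
  have [S [SX _ [aS bS cS eS] fS]] := pattern_card_trace p q r s F XE us.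
  have [S' [SX' _ [aS' bS' cS' eS'] fS']] :=
    pattern_card_trace (~~ p) (~~ q) (~~ r) (~~ s) F XE us.
  rewrite /f fS fS'; suff -> : S' = X :\: S by apply: trace_compl FF Fint _ _ XF SX.
  apply/setP => w; rewrite inE; have [wX|wX] := boolP (w \in X).
    by move: wX; rewrite XE !inE => /or4P[]/eqP->; rewrite andbT ?aS ?bS ?cS ?eS.
  by rewrite andbF; apply: contraNF wX; apply: (subsetP SX').
have one v (S : {set T}) : #|S| = 1 -> v \in S -> S = [set v].
  by move=> S1 vS; apply/esym/eqP; rewrite eqEcard sub1set vS cards1 S1.
have fa : f true false false false = #|trace F X [set a]|.
  have [S [_ S1 [aS _ _ _] fS]] := pattern_card_trace true false false false F XE us.
  by rewrite /f fS (one a S S1 aS).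
have fb : f false true false false = #|trace F X [set b]|.
  have [S [_ S1 [_ bS _ _] fS]] := pattern_card_trace false true false false F XE us.
  by rewrite /f fS (one b S S1 bS).
have fcc : f false false true false = #|trace F X [set c]|.
  have [S [_ S1 [_ _ cS _] fS]] := pattern_card_trace false false true false F XE us.
  by rewrite /f fS (one c S S1 cS).
have fe : f false false false true = #|trace F X [set e]|.
  have [S [_ S1 [_ _ _ eS] fS]] := pattern_card_trace false false false true F XE us.
  by rewrite /f fS (one e S S1 eS).
have za (q r s : bool) : 1 < q + r + s -> f false q r s = 0.
  have [S [SX SE [aS _ _ _] fS]] := pattern_card_trace false q r s F XE us.
  by move=> S1; rewrite /f fS (Xsingle aX) ?cards0 ?aS ?SE.
have zb (p r s : bool) : 1 < p + r + s -> f p false r s = 0.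
  have [S [SX SE [_ bS _ _] fS]] := pattern_card_trace p false r s F XE us.
  by move=> S1; rewrite /f fS (Xsingle bX) ?cards0 ?bS ?SE ?addn0.
have zc (p q s : bool) : 1 < #|trace F X [set c]| -> 1 < p + q + s -> f p q false s = 0.
  have [S [SX SE [_ _ cS _] fS]] := pattern_card_trace p q false s F XE us.
  by move=> nc S1; rewrite /f fS (Xsingle cX) ?cards0 ?cS ?SE ?addn0.
have ze (p q r : bool) : 1 < #|trace F X [set e]| -> 1 < p + q + r -> f p q r false = 0.
  have [S [SX SE [_ _ _ eS] fS]] := pattern_card_trace p q r false F XE us.
  by move=> nc S1; rewrite /f fS (Xsingle eX) ?cards0 ?eS ?SE ?addn0.
have [ab ac ae] : [/\ a != b, a != c & a != e] by split; rewrite eq_sym.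
have [bc be ce] : [/\ b != c, b != e & c != e] by split; rewrite eq_sym.
have na3 := trace1_le3 XF aX bX ab na nb.
have nb3 := trace1_le3 XF bX aX ba nb na.
have nc3 nc := trace1_le3 XF cX aX ca nc na.
have ne3 ne := trace1_le3 XF eX aX ea ne na.
have t3 x y : x \in X -> y \in X -> a != x -> a != y -> x != y ->
    1 < #|trace F X [set x]| -> 1 < #|trace F X [set y]| ->
    #|trace F X [set x]| + #|trace F X [set y]| <= 5.
  move=> xX yX ax ay xy nx ny; rewrite leqNgt; apply/negP => n6.
  have [mx my] := (amax x xX, amax y yX).
  have mx3 := trace1_le3 XF xX aX (contra_neq esym ax) nx na.
  have my3 := trace1_le3 XF yX aX (contra_neq esym ay) ny na.
  apply: (@trace1_three a x y) => //; move: n6 mx my mx3 my3 na3;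
    move: #|trace F X [set a]| #|trace F X [set x]| #|trace F X [set y]| => i j k;
    clear; lia.
have t4 : 1 < #|trace F X [set c]| -> 1 < #|trace F X [set e]| ->
    #|trace F X [set a]| <= 2.
  move=> nc ne; rewrite leqNgt; apply/negP => na3'.
  by apply: (@trace1_four a b c e) => //; apply/eqP; rewrite eqn_leq na3.
have [mb mc me] := And3 (amax b bX) (amax c cX) (amax e eX).
rewrite FE GE !big_bool /=.
have h1 := fc true true true false; have h2 := fc true true false true.
have [h3 h4 h5 h6] := And4 (g1 true true true true) (g1 true true true false)
  (g1 true true false true) (g1 true false true true).
have [h7 h8 h9 h10] := And4 (g1 true false false true) (g1 true false true false)
  (g1 true true false false) (fg true false false false).
have [h11 h12 h13 h14] := And4 (f1 true true true true isT)
  (f1 true true true false isT) (f1 true true false true isT) (f1 true true false false isT).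
rewrite /= in h1 h2; move: (t3 b c bX cX ab ac bc nb) (t3 b e bX eX ab ae be nb).
move: (zc true true false) (zc true true true) (ze true true false) (ze true true true).
rewrite (zb true true true isT) (zb true true false isT) (zb true false true isT).
rewrite (zb false true true isT).
rewrite (za true true true isT) (za true true false isT) (za true false true isT).
move: h1 h2 h3 h4 h5 h6 h7 h8 h9 h10 h11 h12 h13 h14 t4 nc3 ne3.
rewrite f0 -fa -fb -fcc -fe in na nb na3 nb3 mb mc me *.
move: na nb na3 nb3 mb mc me; clearbody f g.
move: (f true false false false) (f false true false false) (f false false true false)
  (f false false false true) (f true true true true) (f true true true false)
  (f true true false true) (f true true false false) => va vb vc ve v1 v2 v3 v4.
move: (g true true true true) (g true true true false) (g true true false true)
  (g true true false false) (g true false true true) (g true false true false)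
  (g true false false true) (g true false false false) => w1 w2 w3 w4 w5 w6 w7 w8.
clear; move=> na nb na3 nb3 mb mc me h1 h2 h3 h4 h5 h6 h7 h8 h9 h10 h11 h12 h13 h14.
move=> t4 nc3 ne3 z1 z2 z3 z4 t3 t3'.
(* The star of [a] has [w8 >= va] facets with trace [[set a]] and at least 7 others. Beyond [va] the
   family has at most [3 + 4], [5 + 2] or [6 + 1] members when two, three or four single vertices
   are repeated: first the other repeated ones, then the remaining traces, taken with their
   complements. *)
have [nc|nc] := ltnP 1 vc; have [ne|ne] := ltnP 1 ve.
- have := t4 nc ne; have := z1 nc isT; have := z3 ne isT; lia.
- have := z1 nc isT; have := t3 nc; lia.
- have := z3 ne isT; have := t3' ne; lia.
lia.
Qed.
End ReferenceMember.

Lemma no_edge_cover_bound X : X \in F -> exists2 v, [set v] \in C & #|F| <= #|star v|.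
Proof.
move=> XF; have fX := family_face FF XF.
suff [v vX vb] : exists2 v, v \in X & #|F| <= #|star v|.
  by exists v => //; exact: face_vertex fX vX.
case: (boolP [exists p in X, (1 < #|trace F X [set p]|) && [exists S : {set T},
    [&& S \subset X, p \notin S, 1 < #|S| & trace F X S != set0]]]).
  move=> /exists_inP[p pX /andP[np /existsP[S /and4P[SX pS S1 /set0Pn[Y /trace_in[YF YX]]]]]].
  have [b [c [bS cS bc]]] := card_gt1P S1.
  have YS w : w \in X -> (w \in Y) = (w \in S) by move=> wX; rewrite -YX inE wX andbT.
  have [bX cX] := (subsetP SX _ bS, subsetP SX _ cS).
  have [e eX] := facet3_extra p b c (subsetP FF _ XF).
  rewrite !inE !negb_or => /and3P[ep eb ec]; exists p => //.
  by apply: (@two_common_vertices p b c e X Y); rewrite ?YS //; clique.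
move=> /exists_inPn nS; apply: (reference_bound XF) => p S pX np SX pS S1.
apply/eqP; apply: contraT => S0; move: (nS p pX); rewrite np /=.
by case/existsP; exists S; rewrite SX pS S1.
Qed.
End NoEdgeCover.
End Dimension3.

(** * The bound for all intersecting families *)

Lemma intersecting_family_bound F : d <= 3 -> F \subset facetset ->
  (forall A B, A \in F -> B \in F -> ~~ [disjoint A & B]) ->
  exists2 v, [set v] \in C & #|F| <= #|star v|.
Proof.
move=> d3 FF Fint; case: (set_0Vmem F) => [->|[X XF]].
  by case: pmC => -[_ [v vC]] _ _; exists v; rewrite // cards0.
have fX := family_face FF XF.
have [x xX] : exists x, x \in X.
  by apply/card_gt0P; rewrite (facet_card (subsetP FF _ XF)).
case: (boolP [exists v, [forall A in F, v \in A]]) => [/existsP[v /forall_inP Fv]|].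
  by exists v; [exact: face_vertex fX (Fv X XF) | exact: star_bound].
rewrite negb_exists => /forallP nostar.
have {}nostar v : exists2 A, A \in F & v \notin A.
  by move: (nostar v); rewrite negb_forall_in => /exists_inP.
move: d3; rewrite leq_eqVlt => /predU1P[d3|d2]; last first.
  by exists x; [exact: face_vertex fX xX | exact: low_dim_bound d2 XF xX nostar].
case: (boolP [exists a, exists b, adj a b && [forall A in F, (a \in A) || (b \in A)]]).
  move=> /existsP[a /existsP[b /andP[ab /forall_inP Fab]]].
  by apply: (edge_cover_bound d3 FF Fint ab) => A AF; apply/orP; exact: Fab.
rewrite negb_exists => /forallP nab; apply: (no_edge_cover_bound d3 FF Fint _ XF).
move=> a b ab; move: (nab a); rewrite negb_exists => /forallP/(_ b).
rewrite ab /= negb_forall_in => /exists_inP[Y YF]; rewrite negb_or => /andP[aY bY].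
by exists Y.
Qed.

Lemma pure_EKR_of_bound :
  (forall F, F \subset facetset ->
     (forall A B, A \in F -> B \in F -> ~~ [disjoint A & B]) ->
     exists2 v, [set v] \in C & #|F| <= #|star v|) -> pure_EKR C.
Proof.
move=> bound; have [[_ [v0 v0C]] pureC _] := pmC; split=> //.
case: (@arg_maxnP T v0 (fun v => [set v] \in C) (fun v => #|star v|) v0C) => v vC vmax.
exists v => //; have -> : [set A in facets C | v \in A] = star v.
  by rewrite /star facetsetE.
apply/eqP; rewrite eqn_leq; apply/andP; split.
  apply: (@leq_bigmax_cond _ _ (fun F : {set {set T}} => #|F|)).
  rewrite -facetsetE; apply/andP; split.
    by apply/subsetP => A; rewrite inE => /andP[].
  apply/forall_inP => A; rewrite inE => /andP[_ vA].
  apply/forall_inP => B; rewrite inE => /andP[_ vB].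
  by apply/negP => /disjointFr/(_ vA); rewrite vB.
apply/bigmax_leqP => F /andP[]; rewrite -facetsetE => FF /forall_inP Fint.
have [|w wC Fw] := bound F FF.
  by move=> A B AF BF; apply: (forall_inP (Fint A AF)).
exact: leq_trans Fw (vmax _ wC).
Qed.
End FlagPseudoManifold.

Theorem flag_pseudo_manifold_EKR (T : finType) (C : {set {set T}}) :
  flag C -> pseudo_manifold C -> complex_dim C <= 3 -> pure_EKR C.
Proof.
move=> flagC pmC d3; apply: (pure_EKR_of_bound pmC) => F FF Fint.
exact: (intersecting_family_bound flagC pmC d3 FF Fint).
Qed.

(** * Invariance of domain *)

Section KuhnLemma.
From mathcomp Require Import fintype finset.
Variables (n k : nat).
Hypothesis k_gt0 : 0 < k.
Local Notation grid := {ffun 'I_n -> 'I_k.+1}.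
Variable label : 'I_n -> grid -> bool.
Implicit Types (q r : grid) (D : {set 'I_n}) (s : seq 'I_n).

Definition step (i : 'I_n) q : grid :=
  [ffun j => if j == i then inord (minn k (q j).+1) else q j].

Lemma step_neq i j q : j != i -> step i q j = q j.
Proof. by rewrite ffunE => /negPf->. Qed.

Lemma stepE i q : step i q i = minn k (q i).+1 :> nat.
Proof. by rewrite ffunE eqxx inordK // ltnS geq_minl. Qed.

Lemma stepC i j q : step i (step j q) = step j (step i q).
Proof.
have [->//|ij] := eqVneq i j; apply/ffunP => l; rewrite !ffunE.
by have [->|] := eqVneq l i; rewrite ?(negPf ij).
Qed.

(* The cup product of the coboundaries of the labels [s], evaluated mod 2 on the
   Kuhn triangulation of the cube with base [q] and directions [D]. *)
Fixpoint cup D s q : bool :=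
  if s is l :: s' then
    \big[addb/false]_(i in D) ((label l (step i q) (+) label l q) && cup (D :\ i) s' (step i q))
  else true.

Lemma addb_false_eq x y : x (+) y = false -> x = y.
Proof. by case: x y => [] []. Qed.

Lemma sum_pairs_sym D (f : 'I_n -> 'I_n -> bool) : (forall i j, f i j = f j i) ->
  \big[addb/false]_(i in D) \big[addb/false]_(j in D :\ i) f i j = false.
Proof.
move=> fC; pose g := \big[addb/false]_(i in D) \big[addb/false]_(j in D | j < i) f i j.
suff -> : \big[addb/false]_(i in D) \big[addb/false]_(j in D :\ i) f i j = g (+) g.
  exact: addbb.
have gE : g = \big[addb/false]_(i in D) \big[addb/false]_(j in D | i < j) f i j.
  rewrite /g (exchange_big_dep [in D]) /=; last by move=> i j _ /andP[].
  apply: eq_bigr => i iD; apply: eq_big => [j|j _]; last exact: fC.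
  by rewrite iD.
rewrite {2}gE /g -big_split /=; apply: eq_bigr => i iD.
rewrite (bigID (fun j : 'I_n => j < i)) /=; congr (_ (+) _); apply: eq_bigl => j;
  rewrite !inE -val_eqE /=; case: (j \in D); rewrite ?andbF //=; by case: ltngtP.
Qed.

(** A cup product of coboundaries is a cocycle; the sum runs over the pairs of opposite faces of the
    cube with directions [D]. *)
Lemma cup_cocycle D s q : #|D| = (size s).+1 ->
  \big[addb/false]_(i in D) (cup (D :\ i) s (step i q) (+) cup (D :\ i) s q) = false.
Proof.
elim: s D q => [|l s IH] D q cD /=; first by rewrite big1.
set a := label l.
have cDi i : i \in D -> #|D :\ i| = (size s).+1.
  by move=> iD; move: cD; rewrite (cardsD1 i) iD => -[].
pose c i j := cup (D :\ i :\ j) s.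
have cC i j : c i j = c j i by rewrite /c !setDDl setUC.
(* The first term is symmetric in [i] and [j] and cancels. In the middle one, exchanging [i] and [j]
   in its second half makes the induction hypothesis for [D :\ i] at [step i q] apply. In the last
   one the induction hypothesis at [q] replaces [step j q] by [q], and symmetry applies again. *)
transitivity (\big[addb/false]_(i in D) \big[addb/false]_(j in D :\ i)
  ((a (step i (step j q)) && c i j (step i (step j q))) (+)
   ((a (step i q) && c i j (step i (step j q))) (+) (a (step j q) && c i j (step j q)))
   (+) (a q && c i j (step j q)))).
  apply: eq_bigr => i iD; rewrite -big_split /=; apply: eq_bigr => j jD.
  rewrite -/(c i j) (stepC j i) /=.
  by case: (a _); case: (a _); case: (a _); case: (a _); case: (c i j _); case: (c i j _).
have split3 (f g h : 'I_n -> 'I_n -> bool) :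
   \big[addb/false]_(i in D) \big[addb/false]_(j in D :\ i) (f i j (+) g i j (+) h i j) =
   \big[addb/false]_(i in D) \big[addb/false]_(j in D :\ i) f i j (+)
   \big[addb/false]_(i in D) \big[addb/false]_(j in D :\ i) g i j (+)
   \big[addb/false]_(i in D) \big[addb/false]_(j in D :\ i) h i j.
  by rewrite -!big_split /=; apply: eq_bigr => i _; rewrite -!big_split.
rewrite split3 sum_pairs_sym => [|i j]; last by rewrite stepC cC.
have split2 (f g : 'I_n -> 'I_n -> bool) :
   \big[addb/false]_(i in D) \big[addb/false]_(j in D :\ i) (f i j (+) g i j) =
   \big[addb/false]_(i in D) \big[addb/false]_(j in D :\ i) f i j (+)
   \big[addb/false]_(i in D) \big[addb/false]_(j in D :\ i) g i j.
  by rewrite -!big_split /=; apply: eq_bigr => i _; rewrite -!big_split.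
have swap (f : 'I_n -> 'I_n -> bool) :
   \big[addb/false]_(i in D) \big[addb/false]_(j in D :\ i) f i j =
   \big[addb/false]_(i in D) \big[addb/false]_(j in D :\ i) f j i.
  rewrite (exchange_big_dep [in D]) /=; last by move=> i j _ /setD1P[].
  by apply: eq_bigr => i iD; apply: eq_bigl => j; rewrite !inE eq_sym iD andbT andbC.
rewrite [X in _ (+) X (+) _](_ : _ = false); last first.
  rewrite split2 [X in _ (+) X]swap -split2 big1 // => i iD.
  rewrite (eq_bigr (fun j => a (step i q) &&
    (c i j (step j (step i q)) (+) c i j (step i q)))) => [|j _].
    by rewrite -big_distrr /= IH ?cDi ?andbF.
  by rewrite (cC j i) (stepC i j); case: (a _).
rewrite /= -[RHS](@sum_pairs_sym D (fun i j => a q && c i j q)) => [|i j]; last by rewrite cC.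
apply: eq_bigr => i iD; rewrite -!big_distrr /=; congr (_ && _).
have := IH (D :\ i) q (cDi i iD); rewrite big_split /= -/(c i).
exact: addb_false_eq.
Qed.

(** Leibniz rule: the factors after the first form a cocycle, so the product is the coboundary of
    [label l] times those factors. *)
Lemma cup_coboundary D l s q : #|D| = (size s).+1 ->
  cup D (l :: s) q = \big[addb/false]_(i in D)
    ((label l (step i q) && cup (D :\ i) s (step i q)) (+)
     (label l q && cup (D :\ i) s q)).
Proof.
move=> cD; apply: addb_false_eq; rewrite /= -big_split /=.
transitivity (label l q && \big[addb/false]_(i in D)
  (cup (D :\ i) s (step i q) (+) cup (D :\ i) s q)); last by rewrite cup_cocycle ?andbF.
rewrite big_distrr /=; apply: eq_bigr => i _; move: (label l _) (label l _) (cup _ _ _) (cup _ _ _).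
by do 4!case.
Qed.

Definition reset i q : grid := [ffun j => if j == i then ord0 else q j].

(** Base points of the cubes with directions [D] on the face of the grid where all other coordinates
    are [k]. *)
Definition box D q := [forall j, if j \in D then q j < k else q j == k :> nat].

(** Mod 2 Stokes formula in the direction [i]: the interior faces cancel, the top and bottom ones
    remain. *)
Lemma box_telescope D i (g : grid -> bool) : i \in D ->
  \big[addb/false]_(q | box D q) (g (step i q) (+) g q) =
  \big[addb/false]_(q | box (D :\ i) q) (g q (+) g (reset i q)).
Proof.
move=> iD.
pose P q := [forall (j | j != i), if j \in D then q j < k else q j == k :> nat].
have PE q r : (forall j, j != i -> q j = r j) -> P q = P r.
  by move=> qr; apply: eq_forallb_in => j ji; rewrite qr.
have boxD q : box D q = P q && (q i < k).
  apply/forallP/andP => [H|[/forall_inP H qi] j].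
    by split; [apply/forall_inP => j _; exact: H | have := H i; rewrite iD].
  by have [->|/H//] := eqVneq j i; rewrite iD.
have boxDi q : box (D :\ i) q = P q && (q i == k :> nat).
  apply/forallP/andP => [H|[/forall_inP H qi] j].
    split; last by have := H i; rewrite !inE eqxx.
    by apply/forall_inP => j ji; have := H j; rewrite !inE ji.
  by rewrite !inE; have [->|/H//] := eqVneq j i.
pose back q : grid := [ffun j => if j == i then inord (q j).-1 else q j].
pose top q : grid := [ffun j => if j == i then ord_max else q j].
rewrite !big_split /=.
have -> : \big[addb/false]_(q | box D q) g (step i q) =
          \big[addb/false]_(q | P q && (0 < q i)) g q.
  rewrite [RHS](reindex_onto (step i) back) /=; last first.
    move=> q /andP[_ qi]; apply/ffunP => j; rewrite !ffunE.
    have [->|//] := eqVneq j i; apply: val_inj; rewrite /= inordK ?ltnS ?geq_minl //.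
    rewrite inordK ?prednK //; last exact: ltnW.
    by apply/minn_idPr; rewrite -ltnS.
  apply: eq_bigl => q; rewrite boxD stepE (PE _ q); last first.
    by move=> j ji; rewrite step_neq.
  rewrite -andbA; congr (_ && _); apply/idP/andP => [qk|[_ /eqP/ffunP/(_ i)]].
    split; first by rewrite leq_min k_gt0.
    apply/eqP/ffunP => j; rewrite ffunE; have [->|ji] := eqVneq j i; last by rewrite step_neq.
    by apply: val_inj; rewrite /= inordK stepE (minn_idPr qk) //= ltnS ltnW.
  rewrite ffunE eqxx => /(congr1 val) /=; rewrite inordK stepE.
    by have := ltn_ord (q i); lia.
  by have := geq_minl k (q i).+1; lia.
have -> : \big[addb/false]_(q | P q && (0 < q i)) g q =
    \big[addb/false]_(q | P q && (0 < q i < k)) g q (+)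
    \big[addb/false]_(q | box (D :\ i) q) g q.
  rewrite (bigID (fun q : grid => q i < k)) /=; congr (_ (+) _); apply: eq_bigl => q.
    by rewrite -andbA.
  rewrite boxDi -andbA; congr (_ && _); rewrite -leqNgt.
  by have := ltn_ord (q i); lia.
have -> : \big[addb/false]_(q | box D q) g q =
    \big[addb/false]_(q | P q && (0 < q i < k)) g q (+)
    \big[addb/false]_(q | P q && (q i == 0 :> nat)) g q.
  rewrite (bigID (fun q : grid => 0 < q i)) /=; congr (_ (+) _); apply: eq_bigl => q.
    by rewrite boxD -andbA; congr (_ && _); rewrite andbC.
  by rewrite boxD -andbA; congr (_ && _); rewrite -leqNgt; lia.
have -> : \big[addb/false]_(q | P q && (q i == 0 :> nat)) g q =
    \big[addb/false]_(q | box (D :\ i) q) g (reset i q).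
  rewrite (reindex_onto (reset i) top) /=; last first.
    move=> q /andP[_ /eqP qi]; apply/ffunP => j; rewrite !ffunE.
    by have [->|//] := eqVneq j i; apply: val_inj.
  apply: eq_bigl => q; rewrite boxDi ffunE eqxx /= (PE _ q); last first.
    by move=> j ji; rewrite ffunE (negPf ji).
  rewrite andbT; congr (_ && _); apply/eqP/eqP => [/ffunP/(_ i)|qi].
    by rewrite !ffunE eqxx => <-.
  apply/ffunP => j; rewrite !ffunE; have [->|//] := eqVneq j i.
  by apply: val_inj; rewrite /= qi.
by rewrite addbACA addbb.
Qed.

Hypotheses (label0 : forall i q, q i = 0 :> nat -> label i q = false)
  (labelk : forall i q, q i = k :> nat -> label i q = true).

(** Steps in directions of [D] do not change [q i], so [label i] is constant along them and its
    coboundary vanishes. *)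
Lemma cup_boundary D s q i : i \notin D -> i \in s ->
  (q i == 0 :> nat) || (q i == k :> nat) -> cup D s q = false.
Proof.
elim: s D q => // l s IH D q iD; rewrite inE /= => lis qi; rewrite big1 // => j jD.
have ij : i != j by apply: contraNneq iD => ->.
case/predU1P: lis => [<-|ins].
  case/orP: qi => /eqP qi; first by rewrite !label0 ?step_neq.
  by rewrite !labelk ?step_neq.
by rewrite IH ?andbF // ?step_neq // !inE (negPf iD) andbF.
Qed.

(** By Stokes only faces of the grid contribute. In the direction [l] the label is 1 on top and 0 at
    the bottom, leaving the sum for the shorter list; in the other directions [cup_boundary]
    applies. *)
Lemma cup_sum s : uniq s ->
  \big[addb/false]_(q | box [set j in s] q) cup [set j in s] s q.
Proof.
elim: s => [_|l s IH /= /andP[ls us]] /=.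
  rewrite (big_pred1 [ffun=> ord_max]) // => q; rewrite /box /=.
  apply/forallP/eqP => [H|-> j]; last by rewrite inE /= ffunE /=.
  by apply/ffunP => j; apply: val_inj; have := H j; rewrite inE /= ffunE => /eqP.
set D := [set j in l :: s]; have DE : D :\ l = [set j in s].
  by apply/setP => j; rewrite !inE; have [->|] := eqVneq j l; rewrite ?(negPf ls).
have lD : l \in D by rewrite !inE eqxx.
have cD : #|D| = (size s).+1 by rewrite cardsE (card_uniqP _) //= ls.
rewrite (eq_bigr _ (fun q _ => cup_coboundary l q cD)) exchange_big /= (bigD1 l) //=.
rewrite [X in _ (+) X]big1 ?addbF => [|i /andP[iD il]].
  rewrite (box_telescope (fun q => label l q && cup (D :\ l) s q) lD) DE.
  apply: (etrans _ (IH us)); apply: eq_bigr => q.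
  move=> /forallP/(_ l); rewrite inE (negPf ls) => /eqP ql.
  by rewrite labelk // label0 ?addbF // ffunE eqxx.
rewrite (box_telescope (fun q => label l q && cup (D :\ i) s q) iD) big1 // => q.
move=> /forallP/(_ i); rewrite !inE eqxx /= => /eqP qi.
have ins : i \in s by move: iD; rewrite inE in_cons (negPf il).
by rewrite !(@cup_boundary _ s _ i) ?andbF // ?ffunE ?qi ?eqxx ?orbT // !inE eqxx.
Qed.

Lemma cup_witness D s q i : cup D s q -> i \in s ->
  exists r r', [/\ label i r, ~~ label i r', forall j, q j <= r j <= q j + (j \in D)
    & forall j, q j <= r' j <= q j + (j \in D)].
Proof.
elim: s D q => // l s IH D q /= H ils.
have [j jD /andP[lj cj]] : exists2 j, j \in D &
    (label l (step j q) (+) label l q) && cup (D :\ j) s (step j q).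
  apply/exists_inP; apply: contraTT H => /exists_inPn H.
  by rewrite big1 // => j jD; apply/negbTE/H.
have stepP r : (forall j', step j q j' <= r j' <= step j q j' + (j' \in D :\ j)) ->
    forall j', q j' <= r j' <= q j' + (j' \in D).
  move=> H' j'; have := H' j'; rewrite !inE.
  have [->|j'j] := eqVneq j' j; last by rewrite step_neq.
  by rewrite stepE jD /=; have := ltn_ord (q j); lia.
have qq j' : q j' <= q j' <= q j' + (j' \in D) by rewrite leqnn leq_addr.
have sq : forall j', q j' <= step j q j' <= q j' + (j' \in D).
  by apply: stepP => j'; rewrite leqnn leq_addr.
case/predU1P: ils => [->|ins]; last first.
  by have [r [r' [lr lr' /stepP rP /stepP rP']]] := IH _ _ cj ins; exists r, r'.
move: lj; case E: (label l q) => lj; [exists q, (step j q) | exists (step j q), q].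
  by split=> //; rewrite ?E //; move: lj; case: (label l _).
by split=> //; rewrite ?E //; move: lj; case: (label l _).
Qed.

(** The cup product is 1 on some cube, and there every label changes. *)
Lemma kuhn : exists q, (forall j, q j < k) /\ forall i, exists r r',
  [/\ label i r, ~~ label i r', forall j, q j <= r j <= (q j).+1
    & forall j, q j <= r' j <= (q j).+1].
Proof.
have := cup_sum (enum_uniq 'I_n).
case: (pickP (fun q => box [set j in enum 'I_n] q && cup [set j in enum 'I_n] (enum 'I_n) q)).
  move=> q /andP[/forallP qb qc] _; exists q; split=> [j|i].
    by have := qb j; rewrite inE mem_enum.
  have [|r [r' [lr lr' rP rP']]] := cup_witness qc (i := i); first by rewrite mem_enum.
  have b1 (b : bool) m : m + b <= m.+1 by case: b; rewrite ?addn1 ?addn0.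
  exists r, r'; split=> // j.
    by case/andP: (rP j) => -> /leq_trans->.
  by case/andP: (rP' j) => -> /leq_trans->.
move=> H; rewrite big1 // => q qb; have := H q; rewrite qb /=.
by move=> ->.
Qed.
End KuhnLemma.

Import Order.TTheory GRing.Theory Num.Theory.
Import numFieldNormedType.Exports.
Local Open Scope classical_set_scope.
Local Open Scope ring_scope.

(** * Sup-norm analysis: zeros on the cube, approximate inverses, images of spheres *)

Section RowVectors.
Variable R : realType.

Lemma rv_norm_le n (v : 'rV[R]_n) e : 0 <= e ->
  (`|v| <= e) <-> (forall i, `|v ord0 i| <= e).
Proof.
move=> e0; rewrite /Num.norm /= mx_normrE; split=> [/bigmax_leP[_ H] i|H].
  exact: (H (ord0, i)).
by apply/bigmax_leP; split=> // -[i j] _; rewrite ord1 H.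
Qed.

Lemma rv_norm_lt n (v : 'rV[R]_n) e : 0 < e ->
  (`|v| < e) <-> (forall i, `|v ord0 i| < e).
Proof.
move=> e0; rewrite /Num.norm /= mx_normrE; split=> [/bigmax_ltP[_ H] i|H].
  exact: (H (ord0, i)).
by apply/bigmax_ltP; split=> // -[i j] _; rewrite ord1 H.
Qed.

Lemma rv_coord_le n (v : 'rV[R]_n) i : `|v ord0 i| <= `|v|.
Proof. by have /(_ i) := (rv_norm_le v (normr_ge0 v)).1 (lexx _). Qed.

Lemma rv_norm_attained n (v : 'rV[R]_n) : v != 0 -> exists i, `|v ord0 i| = `|v|.
Proof.
move=> v0; have [|[i j] /= E] := @mx_norm_neq0 R 1 n v.
  by apply: contra v0 => /eqP/mx_norm_eq0->.
by exists j; rewrite ord1 in E; rewrite [RHS]E.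
Qed.

Lemma bounded_cluster n (u : nat -> 'rV[R]_n) M : (forall k, `|u k| <= M) ->
  exists2 x : 'rV[R]_n, `|x| <= M & forall e : R, 0 < e -> forall N, exists2 k, (N <= k)%N & `|u k - x| < e.
Proof.
move=> uM; have M0 : 0 <= M by apply: le_trans (uM 0%N).
have := @rV_compact R n (fun=> `[- M, M]%classic) (fun=> @segment_compact _ _ _).
move=> /(_ (u @ \oo) _) [|x [Ax xcl]].
  exists 0%N => // k _ i /=; rewrite in_itv /= -ler_norml.
  exact: le_trans (rv_coord_le _ _) (uM k).
exists x; first by apply/rv_norm_le => // i; rewrite ler_norml; exact: Ax.
move=> e e0 N; have [||y [[k Nk <-] xy]] := xcl [set u k | k in [set k | (N <= k)%N]] (ball x e).
- by exists N => // k Nk; exists k.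
- exact: nbhsx_ballx.
by exists k => //; rewrite distrC; move: xy; rewrite mx_norm_ball.
Qed.

Definition cts_on n m (A : set 'rV[R]_n) (f : 'rV[R]_n -> 'rV[R]_m) :=
  forall x, A x -> forall e : R, 0 < e -> exists2 d : R, 0 < d &
    forall y, A y -> `|y - x| < d -> `|f y - f x| < e.

Local Notation cube := (fun x : 'rV[R]__ => `|x| <= 1).

(** Poincare-Miranda: being close to the identity gives each coordinate of [H] opposite signs on
    opposite faces of the cube. [kuhn] yields small cells in which every coordinate changes sign,
    and [H] vanishes at a cluster point of them. *)
Lemma cube_zero n (H : 'rV[R]_n -> 'rV[R]_n) : cts_on cube H ->
  (forall x : 'rV[R]_n, `|x| <= 1 -> `|H x - x| < 1) -> exists2 x : 'rV[R]_n, `|x| <= 1 & H x = 0.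
Proof.
move=> Hc Hx.
have cell k : exists u : 'rV[R]_n, `|u| <= 1 /\ forall i, exists y y' : 'rV[R]_n, [/\ `|y| <= 1,
    `|y'| <= 1, `|y - u| <= 2 / k.+1%:R, `|y' - u| <= 2 / k.+1%:R &
    0 < H y ord0 i /\ H y' ord0 i <= 0].
  pose p (q : {ffun 'I_n -> 'I_k.+2}) : 'rV[R]_n := \row_i (2 * (q i)%:R / k.+1%:R - 1).
  have k0 : 0 < k.+1%:R :> R by rewrite ltr0n.
  have pQ q : `|p q| <= 1.
    apply/rv_norm_le => // i; rewrite mxE ler_norml; apply/andP; split.
      by rewrite lerBrDr addrC subrr divr_ge0 ?mulr_ge0.
    rewrite lerBlDr -mulrA -[leRHS](mulr1 2) ler_pM2l // ler_pdivrMr // mul1r.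
    by rewrite ler_nat -ltnS.
  pose label i q := 0 < H (p q) ord0 i.
  have lab0 i (q : {ffun 'I_n -> 'I_k.+2}) : q i = 0 :> nat -> label i q = false.
    move=> qi; apply/negbTE; rewrite -leNgt.
    have := Hx _ (pQ q) => /(rv_norm_lt _ ltr01)/(_ i); rewrite !mxE qi mulr0 mul0r.
    by rewrite ltr_norml; lra.
  have labk i (q : {ffun 'I_n -> 'I_k.+2}) : q i = k.+1 :> nat -> label i q = true.
    move=> qi; have := Hx _ (pQ q) => /(rv_norm_lt _ ltr01)/(_ i).
    by rewrite !mxE qi ltr_norml mulfK ?gt_eqF // /label; lra.
  have [q [qk qP]] := kuhn (ltn0Sn k) lab0 labk.
  exists (p q); split=> // i; have [r [r' [lr lr' rP rP']]] := qP i.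
  have pd (s : {ffun 'I_n -> 'I_k.+2}) : (forall j, (q j <= s j <= (q j).+1)%N) -> `|p s - p q| <= 2 / k.+1%:R.
    move=> sP; apply/rv_norm_le => [|j]; first by rewrite divr_ge0.
    rewrite !mxE [X in `|X|](_ : _ = (2 / k.+1%:R) * ((s j)%:R - (q j)%:R)); last by field; lra.
    have /andP[qs sq] := sP j; rewrite -natrB // normrM !ger0_norm ?divr_ge0 //.
    by rewrite -[leRHS]mulr1 ler_wpM2l ?divr_ge0 // lern1; lia.
  exists (p r), (p r'); split=> //; try exact: pd.
  by split=> //; rewrite leNgt.
have [u uP] := choice cell.
have [x xQ xcl] := bounded_cluster (fun k => (uP k).1).
exists x => //; apply/rowP => i; rewrite mxE; apply/eqP; apply: contraT => Hxi.
have [d d0 dP] : exists2 d : R, 0 < d & forall y : 'rV[R]_n, `|y| <= 1 -> `|y - x| < d ->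
   `|H y - H x| < `|H x ord0 i|.
  by apply: Hc => //; rewrite normr_gt0.
have [N NP] : exists N, 2 / N.+1%:R < d / 2.
  exists (Num.truncn (4 / d)); have := truncnS_gt (4 / d); rewrite ltr_pdivrMr //.
  by move=> h; rewrite ltr_pdivrMr // ?ltr0n //; nra.
have d2 : 0 < d / 2 by rewrite divr_gt0.
have [k Nk uk] := xcl _ d2 N.
have [_ /(_ i)[y [y' [yQ yQ' yu yu' [Hy Hy']]]]] := uP k.
have kN : 2 / k.+1%:R <= 2 / N.+1%:R :> R.
  by rewrite ler_pM2l // lef_pV2 ?posrE ?ltr0n // ler_nat.
have near (z : 'rV[R]_n) : `|z| <= 1 -> `|z - u k| <= 2 / k.+1%:R -> `|H z ord0 i - H x ord0 i| < `|H x ord0 i|.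
  move=> zQ zu; have : `|H z - H x| < `|H x ord0 i|.
    apply: dP => //; rewrite -(subrK (u k) z) -addrA; apply: le_lt_trans (ler_normD _ _) _.
    by rewrite (splitr d) ltrD //; apply: le_lt_trans zu (le_lt_trans kN NP).
  by apply: le_lt_trans; have := rv_coord_le (H z - H x) i; rewrite !mxE.
have := near y yQ yu; have := near y' yQ' yu'; rewrite !ltr_norml.
have [h|h] := ltrP 0 (H x ord0 i).
  by rewrite gtr0_norm //; lra.
by rewrite ler0_norm //; lra.
Qed.

Lemma rv_continuousP n (V : normedModType R) (g : 'rV[R]_n -> V) (x : 'rV[R]_n) :
  {for x, continuous g} <-> forall e : R, 0 < e -> exists2 d : R, 0 < d &
    forall y : 'rV[R]_n, `|y - x| < d -> `|g y - g x| < e.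
Proof.
have E := @cvgrPdist_lt R V 'rV[R]_n (nbhs x) (nbhs_filter x) g (g x).
split=> [/E gc e /gc|gc].
  rewrite -filter_from_ballE => -[d d0 dP]; exists d => // y yx.
  by rewrite distrC; apply: dP; rewrite /= mx_norm_ball /= distrC.
apply/E => e /gc[d d0 dP]; rewrite -filter_from_ballE; exists d => // y.
by rewrite /= mx_norm_ball /= distrC => /dP; rewrite distrC.
Qed.

Lemma cts_on_comp n m p (A : set 'rV[R]_n) (f : 'rV[R]_n -> 'rV[R]_m)
    (g : 'rV[R]_m -> 'rV[R]_p) :
  cts_on A f -> (forall x, A x -> {for f x, continuous g}) -> cts_on A (g \o f).
Proof.
move=> fc gc x Ax e e0; have [d d0 dP] := (rv_continuousP _ _).1 (gc x Ax) e e0.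
by have [d' d'0 d'P] := fc x Ax d d0; exists d' => // y Ay yx; apply/dP/d'P.
Qed.

Lemma rv_continuous_at n m (g : 'rV[R]_n -> 'rV[R]_m) (x : 'rV[R]_n) :
  (forall i, {for x, continuous (fun y => g y ord0 i)}) -> {for x, continuous g}.
Proof.
move=> gc; apply/rv_continuousP => e e0.
have /choice[d dP] i : exists d : R, 0 < d /\ forall y : 'rV[R]_n, `|y - x| < d ->
    `|g y ord0 i - g x ord0 i| < e.
  by have [d d0 dP] := (rv_continuousP _ _).1 (gc i) e e0; exists d.
exists (\big[Num.min/1]_i d i) => [|y yx].
  by apply/bigmin_gtP; split=> // i _; have [] := dP i.
apply/rv_norm_lt => // i; rewrite !mxE; have [_] := dP i; apply.
by apply: lt_le_trans yx _; apply: bigmin_le_cond.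
Qed.

Lemma lipschitz_continuous_at n (g : 'rV[R]_n -> R) L x :
  (forall y y', `|g y - g y'| <= L * `|y - y'|) -> {for x, continuous g}.
Proof.
move=> gL; apply/rv_continuousP => e e0.
have L0 : 0 < `|L| + 1 by apply: ltr_pwDr.
exists (e / (`|L| + 1)) => [|y]; first exact: divr_gt0.
rewrite ltr_pdivlMr // mulrC; apply: le_lt_trans; apply: le_trans (gL y x) _.
by rewrite ler_wpM2r // (le_trans (ler_norm L)) // lerDl.
Qed.

(** By compactness: pairs at distance at least [d] with ever closer images would cluster at a pair
    with equal images. A pair is coded as one vector of length [n + n], so that a single cluster
    point serves both components. *)
Lemma injective_modulus n (f : 'rV[R]_n -> 'rV[R]_n) : cts_on cube f ->
  {in [pred x : 'rV[R]_n | `|x| <= 1] &, injective f} -> forall d, 0 < d ->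
  exists2 h, 0 < h & forall x x' : 'rV[R]_n, `|x| <= 1 -> `|x'| <= 1 ->
    d <= `|x - x'| -> h <= `|f x - f x'|.
Proof.
move=> fc fi d d0; apply: contrapT => Hn.
have far k : exists w : 'rV[R]_(n + n), [/\ `|w| <= 1, `|lsubmx w| <= 1,
    `|rsubmx w| <= 1, d <= `|lsubmx w - rsubmx w| &
    `|f (lsubmx w) - f (rsubmx w)| < k.+1%:R^-1].
  apply: contrapT => Hk; apply: Hn; exists k.+1%:R^-1; first by rewrite invr_gt0 ltr0n.
  move=> x x' xQ xQ' xx'; rewrite leNgt; apply/negP => fxx'; apply: Hk.
  exists (row_mx x x'); rewrite row_mxKl row_mxKr; split=> //.
  apply/rv_norm_le => // i; rewrite mxE; case: fintype.split => j.
    exact: le_trans (rv_coord_le _ _) xQ.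
  exact: le_trans (rv_coord_le _ _) xQ'.
have [w wP] := choice far.
have [|z zQ zcl] := @bounded_cluster _ w 1; first by move=> k; have [] := wP k.
have sub_le (v : 'rV[R]_(n + n)) : `|lsubmx v| <= `|v| /\ `|rsubmx v| <= `|v|.
  by split; apply/rv_norm_le => // i; rewrite mxE rv_coord_le.
set x := lsubmx z; set x' := rsubmx z.
have [xQ xQ'] : `|x| <= 1 /\ `|x'| <= 1.
  by have [h h'] := sub_le z; split; apply: le_trans zQ.
have close k : `|lsubmx (w k) - x| <= `|w k - z| /\ `|rsubmx (w k) - x'| <= `|w k - z|.
  by rewrite /x /x' -!raddfB; exact: sub_le.
have xx' : d <= `|x - x'|.
  rewrite leNgt; apply/negP => h; have h0 : 0 < (d - `|x - x'|) / 2.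
    by rewrite divr_gt0 // subr_gt0.
  have [k _ kz] := zcl _ h0 0%N; have [_ _ _ dw _] := wP k; have [c1 c2] := close k.
  have : `|lsubmx (w k) - rsubmx (w k)| <=
      `|lsubmx (w k) - x| + `|x - x'| + `|rsubmx (w k) - x'|.
    rewrite [X in `|X| <= _](_ : _ = (lsubmx (w k) - x) + (x - x') + (x' - rsubmx (w k))).
      by rewrite (distrC (rsubmx _)) (le_trans (ler_normD _ _)) // lerD2r ler_normD.
    by rewrite !addrA !subrK.
  lra.
have fxx' : 0 < `|f x - f x'|.
  rewrite normr_gt0 subr_eq0; apply: contraTneq xx' => /fi -> //.
  by rewrite subrr normr0 -ltNge.
have e0 : 0 < `|f x - f x'| / 3 by rewrite divr_gt0.
have [d1 d10 d1P] := fc x xQ _ e0; have [d2 d20 d2P] := fc x' xQ' _ e0.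
have d12 : 0 < Num.min d1 d2 by rewrite lt_min d10.
have [k Nk kz] := zcl _ d12 (Num.truncn (`|f x - f x'| / 3)^-1).
have [_ wl wr _ fw] := wP k; have [c1 c2] := close k.
move: kz; rewrite lt_min => /andP[kz1 kz2].
have f1 := d1P _ wl (le_lt_trans c1 kz1); have f2 := d2P _ wr (le_lt_trans c2 kz2).
have ke : k.+1%:R^-1 < `|f x - f x'| / 3.
  rewrite -[ltRHS]invrK ltf_pV2 ?posrE ?invr_gt0 ?ltr0n //.
  by apply: lt_le_trans (truncnS_gt _) _; rewrite ler_nat.
have : `|f x - f x'| <= `|f (lsubmx (w k)) - f x| +
    `|f (lsubmx (w k)) - f (rsubmx (w k))| + `|f (rsubmx (w k)) - f x'|.
  rewrite [X in `|X| <= _](_ : _ = - (f (lsubmx (w k)) - f x) +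
    (f (lsubmx (w k)) - f (rsubmx (w k))) + (f (rsubmx (w k)) - f x')).
    apply: le_trans (ler_normD _ _) _; rewrite lerD2r.
    by apply: le_trans (ler_normD _ _) _; rewrite normrN.
  by rewrite opprB !addrA !subrK.
by have := lt_trans fw ke; lra.
Qed.

(* The infimal convolution of the inverse of [f] with [L * `|_|] is [L]-Lipschitz
   on the whole space and close to the inverse of [f] on the image of the cube. *)
Definition inverse_approx n (f : 'rV[R]_n -> 'rV[R]_n) L (y : 'rV[R]_n) i : R :=
  inf [set (x : 'rV[R]_n) ord0 i + L * `|y - f x| | x in [set x : 'rV[R]_n | `|x| <= 1]].

Lemma inverse_approx_le n (f : 'rV[R]_n -> 'rV[R]_n) L y i (x : 'rV[R]_n) : 0 <= L -> `|x| <= 1 ->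
  inverse_approx f L y i <= x ord0 i + L * `|y - f x|.
Proof.
move=> L0 xQ; apply: ge_inf; last by exists x.
exists (-1) => _ [z zQ <-]; have := le_trans (rv_coord_le z i) zQ.
rewrite ler_norml => /andP[h _]; rewrite -[leLHS]addr0 lerD // mulr_ge0 //.
Qed.

Lemma inverse_approx_ge n (f : 'rV[R]_n -> 'rV[R]_n) L y i m :
  (forall x : 'rV[R]_n, `|x| <= 1 -> m <= x ord0 i + L * `|y - f x|) ->
  m <= inverse_approx f L y i.
Proof.
move=> H; apply: lb_le_inf => [|_ [x xQ <-]]; last exact: H.
by exists (0 + L * `|y - f 0|), 0; rewrite /= ?normr0 ?mxE.
Qed.

Lemma inverse_approx_lipschitz n (f : 'rV[R]_n -> 'rV[R]_n) L i y y' : 0 <= L ->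
  `|inverse_approx f L y i - inverse_approx f L y' i| <= L * `|y - y'|.
Proof.
move=> L0; have half z z' : inverse_approx f L z i - L * `|z - z'| <= inverse_approx f L z' i.
  apply: inverse_approx_ge => x xQ; rewrite lerBlDr.
  apply: le_trans (inverse_approx_le f z i L0 xQ) _; rewrite -addrA lerD2l -mulrDr.
  by rewrite ler_wpM2l // [leRHS]addrC; apply: ler_distD.
rewrite ler_norml; have := half y y'; have := half y' y; rewrite (distrC y').
by move: (L * _) => *; apply/andP; split; lra.
Qed.

Lemma inverse_approx_close n (f : 'rV[R]_n -> 'rV[R]_n) : cts_on cube f ->
  {in [pred x : 'rV[R]_n | `|x| <= 1] &, injective f} -> forall d, 0 < d ->
  exists2 L, 0 <= L & forall (x : 'rV[R]_n) i, `|x| <= 1 ->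
    `|inverse_approx f L (f x) i - x ord0 i| <= d.
Proof.
move=> fc fi d d0; have [h h0 hP] := injective_modulus fc fi d0.
(* With this slope a point at distance at least [d] from [x] pays at least 2, the largest difference
   of two coordinates on the cube. *)
exists (2 / h) => [|x i xQ]; first by rewrite divr_ge0 // ltW.
have L0 : 0 <= 2 / h by rewrite divr_ge0 // ltW.
rewrite ler_distl; apply/andP; split; last first.
  apply: le_trans (inverse_approx_le f (f x) i L0 xQ) _.
  by rewrite subrr normr0 mulr0 addr0 lerDl ltW.
apply: inverse_approx_ge => x' xQ'; have [xx'|xx'] := ltP `|x - x'| d.
  have := le_trans (rv_coord_le (x - x') i) (ltW xx'); rewrite !mxE ler_norml => /andP[_ h1].
  have : 0 <= 2 / h * `|f x - f x'| by rewrite mulr_ge0.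
  by move: (2 / h * _) => *; lra.
have : 2 <= 2 / h * `|f x - f x'|.
  by rewrite -mulrA ler_peMr // mulrC ler_pdivlMr // mul1r hP.
have := le_trans (rv_coord_le x i) xQ; have := le_trans (rv_coord_le x' i) xQ'.
by rewrite !ler_norml; move: (2 / h * _) => *; lra.
Qed.

(** An interval of length [1 / N.+1] containing [t] in the unit interval; the minimum with [N] puts
    [t = 1] into the last one. *)
Definition cell N (t : R) : 'I_N.+1 := inord (minn N (Num.truncn (t * N.+1%:R))).

Lemma cell_itv N t : 0 <= t <= 1 -> (cell N t)%:R <= t * N.+1%:R <= (cell N t)%:R + 1.
Proof.
move=> /andP[t0 t1]; have N0 : 0 < N.+1%:R :> R by rewrite ltr0n.
have tN : t * N.+1%:R <= N%:R + 1 by rewrite -natr1 -[leRHS]mul1r ler_wpM2r // addr_ge0.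
have /andP[h1 h2] := @truncn_itv R (t * N.+1%:R) (mulr_ge0 t0 (ltW N0)).
rewrite /cell inordK ?ltnS ?geq_minl //.
have [le|lt] := leqP N (Num.truncn (t * N.+1%:R)).
  by rewrite (le_trans _ h1) ?ler_nat.
by rewrite h1 /= natr1 ltW.
Qed.

(* The sphere is covered by [O(N ^ m)] cells of size [1 / N], whose images have
   size [O(1 / N)], while a ball contains [O(N ^ m.+1)] points at that distance. *)
Lemma lipschitz_sphere_misses m (c : 'rV[R]_m.+1) e L (P : 'rV[R]_m.+1 -> 'rV[R]_m.+1) d :
  0 < e -> 0 <= L -> 0 < d ->
  (forall y y', `|y - c| = e -> `|y' - c| = e -> `|P y - P y'| <= L * `|y - y'|) ->
  exists2 v : 'rV[R]_m.+1, `|v| < d & forall y, `|y - c| = e -> P y <> v.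
Proof.
move=> e0 L0 d0 PL; apply: contrapT => Hn.
have pre v : exists y : 'rV[R]_m.+1, `|v| < d -> `|y - c| = e /\ P y = v.
  have [vd|vd] := ltP `|v| d; last by exists 0.
  apply: contrapT => Hv; apply: Hn; exists v => // y yc Py.
  by apply: Hv; exists y.
have [g gP] := choice pre.
(* [K] makes the image of a cell of side [2 * e / (K * M)] smaller than the spacing [d / M] of the
   test points [v t]. [M] exceeds [2 * m.+1 * K ^ m], so that the [M ^ m.+1] test points outnumber
   the [2 * m.+1 * (K * M) ^ m] cells. *)
set K := (Num.truncn (2 * e * L / d)).+1.
set M := (2 * m.+1 * K ^ m).+1.
have K_gt : 2 * e * L / d < K%:R by exact: truncnS_gt.
set N := (K * M).-1; have NE : N.+1 = (K * M)%N by rewrite /N prednK // muln_gt0.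
have M0 : 0 < M%:R :> R by rewrite ltr0n.
have N0 : 0 < N.+1%:R :> R by rewrite ltr0n.
pose v (t : {ffun 'I_m.+1 -> 'I_M}) : 'rV[R]_m.+1 := \row_j (d * (t j)%:R / M%:R).
have vd (t : {ffun 'I_m.+1 -> 'I_M}) : `|v t| < d.
  apply/rv_norm_lt => // j; rewrite mxE ger0_norm.
    by rewrite ltr_pdivrMr // ltr_pM2l // ltr_nat.
  by rewrite divr_ge0 // mulr_ge0 // ltW.
pose y (t : {ffun 'I_m.+1 -> 'I_M}) := g (v t).
have yP t : `|y t - c| = e /\ P (y t) = v t by exact: (gP (v t) (vd t)).
have att (t : {ffun 'I_m.+1 -> 'I_M}) : exists i, `|y t ord0 i - c ord0 i| = e.
  have [|i iE] := @rv_norm_attained _ (y t - c).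
    by rewrite -normr_gt0 (yP t).1.
  by exists i; move: iE; rewrite (yP t).1 !mxE.
have [i iP] := choice att.
pose z (t : {ffun 'I_m.+1 -> 'I_M}) j := (y t ord0 j - c ord0 j + e) / (2 * e).
have e2 : 0 < 2 * e by rewrite mulr_gt0.
have z01 (t : {ffun 'I_m.+1 -> 'I_M}) j : 0 <= z t j <= 1.
  have := rv_coord_le (y t - c) j; rewrite (yP t).1 !mxE ler_norml => /andP[h1 h2].
  apply/andP; split; first by rewrite /z divr_ge0 ?(ltW e2) //; lra.
  by rewrite /z ler_pdivrMr // mul1r; lra.
(* The face of the sup-norm sphere on which [y t] lies, by index and sign, and the cell of [y t] in
   it. *)
pose code (t : {ffun 'I_m.+1 -> 'I_M}) : 'I_m.+1 * bool * {ffun 'I_m -> 'I_N.+1} :=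
  (i t, 0 <= y t ord0 (i t) - c ord0 (i t), [ffun j => cell N (z t (lift (i t) j))]).
have code_inj : injective code.
  move=> t t' E; apply/eqP; apply: contraT => tt'.
  have [E1 E2 E3] : [/\ i t = i t',
      (0 <= y t ord0 (i t) - c ord0 (i t)) = (0 <= y t' ord0 (i t') - c ord0 (i t')) &
      forall j, cell N (z t (lift (i t) j)) = cell N (z t' (lift (i t') j))].
    by case: E => E1 E2 /ffunP E3; split=> // j; have := E3 j; rewrite !ffunE.
  have eN : 0 <= 2 * e / N.+1%:R by rewrite divr_ge0 // ltW.
  have yy' : `|y t - y t'| <= 2 * e / N.+1%:R.
    apply/rv_norm_le => // j.
    rewrite !mxE; case: (unliftP (i t) j) => [j'|] ->.
      have := E3 j'; rewrite -E1 => Ec.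
      have /andP[h1 h2] := cell_itv N (z01 t (lift (i t) j')).
      have /andP[h3 h4] := cell_itv N (z01 t' (lift (i t) j')).
      rewrite -Ec in h3 h4.
      have -> : y t ord0 (lift (i t) j') - y t' ord0 (lift (i t) j') =
          (z t (lift (i t) j') * N.+1%:R - z t' (lift (i t) j') * N.+1%:R) * (2 * e / N.+1%:R).
        by rewrite /z; field; rewrite !gt_eqF // -natr1.
      rewrite normrM (ger0_norm eN) -[leRHS]mul1r.
      by rewrite ler_wpM2r // ler_norml; lra.
    have := iP t; have := iP t'; rewrite -E1 in E2 *; move=> h1 h2.
    suff -> : y t ord0 (i t) = y t' ord0 (i t) by rewrite subrr normr0.
    move: h1 h2 E2; case: (leP 0 (y t' ord0 (i t) - c ord0 (i t))) => s1.
      by rewrite (ger0_norm s1) => h1 + s2; rewrite (ger0_norm s2); lra.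
    rewrite (ltr0_norm s1) => h1 + /negbT; rewrite -ltNge => + s2.
    by rewrite (ltr0_norm s2); lra.
  have /existsP[j jtt'] : [exists j, t j != t' j].
    by rewrite -negb_forall; apply: contra tt' => /forallP H; apply/eqP/ffunP => j; apply/eqP.
  have M0' : 0 <= M%:R^-1 :> R by rewrite invr_ge0.
  have vv' : d / M%:R <= `|v t - v t'|.
    apply: le_trans (rv_coord_le _ j); rewrite !mxE -mulrBl -mulrBr !normrM.
    rewrite (gtr0_norm d0) (ger0_norm M0') ler_wpM2r //.
    rewrite -[leLHS]mulr1 ler_wpM2l //; first exact: ltW.
    have [lt|lt|/val_inj E'] := ltngtP (t j) (t' j); last by rewrite E' eqxx in jtt'.
      by rewrite distrC -natrB ?(ltnW lt) // ger0_norm // ler1n subn_gt0.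
    by rewrite -natrB ?(ltnW lt) // ger0_norm // ler1n subn_gt0.
  have := PL (y t) (y t') (yP t).1 (yP t').1; rewrite (yP t).2 (yP t').2 => h.
  have h' := le_trans vv' (le_trans h (ler_wpM2l L0 yy')).
  suff lt : L * (2 * e / N.+1%:R) < d / M%:R by rewrite ltNge h' in lt.
  have K0 : 0 < K%:R :> R by rewrite ltr0n.
  have -> : L * (2 * e / N.+1%:R) = 2 * e * L / d * (d / M%:R) / K%:R.
    by rewrite NE natrM; field; rewrite !gt_eqF.
  by rewrite ltr_pdivrMr // mulrC ltr_pM2l // divr_gt0.
have := leq_card _ code_inj; rewrite !card_prod card_bool !card_ffun !card_ord NE.
rewrite expnMn expnS leqNgt => /negP; apply.
rewrite mulnA ltn_pmul2r ?expn_gt0 // /M ltnS.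
by rewrite (mulnC _ 2).
Qed.

Lemma dist_max (t p q : R) : `|Num.max t p - Num.max t q| <= `|p - q|.
Proof.
have [h1 h2] : p - q <= `|p - q| /\ q - p <= `|p - q|.
  by rewrite ler_norm distrC ler_norm.
by case: (leP t p) => tp; case: (leP t q) => tq; rewrite ler_norml; apply/andP; split; lra.
Qed.

Lemma dist_min (t p q : R) : `|Num.min t p - Num.min t q| <= `|p - q|.
Proof.
have [h1 h2] : p - q <= `|p - q| /\ q - p <= `|p - q|.
  by rewrite ler_norm distrC ler_norm.
by case: (leP t p) => tp; case: (leP t q) => tq; rewrite ler_norml; apply/andP; split; lra.
Qed.

End RowVectors.

(** * Tao's argument on the cube *)

Section RowVectors.
Variable R : realType.
Local Notation cube := (fun x : 'rV[R]__ => `|x| <= 1).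

Section GeneralContinuity.
Variables (T : topologicalType) (V : normedModType R) (x : T).

Lemma radial_continuous (c : V) (z : T -> V) e : {for x, continuous z} -> z x != 0 ->
  {for x, continuous (fun y => c + Num.max (e / `|z y|) 1 *: z y)}.
Proof.
move=> zc z0; apply: cvgD; first exact: cvg_cst.
apply: cvgZ => //.
apply: (@continuous_max R T (fun y => e / `|z y|) (fun=> 1)); last exact: cvg_cst.
apply: cvgM; first exact: cvg_cst.
by apply: cvgV; [rewrite normr_eq0 | exact: cvg_norm].
Qed.

Lemma excess_continuous (z : T -> V) (a b e : R) : {for x, continuous z} ->
  {for x, continuous (fun y => a + b * Num.max 0 (`|z y| - e))}.
Proof.
move=> zc; apply: cvgD; first exact: cvg_cst.
apply: cvgM; first exact: cvg_cst.
apply: (@continuous_max R T (fun=> 0) (fun y => `|z y| - e)); first exact: cvg_cst.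
by apply: cvgB; [exact: cvg_norm | exact: cvg_cst].
Qed.

Lemma clip_continuous (t p : T -> R) : {for x, continuous t} -> {for x, continuous p} ->
  {for x, continuous (fun y => Num.max (- t y) (Num.min (t y) (p y)))}.
Proof.
move=> tc pc; apply: (@continuous_max R T (fun y => - t y) (t \min p)).
  exact: cvgN.
exact: continuous_min.
Qed.

Lemma subr_cst_continuous (p : T -> V) v : {for x, continuous p} ->
  {for x, continuous (fun y => p y - v)}.
Proof. by move=> pc; apply: cvgB => //; exact: cvg_cst. Qed.
End GeneralContinuity.

(* Tao's argument: if the image of [0] is on the boundary of the image of the
   cube, then a small perturbation of the inverse of [f] has no zero, although the
   composite with [f] is close to the identity, contradicting [cube_zero]. *)
Lemma cube_invariance m (f : 'rV[R]_m.+1 -> 'rV[R]_m.+1) : cts_on cube f ->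
  {in [pred x : 'rV[R]_m.+1 | `|x| <= 1] &, injective f} ->
  exists2 r : R, 0 < r & forall y : 'rV[R]_m.+1, `|y - f 0| < r ->
    exists2 x : 'rV[R]_m.+1, `|x| <= 1 & f x = y.
Proof.
move=> fc fi; apply: contrapT => Hn.
have [h h0 hP] := injective_modulus fc fi (ltac:(lra) : 0 < (1 / 10 : R)).
(* As [c] will be within [e / 2] of [f 0], images within [3 / 2 * e] of [c] are within [2 * e = h]
   of [f 0], so their preimages have norm below [1 / 10]. *)
have Q0 : `|0 : 'rV[R]_m.+1| <= 1 by rewrite normr0.
set e := h / 2; have e0 : 0 < e by rewrite divr_gt0.
have [c cf cP] : exists2 c : 'rV[R]_m.+1, `|c - f 0| < e / 2 &
    forall x : 'rV[R]_m.+1, `|x| <= 1 -> f x != c.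
  apply: contrapT => Hc; apply: Hn; exists (e / 2); first by rewrite divr_gt0.
  move=> y yf; apply: contrapT => Hy; apply: Hc; exists y => // x xQ.
  by apply/eqP => fx; apply: Hy; exists x.
have near x : `|x| <= 1 -> `|f x - c| < 3 / 2 * e -> `|x| < 1 / 10.
  move=> xQ xc; rewrite ltNge; apply/negP => x10.
  have := hP x 0 xQ Q0; rewrite subr0 => /(_ x10).
  have := ler_distD c (f x) (f 0); rewrite /e in xc cf *; lra.
have [d1 d10 d1P] := fc 0 Q0 (e / 2) (divr_gt0 e0 (ltac:(lra) : 0 < (2 : R))).
have far x : `|x| <= 1 -> e <= `|f x - c| -> d1 <= `|x|.
  move=> xQ xc; rewrite leNgt; apply/negP => xd1.
  have := d1P x xQ; rewrite subr0 => /(_ xd1).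
  have := ler_distD (f 0) (f x) c; rewrite (distrC (f 0)); lra.
(* A zero found outside the ball has norm below [2 * d], which [d1 / 4] plays against [far]. The
   bound [1 / 20] gives [d + 1 / 10 <= 1 / 5], so that clipping does not change the approximate
   inverse on preimages of norm below [1 / 10]. *)
pose d := Num.min (1 / 20) (d1 / 4).
have d0 : 0 < d by rewrite lt_min divr_gt0 // divr_gt0.
have [dl1 dl2] : d <= 1 / 20 /\ d <= d1 / 4 by rewrite !ge_min !lexx orbT.
have [L L0 LP] := inverse_approx_close fc fi d0.
(* The clipping level is constant on the sphere of radius [e] about [c], where [P] is thus Lipschitz
   and small. It has grown by 1 at radius [3 / 2 * e], enough to leave the approximate inverse
   unclipped on the image of the cube. *)
pose tau (y : 'rV[R]_m.+1) : R := 1 / 5 + 2 / e * Num.max 0 (`|y - c| - e).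
pose P (y : 'rV[R]_m.+1) : 'rV[R]_m.+1 :=
  \row_i Num.max (- tau y) (Num.min (tau y) (inverse_approx f L y i)).
(* Radial projection of the punctured ball about [c] onto its sphere, the identity outside; [c]
   itself is not in the image of [f]. *)
pose Phi (y : 'rV[R]_m.+1) := c + (Num.max (e / `|y - c|) 1) *: (y - c).
have tau_sphere y : `|y - c| = e -> tau y = 1 / 5.
  by move=> yc; rewrite /tau yc subrr maxxx mulr0 addr0.
have [v vd vP] : exists2 v : 'rV[R]_m.+1, `|v| < d & forall y, `|y - c| = e -> P y <> v.
  apply: (lipschitz_sphere_misses e0 L0 d0) => y y' yc yc'.
  apply/rv_norm_le => [|i]; first by rewrite mulr_ge0.
  rewrite !mxE !tau_sphere //.
  apply: le_trans (inverse_approx_lipschitz f i y y' L0).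
  exact: le_trans (dist_max _ _ _) (dist_min _ _ _).
have Pbound y i t : 0 <= t -> tau y <= t -> 0 <= tau y -> `|P y ord0 i| <= t.
  move=> t0 taut tau0; rewrite mxE ler_norml; move: (inverse_approx f L y i) => p.
  case: (leP (tau y) p) => h1; case: (leP (- tau y)) => h2; apply/andP; split; lra.
have far_close x : `|x| <= 1 -> e <= `|f x - c| -> `|P (f x) - x| <= d.
  move=> xQ xc; apply/rv_norm_le => [|i]; first exact: ltW.
  have Lx := LP x i xQ; rewrite !mxE.
  have tau_ge : `|inverse_approx f L (f x) i| <= tau (f x).
    have xi := rv_coord_le x i.
    have h1 : `|inverse_approx f L (f x) i| <= d + `|x ord0 i|.
      rewrite -[X in `|X| <= _](subrK (x ord0 i)).
      by apply: le_trans (ler_normD _ _) _; rewrite lerD2r.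
    rewrite /tau (max_r _) ?subr_ge0 //; have [lt|ge] := ltP `|f x - c| (3 / 2 * e).
      have := near x xQ lt; have : 0 <= 2 / e * (`|f x - c| - e).
        by rewrite mulr_ge0 ?divr_ge0 ?subr_ge0 // ltW.
      lra.
    have : 1 <= 2 / e * (`|f x - c| - e) by rewrite mulrAC ler_pdivlMr //; lra.
    lra.
  move: tau_ge; rewrite ler_norml => /andP[h1 h2].
  by rewrite (min_r h2) (max_r h1).
have norm0 x : `|x| <= 1 -> 0 < `|f x - c| by move=> xQ; rewrite normr_gt0 subr_eq0 cP.
have PhiE x : `|x| <= 1 -> e <= `|f x - c| -> Phi (f x) = f x.
  move=> xQ xc; rewrite /Phi max_r; first by rewrite scale1r addrC subrK.
  by rewrite ler_pdivrMr ?norm0 // mul1r.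
have Phi_sphere x : `|x| <= 1 -> `|f x - c| < e -> `|Phi (f x) - c| = e.
  move=> xQ xc; rewrite /Phi addrC addKr normrZ max_l; last first.
    by rewrite ler_pdivlMr ?norm0 // mul1r ltW.
  rewrite [X in X * _]ger0_norm; last by rewrite divr_ge0 // ltW.
  by rewrite -mulrA mulVf ?mulr1 // gt_eqF // norm0.
have [|x xQ|x xQ] := @cube_zero R m.+1 ((fun y => P (Phi y) - v) \o f).
- apply: cts_on_comp fc _ => x xQ; apply: rv_continuous_at => i.
  have idc (y : 'rV[R]_m.+1) :
      {for y, continuous ((fun y => y - c) : 'rV[R]_m.+1 -> 'rV[R]_m.+1)}.
    by apply/rv_continuousP => r r0; exists r => // z; rewrite opprB addrA subrK.
  have Phic : {for f x, continuous Phi}.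
    by apply: radial_continuous; [exact: idc | rewrite subr_eq0 cP].
  have Pc y : {for y, continuous (fun y => P y ord0 i)}.
    have -> : (fun y => P y ord0 i) =
        (fun y => Num.max (- tau y) (Num.min (tau y) (inverse_approx f L y i))).
      by apply/funext => z; rewrite mxE.
    apply: clip_continuous; first by apply: (@excess_continuous 'rV[R]_m.+1 'rV[R]_m.+1 y (fun y => y - c)); exact: idc.
    by apply: lipschitz_continuous_at => y1 y2; apply: inverse_approx_lipschitz.
  have -> : (fun y => (P (Phi y) - v) ord0 i) =
      (fun y => ((fun y => P y ord0 i) \o Phi) y - v ord0 i).
    by apply/funext => y; rewrite /= !mxE.
  by apply: subr_cst_continuous; apply: continuous_comp.
- have [lt|ge] := ltP `|f x - c| e; last first.
    rewrite /= PhiE // -addrA (addrC (- v)) addrA.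
    by apply: le_lt_trans (ler_normB _ _) _; have := far_close x xQ ge; lra.
  have xs : `|x| < 1 / 10 by apply: near => //; lra.
  have Ps : `|P (Phi (f x))| <= 1 / 5.
    by apply/rv_norm_le => // i; apply: Pbound; rewrite ?tau_sphere ?Phi_sphere.
  rewrite /=; apply: le_lt_trans (ler_normB _ _) _.
  by have := ler_normB (P (Phi (f x))) v; lra.
rewrite /= => /eqP; rewrite subr_eq0 => /eqP Pv.
have [lt|ge] := ltP `|f x - c| e; first by apply: (vP (Phi (f x))) => //; exact: Phi_sphere.
have := far x xQ ge; have := far_close x xQ ge; rewrite PhiE // in Pv; rewrite Pv.
have := ler_distD v 0 x; rewrite !sub0r !normrN distrC; lra.
Qed.
End RowVectors.

(** * Invariance of domain and its use in charts *)

Section InvarianceOfDomain.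
Variable R : realType.

Theorem invariance_of_domain m (f : 'rV[R]_m.+1 -> 'rV[R]_m.+1) (x0 : 'rV[R]_m.+1) (r : R) :
  0 < r -> cts_on (fun x => `|x - x0| <= r) f ->
  {in [pred x : 'rV[R]_m.+1 | `|x - x0| <= r] &, injective f} ->
  exists2 e : R, 0 < e & forall y : 'rV[R]_m.+1, `|y - f x0| < e ->
    exists2 x : 'rV[R]_m.+1, `|x - x0| <= r & f x = y.
Proof.
move=> r0 fc fi; pose s (z : 'rV[R]_m.+1) := x0 + r *: z.
have sE z z' : `|s z - s z'| = r * `|z - z'|.
  by rewrite /s opprD addrACA subrr add0r -scalerBr normrZ gtr0_norm.
have s0 z : `|s z - x0| = r * `|z| by have := sE z 0; rewrite /s scaler0 addr0 subr0.
have sQ (z : 'rV[R]_m.+1) : `|z| <= 1 -> `|s z - x0| <= r.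
  by move=> zQ; rewrite s0 -[leRHS]mulr1 ler_pM2l.
have [||e e0 eP] := @cube_invariance R m (f \o s).
- move=> z zQ e e0; have [d d0 dP] := fc (s z) (sQ z zQ) e e0.
  exists (d / r) => [|z' zQ' zz']; first exact: divr_gt0.
  by apply: dP; [exact: sQ | rewrite sE mulrC -ltr_pdivlMr].
- move=> z z'; rewrite !inE => zQ zQ' /= /fi; rewrite !inE !sQ // => /(_ isT isT).
  move=> E; have := sE z z'; rewrite E subrr normr0 => /esym/eqP.
  by rewrite mulf_eq0 gt_eqF //= normr_eq0 subr_eq0 => /eqP.
exists e => // y yf; have [|z zQ <-] := eP y.
  by rewrite /= /s scaler0 addr0.
by exists (s z) => //; exact: sQ.
Qed.

(** Padded with zeros, [f] would map a ball injectively into a hyperplane of its own space. *)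
Lemma no_embedding m n (f : 'rV[R]_m -> 'rV[R]_n) (x0 : 'rV[R]_m) (r : R) :
  0 < r -> cts_on (fun x => `|x - x0| <= r) f ->
  {in [pred x : 'rV[R]_m | `|x - x0| <= r] &, injective f} -> (m <= n)%N.
Proof.
move=> r0 fc fi; rewrite leqNgt; apply/negP => nm.
case: m nm => // m nm in f x0 fc fi *.
pose F x : 'rV[R]_m.+1 := \row_(j < m.+1) if insub (val j) is Some i then f x ord0 i else 0.
have FE x i (im : (i < m.+1)%N) (lt : (i < n)%N) : F x ord0 (Ordinal im) = f x ord0 (Ordinal lt).
  by rewrite mxE /= insubT.
have [||e e0 eP] := @invariance_of_domain m F x0 r r0.
- move=> x xr e e0; have [d d0 dP] := fc x xr e e0; exists d => // y yr yx.
  apply/rv_norm_lt => // j; rewrite !mxE; case: insubP => [i _ _|_]; last by rewrite subrr normr0.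
  by have := (rv_norm_lt _ e0).1 (dP y yr yx) i; rewrite !mxE.
- move=> x y xr yr Fxy; apply: fi => //; apply/rowP => i.
  have im : (i < m.+1)%N by apply: ltn_trans (ltn_ord i) nm.
  have := congr1 (fun M : 'rV[R]_m.+1 => M ord0 (Ordinal im)) Fxy.
  by rewrite !(FE _ _ im (ltn_ord i)) (_ : Ordinal (ltn_ord i) = i) //; exact: val_inj.
have last0 x : F x ord0 ord_max = 0 by rewrite mxE insubF //= ltnNge -ltnS nm.
have [|x _ Fx] := eP (F x0 + const_mx (e / 2)).
  rewrite addrC addKr; apply/rv_norm_lt => // i; rewrite mxE gtr0_norm ?divr_gt0 //.
  by rewrite ltr_pdivrMr // mulr_natr mulr2n ltrDl.
have := congr1 (fun M : 'rV[R]_m.+1 => M ord0 ord_max) Fx.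
rewrite /= last0 mxE last0 add0r mxE => /esym/eqP.
by rewrite gt_eqF // divr_gt0.
Qed.

Lemma continuous_cts_on m k (x0 : 'rV[R]_m) (r : R) (f : 'rV[R]_m -> 'rV[R]_k) :
  (forall x, `|x - x0| <= r -> {for x, continuous f}) -> cts_on (fun x => `|x - x0| <= r) f.
Proof.
move=> fc x xr e e0; have [d d0 dP] := (rv_continuousP f x).1 (fc x xr) e e0.
by exists d => // y _; exact: dP.
Qed.

Lemma nbhs_rvP m (x : 'rV[R]_m) (A : set 'rV[R]_m) : nbhs x A ->
  exists2 r : R, 0 < r & forall y : 'rV[R]_m, `|y - x| <= r -> A y.
Proof.
rewrite -filter_from_ballE => -[e e0 eA]; exists (e / 2); first exact: divr_gt0.
move=> y yx; apply: eA; rewrite /= mx_norm_ball /= distrC; apply: le_lt_trans yx _.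
by rewrite ltr_pdivrMr // mulr_natr mulr2n ltrDl.
Qed.

(** A chart by total functions instead of maps between subspace types, so that it composes directly
    with parametrizations and projections. *)
Definition euclidean_at n (X : topologicalType) (p : X) :=
  exists (phi : X -> 'rV[R]_n) (psi : 'rV[R]_n -> X) (U : set X) (V : set 'rV[R]_n),
  [/\ open U, U p, open V &
    (forall x, U x -> [/\ V (phi x), psi (phi x) = x & {for x, continuous phi}]) /\
    (forall y, V y -> [/\ U (psi y), phi (psi y) = y & {for y, continuous psi}])].

Section LocallyEuclideanPoint.
Variables (X : topologicalType) (n : nat).

(** Read in a chart, on a smaller ball, [j] becomes a map between Euclidean spaces. *)
Lemma parametrization_chart m (j : 'rV[R]_m -> X) (x0 : 'rV[R]_m) (r : R) :
  euclidean_at n (j x0) -> 0 < r -> (forall x, `|x - x0| <= r -> {for x, continuous j}) ->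
  {in [pred x : 'rV[R]_m | `|x - x0| <= r] &, injective j} ->
  exists (phi : X -> 'rV[R]_n) (psi : 'rV[R]_n -> X) (U : set X) (r' : R),
  [/\ open U, U (j x0), forall x, U x -> psi (phi x) = x /\ {for x, continuous phi},
     0 < r' & [/\ forall x, `|x - x0| <= r' -> U (j x),
       cts_on (fun x => `|x - x0| <= r') (phi \o j) &
       {in [pred x : 'rV[R]_m | `|x - x0| <= r'] &, injective (phi \o j)}]].
Proof.
move=> [phi [psi [U [V [oO Oj oV [OP VP]]]]]] r0 jc ji.
have jc0 : {for x0, continuous j} by apply: jc; rewrite subrr normr0 ltW.
have [r1 r10 r1P] := nbhs_rvP (jc0 _ (open_nbhs_nbhs (conj oO Oj))).
pose r2 := Num.min r r1; have r20 : 0 < r2 by rewrite lt_min r0.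
have r2P (x : 'rV[R]_m) : `|x - x0| <= r2 -> `|x - x0| <= r /\ U (j x).
  by rewrite le_min => /andP[xr xr1]; split=> //; exact: r1P.
exists phi, psi, U, r2; split=> //; first by move=> x /OP[].
split; first by move=> x /r2P[].
  apply: continuous_cts_on => x /r2P[xr Ox]; apply: continuous_comp; first exact: jc.
  by have [] := OP _ Ox.
move=> x y; rewrite !inE => /r2P[xr Ox] /r2P[yr Oy] /= E; apply: ji; rewrite ?inE //.
by have [_ <- _] := OP _ Ox; have [_ <- _] := OP _ Oy; rewrite E.
Qed.

Lemma parametrization_dim m (j : 'rV[R]_m -> X) (x0 : 'rV[R]_m) (r : R) :
  euclidean_at n (j x0) -> 0 < r -> (forall x, `|x - x0| <= r -> {for x, continuous j}) ->
  {in [pred x : 'rV[R]_m | `|x - x0| <= r] &, injective j} -> (m <= n)%N.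
Proof.
move=> Xj r0 jc ji.
have [phi [psi [U [r' [_ _ _ r'0 [_ fc fi]]]]]] := parametrization_chart Xj r0 jc ji.
exact: no_embedding r'0 fc fi.
Qed.

Lemma projection_chart m (g : X -> 'rV[R]_m) (p : X) (N : set X) :
  euclidean_at n p -> nbhs p N -> (forall x, N x -> {for x, continuous g}) ->
  (forall x y, N x -> N y -> g x = g y -> x = y) ->
  exists (psi : 'rV[R]_n -> X) (y0 : 'rV[R]_n) (r : R),
  [/\ psi y0 = p, 0 < r, forall y, `|y - y0| <= r -> N (psi y),
     cts_on (fun y => `|y - y0| <= r) (g \o psi) &
     {in [pred y : 'rV[R]_n | `|y - y0| <= r] &, injective (g \o psi)}].
Proof.
move=> [phi [psi [U [V [oO Op oV [OP VP]]]]]] Np gc gi.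
have [Vp pp pc] := OP _ Op; have [_ _ psic] := VP _ Vp.
have NV : nbhs (phi p) (V `&` psi @^-1` N).
  apply: filterI; first exact: open_nbhs_nbhs.
  by apply: psic; rewrite pp.
have [r r0 rP] := nbhs_rvP NV.
exists psi, (phi p), r; split=> // [y /rP[]//||].
  apply: continuous_cts_on => y /rP[Vy Ny]; apply: continuous_comp; last exact: gc.
  by have [] := VP _ Vy.
move=> x y; rewrite !inE => /rP[Vx Nx] /rP[Vy Ny] /= /(gi _ _ Nx Ny) E.
by have [_ <- _] := VP _ Vx; have [_ <- _] := VP _ Vy; rewrite E.
Qed.

Lemma projection_dim m (g : X -> 'rV[R]_m) (p : X) (N : set X) :
  euclidean_at n p -> nbhs p N -> (forall x, N x -> {for x, continuous g}) ->
  (forall x y, N x -> N y -> g x = g y -> x = y) -> (n <= m)%N.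
Proof.
move=> Xp Np gc gi; have [psi [y0 [r [_ r0 _ fc fi]]]] := projection_chart Xp Np gc gi.
exact: no_embedding r0 fc fi.
Qed.
End LocallyEuclideanPoint.

Lemma parametrization_open (X : topologicalType) n (j : 'rV[R]_n.+1 -> X)
    (x0 : 'rV[R]_n.+1) (r : R) :
  euclidean_at n.+1 (j x0) -> 0 < r ->
  (forall x, `|x - x0| <= r -> {for x, continuous j}) ->
  {in [pred x : 'rV[R]_n.+1 | `|x - x0| <= r] &, injective j} ->
  nbhs (j x0) (range j).
Proof.
move=> Xj r0 jc ji.
have [phi [psi [U [r' [oO Oj OP r'0 [r'U fc fi]]]]]] := parametrization_chart Xj r0 jc ji.
have [e e0 eP] := invariance_of_domain r'0 fc fi.
have [_ phic] := OP _ Oj.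
have B : nbhs (phi (j x0)) [set y : 'rV[R]_n.+1 | `|y - phi (j x0)| < e].
  rewrite -filter_from_ballE; exists e => // y.
  by rewrite /= mx_norm_ball /= distrC.
apply: filterS (filterI (open_nbhs_nbhs (conj oO Oj)) (phic _ B)) => x [Ox /= xe].
have [y yr E] := eP _ xe; exists y => //.
have [<- _] := OP _ Ox; rewrite -E /=; by have [-> _] := OP _ (r'U _ yr).
Qed.

Lemma projection_open (X : topologicalType) n (g : X -> 'rV[R]_n.+1) (p : X) (N : set X) :
  euclidean_at n.+1 p -> nbhs p N -> (forall x, N x -> {for x, continuous g}) ->
  (forall x y, N x -> N y -> g x = g y -> x = y) ->
  exists2 e : R, 0 < e & forall y, `|y - g p| < e -> exists2 x, N x & g x = y.
Proof.
move=> Xp Np gc gi; have [psi [y0 [r [<- r0 rN fc fi]]]] := projection_chart Xp Np gc gi.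
have [e e0 eP] := invariance_of_domain r0 fc fi; exists e => // y ye.
by have [x xr <-] := eP y ye; exists (psi x) => //; exact: rN.
Qed.
End InvarianceOfDomain.

(** * The realization of a simplicial manifold *)

Lemma set_type_nbhs (X : topologicalType) (A : set X) (u : set_type A) (N : set (set_type A)) :
  nbhs u N -> exists2 W : set X, open W & W (set_val u) /\ set_val @^-1` W `<=` N.
Proof. by move=> [_ [[W oW <-] Wu] WN]; exists W. Qed.

Lemma continuous_of_restriction (X Y : topologicalType) (U : set X) (f : set_type U -> Y)
    (F : X -> Y) : open U -> continuous f -> (forall u, F (set_val u) = f u) ->
  forall x, U x -> {for x, continuous F}.
Proof.
move=> oU fc Ff x Ux N; rewrite -[x]/(set_val (exist (fun y => y \in U) x (mem_set Ux))).
rewrite Ff => /fc/set_type_nbhs[W oW [Wx WN]].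
apply: filterS (open_nbhs_nbhs (conj (openI oW oU) (conj Wx Ux))) => z [Wz Uz] /=.
have := WN (exist _ z (mem_set Uz)) Wz; rewrite /= -Ff.
by [].
Qed.

Lemma euclidean_at_manifold (R : realType) n (X M : topologicalType) (p : X) :
  homeomorphic X M -> locally_euclidean R n M -> euclidean_at R n p.
Proof.
move=> [h [h' [hc hc' hK hK']]] /(_ (h p))[U [V [oU Up oV [a [b [ac bc aK bK]]]]]].
pose phi0 (z : M) : 'rV[R]_n :=
  if pselect (U z) is left H then set_val (a (exist _ z (mem_set H))) else 0.
pose psi0 (y : 'rV[R]_n) : M :=
  if pselect (V y) is left H then set_val (b (exist _ y (mem_set H))) else h p.
have phi0E u : phi0 (set_val u) = set_val (a u).
  rewrite /phi0; case: pselect => [H|]; last by case; apply/set_mem; case: u.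
  by congr (set_val (a _)); apply: val_inj.
have psi0E u : psi0 (set_val u) = set_val (b u).
  rewrite /psi0; case: pselect => [H|]; last by case; apply/set_mem; case: u.
  by congr (set_val (b _)); apply: val_inj.
have valU (z : M) : U z -> exists u : set_type U, set_val u = z.
  by move=> Uz; exists (exist _ z (mem_set Uz)).
have valV (y : 'rV[R]_n) : V y -> exists u : set_type V, set_val u = y.
  by move=> Vy; exists (exist _ y (mem_set Vy)).
have inU (u : set_type U) : U (set_val u) by apply/set_mem; case: u.
have inV (u : set_type V) : V (set_val u) by apply/set_mem; case: u.
have valc (Z : topologicalType) (A : set Z) : continuous (set_val : set_type A -> Z).
  exact: initial_continuous.
exists (phi0 \o h), (h' \o psi0), (h @^-1` U), V; split=> //.
  by apply: open_comp => // z _; exact: hc.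
split=> [x Ux|y Vy].
  split.
  - by have [u uE] := valU _ Ux; rewrite /= -uE phi0E.
  - by have [u uE] := valU _ Ux; rewrite /= -uE phi0E psi0E aK uE hK.
  apply: continuous_comp; first exact: hc.
  apply: (continuous_of_restriction oU _ phi0E) => // z.
  by apply: continuous_comp; [exact: ac | exact: valc].
have [u uE] := valV _ Vy; split.
- by rewrite /= -uE psi0E hK'.
- by rewrite /= -uE psi0E hK' phi0E bK.
apply: continuous_comp; last exact: hc'.
apply: (continuous_of_restriction oV _ psi0E) => // z.
by apply: continuous_comp; [exact: bc | exact: valc].
Qed.

(** * Barycentric coordinates and affine coordinates *)

Section Realization.
Variables (R : realType) (T : finType) (C : {set {set T}}).
Local Notation X := (set_type (realization R C)).

Definition coord (x : X) (v : T) : R := set_val x v.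

Lemma coordP (x : X) : [/\ forall v, 0 <= coord x v, \sum_v coord x v = 1 &
  [set v | coord x v != 0]%SET \in C].
Proof. by case: x => x /= xP; exact: (set_mem xP). Qed.

Lemma coord_inj (x y : X) : coord x =1 coord y -> x = y.
Proof. by move=> xy; apply: val_inj; apply/funext. Qed.

Lemma continuous_coord v : continuous (coord^~ v).
Proof.
move=> x N Nx.
have H := @proj_continuous T (fun=> R) v (set_val x) N Nx.
exact: (@initial_continuous _ _ (set_val : X -> _) x _ H).
Qed.

Lemma realization_continuous (S : topologicalType) (f : S -> X) s :
  (forall v, {for s, continuous (fun s => coord (f s) v)}) -> {for s, continuous f}.
Proof.
move=> fc N /set_type_nbhs[W oW [Ws WN]].
suff H : {for s, continuous (set_val \o f : S -> prod_topology (fun=> R))}.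
  have HW : nbhs s ((fun z => set_val (f z)) @^-1` W) := H W (open_nbhs_nbhs (conj oW Ws)).
  rewrite -[_ N]/(nbhs s (f @^-1` N)).
  by apply: (@filterS _ (nbhs s) (nbhs_filter s) _ _ _ HW) => z; exact: WN.
apply/cvg_sup => v B [_ [[D oD <-] Ds] DB].
have HD : nbhs s ((fun z => coord (f z) v) @^-1` D) := fc v D (open_nbhs_nbhs (conj oD Ds)).
rewrite -[_ B]/(nbhs s ((fun z => set_val (f z)) @^-1` B)).
by apply: (@filterS _ (nbhs s) (nbhs_filter s) _ _ _ HD) => z Dz; apply: DB.
Qed.
End Realization.

Lemma quotient_continuous (R : realType) (S : topologicalType) (f g : S -> R) (s : S) :
  {for s, continuous f} -> {for s, continuous g} -> g s != 0 ->
  {for s, continuous (fun s => f s / g s)}.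
Proof. by move=> fc gc g0; apply: cvgM => //; exact: cvgV. Qed.

Lemma sum_continuous (R : realType) (S : topologicalType) (I : finType) (P : pred I)
    (f : I -> S -> R) (s : S) :
  (forall i, {for s, continuous (f i)}) ->
  {for s, continuous (fun s => \sum_(i | P i) f i s)}.
Proof.
move=> fc; have add_cts : continuous (fun x : R * R => x.1 + x.2).
  exact: (@add_continuous R^o).
by apply: (cvg_big add_cts) => i _; exact: fc.
Qed.

Section Realization.
Variables (R : realType) (T : finType) (C : {set {set T}}).
Local Notation X := (set_type (realization R C)).

Lemma weights_map (S : topologicalType) (W : S -> T -> R) :
  (forall s v, 0 <= W s v) -> (forall s, 0 < \sum_v W s v) ->
  (forall s, [set v | W s v != 0]%SET \in C) ->
  exists J : S -> X, (forall s v, coord (J s) v = W s v / \sum_u W s u) /\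
    forall s, (forall v, {for s, continuous (fun s => W s v)}) -> {for s, continuous J}.
Proof.
move=> W0 Ws WC; have pt s : exists x : X, forall v, coord x v = W s v / \sum_u W s u.
  have xP : realization R C (fun v => W s v / \sum_u W s u).
    split=> [v||]; first by rewrite divr_ge0 // ltW.
      by rewrite -mulr_suml divff // gt_eqF.
    rewrite (_ : [set v | _]%SET = [set v | W s v != 0]%SET) //.
    by apply/setP => v; rewrite !inE mulf_eq0 invr_eq0 (gt_eqF (Ws s)) orbF.
  by exists (exist (fun x => x \in realization R C) _ (mem_set xP)).
have [J JE] := choice pt; exists J; split=> // s Wc.
apply: realization_continuous => v.
have -> : (fun s => coord (J s) v) = (fun s => W s v / \sum_u W s u).
  by apply/funext => z; exact: JE.
apply: quotient_continuous; [exact: Wc | | by rewrite gt_eqF].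
by apply: sum_continuous => u; exact: Wc.
Qed.

(** The common weight 1 at [w0] determines the normalizing sum. *)
Lemma coords_inj_weights (S : Type) (J : S -> X) (W : S -> T -> R) w0 s t :
  (forall s v, coord (J s) v = W s v / \sum_u W s u) -> 0 < \sum_u W s u ->
  0 < \sum_u W t u -> W s w0 = 1 -> W t w0 = 1 -> J s = J t -> W s =1 W t.
Proof.
move=> JE Ws Wt s0 t0 E v.
have H u : W s u / \sum_u W s u = W t u / \sum_u W t u by rewrite -!JE E.
have sum_eq : \sum_u W s u = \sum_u W t u.
  by have := H w0; rewrite s0 t0 !div1r => /invr_inj.
have := H v; rewrite sum_eq => /(mulIf _); apply.
by rewrite invr_eq0 gt_eqF.
Qed.

(* Affine coordinates: the barycentric coordinates relative to that of [w0]. *)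
Definition ratios k (w0 : T) (b : 'I_k -> T) (x : X) : 'rV[R]_k :=
  \row_i (coord x (b i) / coord x w0).

Lemma ratios_continuous k w0 (b : 'I_k -> T) x : 0 < coord x w0 ->
  {for x, continuous (ratios w0 b)}.
Proof.
move=> x0 N /nbhs_ballP[e e0 eN].
have H i : nbhs x [set z | ball (coord x (b i) / coord x w0) e (coord z (b i) / coord z w0)].
  have : {for x, continuous (fun z => coord z (b i) / coord z w0)}.
    apply: (@quotient_continuous R X (fun z : X => coord z (b i)) (fun z : X => coord z w0)).
    - exact: continuous_coord.
    - exact: continuous_coord.
    - by rewrite gt_eqF.
  by apply; apply: nbhsx_ballx.
have HA := @filter_forall _ _ _ (nbhs x) (nbhs_filter x) H.
rewrite -[_ N]/(nbhs x (ratios w0 b @^-1` N)).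
apply: (@filterS _ (nbhs x) (nbhs_filter x) _ _ _ HA) => z zP; apply: eN; split=> // i j.
by rewrite ord1 !mxE; exact: zP.
Qed.

(** Equal ratios make the coordinates of [y] a multiple of those of [x], and both sum to 1. *)
Lemma ratios_inj k w0 (b : 'I_k -> T) (x y : X) : 0 < coord x w0 -> 0 < coord y w0 ->
  (forall v, v != w0 -> (forall i, b i != v) -> coord x v = 0 /\ coord y v = 0) ->
  ratios w0 b x = ratios w0 b y -> x = y.
Proof.
move=> x0 y0 supp E; set l := coord y w0 / coord x w0.
have yE v : coord y v = l * coord x v.
  have [->|vw] := eqVneq v w0; first by rewrite /l divfK // gt_eqF.
  have [/existsP[i /eqP bi]|/existsPn nb] := boolP [exists i, b i == v].
    have := congr1 (fun M : 'rV[R]_k => M ord0 i) E; rewrite !mxE bi /l => Ei.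
    by rewrite mulrAC -mulrA Ei mulrC divfK // gt_eqF.
  by have [-> ->] := supp v vw nb; rewrite mulr0.
have l1 : l = 1.
  have [_ sx _] := coordP x; have [_ sy _] := coordP y.
  by rewrite -[RHS]sy (eq_bigr _ (fun v _ => yE v)) -mulr_sumr sx mulr1.
by apply: coord_inj => v; rewrite yE l1 mul1r.
Qed.

Definition open_star (A : {set T}) : set X := [set x | forall v, v \in A -> 0 < coord x v].

Lemma open_star_nbhs A x : open_star A x -> nbhs x (open_star A).
Proof.
move=> xA; have H v : nbhs x [set z | v \in A -> 0 < coord z v].
  have [vA|vA] := boolP (v \in A); last first.
    by apply: (@filterS _ (nbhs x) (nbhs_filter x) _ _ _ (@filterT _ (nbhs x) (nbhs_filter x))).
  have N0 : nbhs (coord x v) [set r : R | 0 < r].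
    exact: (open_nbhs_nbhs (conj (@open_gt R 0) (xA v vA))).
  have N1 : nbhs x [set z : X | 0 < coord z v] := @continuous_coord R T C v x _ N0.
  by apply: (@filterS _ (nbhs x) (nbhs_filter x) _ _ _ N1) => z zP _; exact: zP.
have HA := @filter_forall _ _ _ (nbhs x) (nbhs_filter x) H.
by apply: (@filterS _ (nbhs x) (nbhs_filter x) _ _ _ HA) => z zP v; exact: zP.
Qed.

Lemma open_star_support A x : open_star A x -> A \subset [set v | coord x v != 0]%SET.
Proof. by move=> xA; apply/fintype.subsetP => v vA; rewrite inE gt_eqF // xA. Qed.

Lemma open_star_point A : A \in C -> A != finset.set0 ->
  exists2 x, open_star A x & forall v, v \notin A -> coord x v = 0.
Proof.
move=> AC /finset.set0Pn[w wA]; pose W (_ : R) v : R := (v \in A)%:R.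
have W0 v : 0 <= W 0 v by rewrite ler0n.
have Ws s : 0 < \sum_v W s v.
  by rewrite (bigD1 w) //= /W wA; apply: ltr_pwDl => //; apply: sumr_ge0 => v _; exact: W0.
have [||s|J [JE _]] := @weights_map R W.
- by move=> s v; exact: W0.
- exact: Ws.
- by rewrite (_ : [set v | W s v != 0]%SET = A) //; apply/setP => v; rewrite inE /W pnatr_eq0 eqb0 negbK.
exists (J 0) => v vA; rewrite JE.
  by apply: divr_gt0; [rewrite /W vA ltr01 | exact: Ws].
by rewrite /W (negbTE vA) mul0r.
Qed.

Lemma enum_but (A : {set T}) w0 k : w0 \in A -> #|A| = k.+1 ->
  exists b : 'I_k -> T, [/\ injective b, forall i, b i \in A /\ b i != w0 &
    forall v, v \in A -> v != w0 -> exists i, b i = v].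
Proof.
move=> wA Ak; have sk : size (enum (A :\ w0)) = k.
  by rewrite -cardE; apply: eq_add_S; rewrite -Ak (cardsD1 w0 A) wA.
exists (fun i => nth w0 (enum (A :\ w0)) i).
split=> [i j E|i|v vA vw].
- apply: val_inj; apply/eqP.
  have U := @nth_uniq _ w0 (enum (A :\ w0)) i j; rewrite !sk !ltn_ord enum_uniq in U.
  by rewrite -U //; apply/eqP.
- have : nth w0 (enum (A :\ w0)) i \in A :\ w0 by rewrite -mem_enum mem_nth ?sk.
  by rewrite !inE => /andP[-> ->].
have vin : v \in enum (A :\ w0) by rewrite mem_enum !inE vw.
have lt : (index v (enum (A :\ w0)) < k)%N by rewrite -sk index_mem.
by exists (Ordinal lt); rewrite /= nth_index.
Qed.
End Realization.

(** * Sheets: parametrized pieces of one simplex or of two glued ones *)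

Section Sheets.
Variables (R : realType) (T : finType) (k : nat) (w0 : T) (b : 'I_k -> T)
  (s : 'I_k -> R) (c : T -> option 'I_k).

(* Unnormalized barycentric coordinates. The vertex [b i] has weight [s i + y i], cut
   off at [0]; with [s i = 0], negative values of [y i] go to the vertex [v] with
   [c v = Some i], so that two simplices are glued along the face [y i = 0]. *)
Definition sheet_weight (y : 'rV[R]_k) (v : T) : R :=
  (v == w0)%:R + \sum_(i | b i == v) Num.max 0 (s i + y ord0 i) +
  (if c v is Some i then Num.max 0 (- y ord0 i) else 0).

Lemma pos_part_ge0 (a : R) : 0 <= Num.max 0 a.
Proof. by rewrite le_max lexx. Qed.

Lemma sheet_weight_ge0 y v : 0 <= sheet_weight y v.
Proof.
rewrite /sheet_weight addr_ge0 //; last by case: (c v) => // i; exact: pos_part_ge0.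
by rewrite addr_ge0 // ?ler0n // sumr_ge0 // => i _; exact: pos_part_ge0.
Qed.

Lemma pos_part_continuous (S : topologicalType) (f : S -> R) t :
  {for t, continuous f} -> {for t, continuous (fun z => Num.max 0 (f z))}.
Proof.
move=> fc; apply: (@continuous_max R S (fun=> 0) f) => //.
exact: cvg_cst.
Qed.

Lemma const_continuous (S : topologicalType) (a : R) (t : S) : {for t, continuous (fun _ : S => a)}.
Proof. exact: cvg_cst. Qed.

Lemma add_continuous_for (S : topologicalType) (f g : S -> R) t :
  {for t, continuous f} -> {for t, continuous g} -> {for t, continuous (fun z => f z + g z)}.
Proof. by move=> fc gc; apply: (@cvgD R R^o). Qed.

Lemma sheet_weight_continuous v y : {for y, continuous (fun y => sheet_weight y v)}.
Proof.
have cc i : {for y, continuous (fun y : 'rV[R]_k => y ord0 i)}.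
  by move=> N; exact: coord_continuous.
have pc i a d (g : 'rV[R]_k -> R) : g = (fun z => Num.max 0 (a + d * z ord0 i)) ->
    {for y, continuous g}.
  move=> ->.
  apply: (@pos_part_continuous 'rV[R]_k (fun z => a + d * z ord0 i) y).
  apply: (@add_continuous_for 'rV[R]_k (fun=> a) (fun z => d * z ord0 i) y); first exact: const_continuous.
  by apply: (@cvgM R 'rV[R]_k (nbhs y) _ (fun=> d)); [exact: const_continuous | exact: cc].
apply: add_continuous_for.
  apply: add_continuous_for; first exact: const_continuous.
  apply: (@sum_continuous R 'rV[R]_k _ _ (fun i z => Num.max 0 (s i + z ord0 i)) y) => i.
  by apply: (pc i (s i) 1); apply/funext => z; rewrite mul1r.
case: (c v) => [i|]; last exact: const_continuous.
by apply: (pc i 0 (-1)); apply/funext => z; rewrite mulN1r add0r.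
Qed.

Hypotheses (b_inj : injective b) (bw : forall i, b i != w0) (cw : c w0 = None)
  (cb : forall i, c (b i) = None).

Lemma sheet_weight_base y : sheet_weight y w0 = 1.
Proof.
rewrite /sheet_weight eqxx cw big_pred0 ?addr0 // => i; exact: negbTE (bw i).
Qed.

Lemma sheet_weight_face y i : sheet_weight y (b i) = Num.max 0 (s i + y ord0 i).
Proof.
rewrite /sheet_weight cb (negbTE (bw i)) (big_pred1 i) ?add0r ?addr0 // => j.
by rewrite /= (inj_eq b_inj).
Qed.

Lemma sheet_weight_out y v : v != w0 -> (forall i, b i != v) ->
  sheet_weight y v = if c v is Some i then Num.max 0 (- y ord0 i) else 0.
Proof.
move=> vw bv; rewrite /sheet_weight (negbTE vw) big_pred0 ?add0r // => i.
exact: negbTE (bv i).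
Qed.

(** The bound [1 / 2] keeps [1 + y i] positive, so the cutoff is inactive where [s i = 1]. Where
    [s i = 0], the weights of [b i] and [v] are the positive and negative parts of [y i]. *)
Lemma sheet_weight_inj (y z : 'rV[R]_k) :
  (forall i, s i = 1 \/ s i = 0 /\ exists v, c v = Some i) ->
  `|y| <= 1 / 2 -> `|z| <= 1 / 2 -> sheet_weight y =1 sheet_weight z -> y = z.
Proof.
move=> sP y2 z2 E; apply/rowP => i; have := E (b i); rewrite !sheet_weight_face.
have half (x : 'rV[R]_k) : `|x| <= 1 / 2 -> 0 <= 1 + x ord0 i.
  move=> x2; have := (rv_norm_le x (_ : 0 <= 1 / 2)).1 x2 i.
  by rewrite divr_ge0 // => /(_ isT); rewrite ler_norml => /andP[]; lra.
have [->|[-> [v cv]]] := sP i.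
  by rewrite !max_r ?half // => /addrI.
have vw : v != w0 by apply/eqP => vE; rewrite vE cw in cv.
have vb j : b j != v by apply/eqP => vE; rewrite -vE cb in cv.
have := E v; rewrite !sheet_weight_out // cv !add0r.
by rewrite !maxEle; do 4 case: leP => ?; lra.
Qed.
End Sheets.

Section Realization.
Variables (R : realType) (T : finType) (C : {set {set T}}).
Local Notation X := (set_type (realization R C)).

Lemma sheet_parametrization k (w0 : T) (b : 'I_k -> T) (s : 'I_k -> R) (c : T -> option 'I_k) :
  injective b -> (forall i, b i != w0) -> c w0 = None -> (forall i, c (b i) = None) ->
  (forall i, s i = 1 \/ s i = 0 /\ exists v, c v = Some i) ->
  (forall y, [set v | sheet_weight w0 b s c y v != 0]%SET \in C) ->
  exists J : 'rV[R]_k -> X,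
  [/\ forall y v, coord (J y) v = sheet_weight w0 b s c y v / \sum_u sheet_weight w0 b s c y u,
     continuous J & {in [pred y : 'rV[R]_k | `|y - 0| <= 1 / 2] &, injective J}].
Proof.
move=> b_inj bw cw cb sP WC; pose W := sheet_weight w0 b s c.
have W1 y : W y w0 = 1 by exact: sheet_weight_base.
have W0 y v : 0 <= W y v by exact: sheet_weight_ge0.
have Ws y : 0 < \sum_u W y u.
  by rewrite (bigD1 w0) //= W1 ltr_pwDl // sumr_ge0.
have [//|//|//|J [JE Jc]] := @weights_map R T C _ W.
exists J; split=> //; first by move=> y; apply: Jc => v; exact: sheet_weight_continuous.
move=> y z; rewrite !inE !subr0 => y2 z2 E.
apply: (@sheet_weight_inj R T k w0 b s c) => //.
exact: (coords_inj_weights JE (Ws y) (Ws z) (W1 y) (W1 z) E).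
Qed.
End Realization.

(** * Facets and ridges of a locally Euclidean realization *)

Section EuclideanRealization.
Variables (R : realType) (T : finType) (C : {set {set T}}).
Local Notation X := (set_type (realization R C)).
Hypothesis Csub : forall A B : {set T}, A \in C -> B \subset A -> B \in C.

(** A sheet inside [A] embeds a ball of dimension [#|A| - 1], so this is at most [n]. Conversely, by
    maximality the points of the open star of [A] are supported on [A], so the ratios embed this
    open star in dimension [#|A| - 1]. *)
Lemma euclidean_facet_card n A : (forall p : X, euclidean_at R n p) -> A \in facets C ->
  A != finset.set0 -> #|A| = n.+1.
Proof.
move=> eucl Af A0; have AC := facets_face Af; have /finset.set0Pn[w0 wA] := A0.
have Ak : #|A| = #|A|.-1.+1 by rewrite prednK // (cardD1 w0) wA.
rewrite Ak; congr _.+1; set k := #|A|.-1 in Ak *.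
have [b [b_inj bA Ab]] := enum_but wA Ak; apply/eqP; rewrite eqn_leq; apply/andP; split.
  have [||||||J [_ Jc Ji]] := @sheet_parametrization R T C k w0 b (fun=> 1) (fun=> None) => //.
  - by move=> i; case: (bA i).
  - by move=> i; left.
  - move=> y; apply: Csub AC _; apply/fintype.subsetP => v; rewrite inE; apply: contraR => vA.
    rewrite sheet_weight_out //; first by apply: contraNneq vA => ->.
    by move=> i; apply: contraNneq vA => <-; case: (bA i).
  by apply: (parametrization_dim (eucl (J 0)) (_ : 0 < 1 / 2) _ Ji) => // *; exact: Jc.
have [p pA _] := open_star_point R AC A0.
apply: (@projection_dim R X n k (ratios w0 b) p (open_star A)) => //.
- exact: open_star_nbhs.
- by move=> x xA; apply: ratios_continuous; exact: xA.
have supp (x : X) v : open_star A x -> v \notin A -> coord x v = 0.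
  move=> xA vA; have [_ _ xC] := coordP x.
  have E := facet_max Af xC (open_star_support xA).
  by apply/eqP; apply: contraNT vA => xv; rewrite -E inE.
move=> x y xA yA; apply: ratios_inj => [||v vw vb]; [exact: xA | exact: yA |].
have vA : v \notin A by apply/negP => vA; have [i bi] := Ab v vA vw; have := vb i; rewrite bi eqxx.
by split; exact: supp.
Qed.

(* Otherwise the affine coordinates relative to a vertex of [A] would embed the open
   star of [A] in the half-space where that of the vertex of [B] outside [A] is
   nonnegative, and a point on its boundary would be interior to the image. *)
Lemma not_boundary_face n (A B : {set T}) : (forall p : X, euclidean_at R n.+1 p) -> A \in C ->
  A != finset.set0 -> #|B| = n.+2 -> A \proper B ->
  (forall D : {set T}, D \in C -> A \subset D -> D \subset B) -> False.
Proof.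
move=> eucl AC A0 Bn /properP[AB [v vB vA]] Buniq; have /finset.set0Pn[w0 wA] := A0.
have [b [b_inj bB Bb]] := enum_but (fintype.subsetP AB _ wA) Bn.
have [p pA p0] := open_star_point R AC A0.
have [|||e e0 eP] := @projection_open R X n (ratios w0 b) p (open_star A) (eucl p).
- exact: open_star_nbhs.
- by move=> x xA; apply: ratios_continuous; exact: xA.
- move=> x y xA yA; apply: ratios_inj => [||u uw ub]; [exact: xA | exact: yA |].
  have supp (z : X) : open_star A z -> coord z u = 0.
    move=> zA; have [_ _ zC] := coordP z.
    have /fintype.subsetP E := Buniq _ zC (open_star_support zA).
    apply/eqP; apply: contraT => zu; have [|i bi] := Bb u _ uw; first by apply: E; rewrite inE.
    by have := ub i; rewrite bi eqxx.
  by split; exact: supp.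
have [|x xA xE] := eP (ratios w0 b p - const_mx (e / 2)).
  rewrite addrAC subrr add0r normrN; apply/rv_norm_lt => // i; rewrite mxE gtr0_norm ?divr_gt0 //.
  by rewrite ltr_pdivrMr // mulr_natr mulr2n ltrDl.
have vw : v != w0 by apply: contraNneq vA => ->.
have [i bi] := Bb v vB vw.
have := congr1 (fun M : 'rV[R]_n.+1 => M ord0 i) xE; rewrite !mxE bi (p0 v vA) mul0r add0r.
have [x0 _ _] := coordP x => E; have : 0 <= coord x v / coord x w0 by rewrite divr_ge0.
by rewrite E oppr_ge0 leNgt divr_gt0.
Qed.

(* The first two sheets already fill a neighbourhood of the barycenter of [A]. *)
Lemma no_three_sheets n (A : {set T}) v1 v2 v3 : (forall p : X, euclidean_at R n.+1 p) ->
  A != finset.set0 -> #|A| = n.+1 -> v1 \notin A -> v2 \notin A -> v3 \notin A ->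
  v1 != v2 -> v2 != v3 -> v3 != v1 ->
  v1 |: A \in C -> v2 |: A \in C -> v3 |: A \in C -> False.
Proof.
move=> eucl A0 An v1A v2A v3A v12 v23 v31 C1 C2 C3; have /finset.set0Pn[w0 wA] := A0.
have An1 : #|v1 |: A| = n.+2 by rewrite cardsU1 v1A An.
have [b [b_inj bA Ab]] := enum_but (setU1r v1 wA) An1.
have w_neq v : v \notin A -> v != w0 by apply: contraNneq => ->.
have [i1 bi1] := Ab v1 (setU11 _ _) (w_neq _ v1A).
(* The coordinate [i1] crosses [A]: its positive part is the weight of [v1], its negative part that
   of [v2]. *)
pose s i : R := (i != i1)%:R; pose c v := if v == v2 then Some i1 else None.
pose W := sheet_weight w0 b s c.
have bw i : b i != w0 by case: (bA i).
have bout v : v \notin A -> v != v1 -> forall i, b i != v.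
  move=> vA vv1 i; apply/eqP => bv; have [] := bA i.
  by rewrite bv finset.in_setU1 (negbTE vv1) (negbTE vA).
have cw : c w0 = None by rewrite /c eq_sym (negbTE (w_neq _ v2A)).
have v21 : v2 != v1 by rewrite eq_sym.
have cb i : c (b i) = None by rewrite /c (negbTE (bout v2 v2A v21 i)).
have Wv1 y : W y v1 = Num.max 0 (y ord0 i1).
  by rewrite -bi1 /W sheet_weight_face // /s eqxx add0r.
have Wv2 y : W y v2 = Num.max 0 (- y ord0 i1).
  by rewrite /W sheet_weight_out ?w_neq ?/c ?eqxx //; exact: bout.
have W0 y v : v \notin A -> v != v1 -> v != v2 -> W y v = 0.
  move=> vA vv1 vv2; rewrite /W sheet_weight_out ?w_neq ?/c ?(negbTE vv2) //.
  exact: bout.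
have [||||||J [JE Jc Ji]] := @sheet_parametrization R T C n.+1 w0 b s c => //.
- move=> i; rewrite /s; have [->|_] := eqVneq i i1; last by left.
  by right; split=> //; exists v2; rewrite /c eqxx.
- move=> y; rewrite -/W; have [y0|y0] := leP 0 (y ord0 i1).
    apply: Csub C1 _; apply/fintype.subsetP => v; rewrite inE; apply: contraR.
    rewrite finset.in_setU1 negb_or => /andP[vv1 vA].
    have [->|vv2] := eqVneq v v2; first by rewrite Wv2 max_l // oppr_le0.
    by rewrite W0.
  apply: Csub C2 _; apply/fintype.subsetP => v; rewrite inE; apply: contraR.
  rewrite finset.in_setU1 negb_or => /andP[vv2 vA].
  have [->|vv1] := eqVneq v v1; first by rewrite Wv1 max_l // ltW.
  by rewrite W0.
have W00 v : W 0 v = (v \in A)%:R.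
  have [->|vv1] := eqVneq v v1; first by rewrite Wv1 mxE maxxx (negbTE v1A).
  have [->|vv2] := eqVneq v v2; first by rewrite Wv2 mxE oppr0 maxxx (negbTE v2A).
  have [vA|vA] := boolP (v \in A); last by rewrite W0.
  have [->|vw] := eqVneq v w0; first exact: sheet_weight_base.
  have [i bi] := Ab v (setU1r v1 vA) vw.
  have ii1 : i != i1 by apply: contraNneq vv1 => ii; rewrite -bi ii bi1.
  by rewrite -bi /W sheet_weight_face // mxE addr0 /s ii1 max_r.
(* A path from the barycenter of [A] into the third sheet; for [t > 0] its weight at [v3] keeps it
   off the first two. *)
pose V (t : R) v : R := (v \in A)%:R + (v == v3)%:R * Num.max 0 t.
have V0 t v : 0 <= V t v by rewrite /V addr_ge0 ?ler0n // mulr_ge0 ?ler0n // pos_part_ge0.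
have Vw t : V t w0 = 1 by rewrite /V wA eq_sym (negbTE (w_neq _ v3A)) mul0r addr0.
have Vs t : 0 < \sum_v V t v by rewrite (bigD1 w0) //= Vw ltr_pwDl // sumr_ge0.
have [//|//|t|K [KE Kc]] := @weights_map R T C _ V.
  apply: Csub C3 _; apply/fintype.subsetP => v; rewrite inE; apply: contraR.
  by rewrite finset.in_setU1 negb_or /V => /andP[/negbTE-> /negbTE->]; rewrite mul0r addr0.
have VW v : V 0 v = W 0 v by rewrite W00 /V maxxx mulr0 addr0.
have KJ : K 0 = J 0.
  apply: coord_inj => v; rewrite KE JE -/W VW; congr (_ / _).
  by apply: eq_bigr => u _; exact: VW.
have Nb : nbhs (K 0) (range J).
  rewrite KJ; apply: (parametrization_open (eucl (J 0)) (_ : 0 < 1 / 2) _ Ji) => // *.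
  exact: Jc.
have Kc0 : {for 0, continuous K}.
  apply: Kc => v; apply: (@add_continuous_for R R (fun=> (v \in A)%:R)); first exact: const_continuous.
  apply: (@cvgM R R _ _ (fun=> (v == v3)%:R)); first exact: const_continuous.
  by apply: (@pos_part_continuous R R id) => N.
have /nbhs_ballP[e e0 eP] : nbhs (0 : R) (K @^-1` range J) := Kc0 _ Nb.
have [|y _ Jy] := eP (e / 2).
  rewrite /ball /= sub0r normrN gtr0_norm ?divr_gt0 //.
  by rewrite ltr_pdivrMr // mulr_natr mulr2n ltrDl.
have v32 : v3 != v2 by rewrite eq_sym.
have := JE y v3; rewrite Jy KE -/W (W0 y v3) // mul0r => /eqP.
rewrite gt_eqF // divr_gt0 // /V (negbTE v3A) eqxx add0r mul1r max_r ?divr_gt0 //.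
by rewrite ltW // divr_gt0.
Qed.
End EuclideanRealization.

(** * Dimension zero, purity and ridges, conclusion *)

Lemma facet_dim (T : finType) (C : {set {set T}}) n : C != finset.set0 ->
  (forall A : {set T}, A \in facets C -> #|A| = n.+1) -> complex_dim C = n.
Proof.
move=> /finset.set0Pn[A AC] Cn; rewrite /complex_dim (_ : (\max_(B in C) #|B|)%N = n.+1) //.
apply/eqP; rewrite eqn_leq; apply/andP; split.
  by apply/bigmax_leqP => B BC; have [D Df BD] := face_in_facet BC; rewrite -(Cn D) // subset_leq_card.
have [D Df _] := face_in_facet AC; rewrite -(Cn D Df).
exact: (@leq_bigmax_cond _ (mem C) (fun B => #|B|) D (facets_face Df)).
Qed.

Lemma facet_neq0 (T : finType) (C : {set {set T}}) (A : {set T}) : simplicial_complex C ->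
  A \in facets C -> A != finset.set0.
Proof.
move=> [_ [v vC]] Af; apply: contraTneq vC => A0.
apply/negP => /(facet_max Af); rewrite A0 finset.sub0set => /(_ isT)/setP/(_ v).
by rewrite finset.in_set1 eqxx finset.in_set0.
Qed.

(** In dimension 0 the only ridge is the empty face, which lies in every point, so that a 0-manifold
    is a pseudo-manifold only if it has two points. Distinct facets are disjoint, so an intersecting
    family has at most one member. *)
Lemma point_complex_EKR (T : finType) (C : {set {set T}}) : simplicial_complex C ->
  (forall A : {set T}, A \in facets C -> #|A| = 1) -> pure_EKR C.
Proof.
move=> [_ [v vC]] C1; split; first by move=> A B /C1-> /C1->.
have facet_of u (A : {set T}) : A \in facets C -> u \in A -> A = [set u]%SET.
  by move=> /C1/eqP/cards1P[w ->]; rewrite finset.in_set1 => /eqP->.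
have vf : [set v]%SET \in facets C.
  have [A Af vA] := face_in_facet vC; rewrite -(facet_of v A) //.
  by rewrite (fintype.subsetP vA) // finset.in_set1.
exists v => //; rewrite (_ : [set A in facets C | v \in A]%SET = [set [set v]]%SET); last first.
  apply/setP => A; rewrite finset.in_set1 finset.in_set.
  apply/andP/eqP => [[Af vA]|->]; last by rewrite vf finset.in_set1.
  exact: facet_of.
rewrite cards1; apply/eqP; rewrite eqn_leq; apply/andP; split.
  rewrite -(cards1 [set v]%SET).
  apply: (@leq_bigmax_cond _ _ (fun F : {set {set T}} => #|F|)).
  rewrite finset.sub1set vf; apply/forallP => A; apply/implyP; rewrite finset.in_set1 => /eqP->.
  apply/forallP => B; apply/implyP; rewrite finset.in_set1 => /eqP->.
  by apply/pred0Pn; exists v; rewrite /= finset.in_set1 eqxx.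
apply/bigmax_leqP => F /andP[Ff Fi]; apply/card_le1_eqP => A B AF BF.
have /forallP/(_ A)/implyP/(_ AF)/forallP/(_ B)/implyP/(_ BF)/pred0Pn[u /andP[uA uB]] := Fi.
have Af := fintype.subsetP Ff A AF; have Bf := fintype.subsetP Ff B BF.
by rewrite (facet_of u A Af uA) (facet_of u B Bf uB).
Qed.

Theorem manifold_pseudo_manifold (R : realType) (T : finType) (C : {set {set T}}) n :
  simplicial_complex C -> (forall p : set_type (realization R C), euclidean_at R n.+1 p) ->
  pseudo_manifold C.
Proof.
move=> sC eucl; have [Csub [v0 v0C]] := sC.
have Fn (A : {set T}) : A \in facets C -> #|A| = n.+2.
  by move=> Af; apply: (euclidean_facet_card Csub eucl Af); exact: facet_neq0 Af.
have C0 : C != finset.set0 by apply/finset.set0Pn; exists [set v0]%SET.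
split=> //; first by move=> A B /Fn-> /Fn->.
move=> A; rewrite finset.inE (facet_dim C0 Fn) => /andP[AC /eqP An].
have A0 : A != finset.set0 by rewrite -card_gt0 An.
have ext (B : {set T}) : B \in facets C -> A \subset B -> exists2 v, v \notin A & B = v |: A.
  move=> Bf AB; have : #|B :\: A| == 1%N by rewrite cardsD (finset.setIidPr AB) Fn // An subSnn.
  move=> /cards1P[v vE]; have : v \in B :\: A by rewrite vE finset.in_set1.
  rewrite finset.in_setD => /andP[vA vB]; exists v => //; rewrite -vE.
  apply/setP => x; rewrite finset.in_setU finset.in_setD.
  by case: (boolP (x \in A)) => [/(fintype.subsetP AB)->|_]; rewrite ?orbT ?orbF.
set S := [set B in facets C | A \subset B]%SET.
have SP B : B \in S -> B \in facets C /\ A \subset B by rewrite finset.inE => /andP[].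
have [B1 B1f AB1] := face_in_facet AC.
have B1S : B1 \in S by rewrite finset.inE B1f.
apply/eqP; rewrite eqn_leq; apply/andP; split.
  rewrite leqNgt; apply/negP => /card_gt2P[D1 [D2 [D3 [[D1S D2S D3S] [D12 D23 D31]]]]].
  have [D1f AD1] := SP _ D1S; have [D2f AD2] := SP _ D2S; have [D3f AD3] := SP _ D3S.
  have [v1 v1A E1] := ext _ D1f AD1; have [v2 v2A E2] := ext _ D2f AD2.
  have [v3 v3A E3] := ext _ D3f AD3; subst D1 D2 D3.
  apply: (no_three_sheets Csub eucl A0 An v1A v2A v3A); try exact: facets_face.
  - by apply: contraNneq D12 => ->.
  - by apply: contraNneq D23 => ->.
  - by apply: contraNneq D31 => ->.
rewrite ltnNge; apply/negP => S1.
apply: (not_boundary_face eucl AC A0 (Fn _ B1f)).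
  by rewrite properEcard AB1 An (Fn _ B1f) ltnSn.
move=> D DC AD; have [D' Df' DD'] := face_in_facet DC.
have D'S : D' \in S by rewrite finset.inE Df' (fintype.subset_trans AD).
by have /card_le1_eqP/(_ D' B1 D'S B1S) -> := S1.
Qed.

Theorem corollary1p8 :
  (forall (T : finType) (C : {set {set T}}),
     flag C -> pseudo_manifold C -> (complex_dim C <= 3)%N -> pure_EKR C) /\
  (forall (R : realType) (T : finType) (C : {set {set T}}),
     flag C -> simplicial_manifold R C -> (complex_dim C <= 3)%N ->
     pure_EKR C).
Proof.
split=> [T C|R T C flagC [sC [n [M [[_ _ _ Meucl] XM]]]] d3].
  exact: flag_pseudo_manifold_EKR.
have eucl p := euclidean_at_manifold p XM Meucl.
case: n Meucl eucl => [|n] _ eucl.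
  apply: point_complex_EKR => // A Af; have [Csub _] := sC.
  exact: (euclidean_facet_card Csub eucl Af (facet_neq0 sC Af)).
exact: flag_pseudo_manifold_EKR flagC (manifold_pseudo_manifold sC eucl) d3.
Qed.
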